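(* Let $\alpha\in(0,1)$ and let $B_\alpha\colon\mathbb{R}\to\mathbb{R}$ denote index-$\alpha$ fractional Brownian motion. Let $I\subset\mathbb{N}$ be a non-empty proper subset, let $F_I$ be the set of irrationals in $(0,1)$ whose continued fraction entries all lie in $I$, and let $h=\dim_{\mathrm H}F_I$. Then: (1) the maps $\theta\mapsto\overline{\dim}_{\theta}B_\alpha(F_I)$ and $\theta\mapsto\underline{\dim}_{\theta}B_\alpha(F_I)$ are almost surely continuous at $\theta=0$; (2) if $\alpha>h$ then almost surely $h/\alpha=\dim_{\mathrm H}B_\alpha(F_I)\le\overline{\dim}_{\mathrm B}B_\alpha(F_I)<1$; (3) if $\alpha\le h$ then almost surely $\dim_{\mathrm H}B_\alpha(F_I)=\dim_{\mathrm B}B_\alpha(F_I)=1$.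
   Context: $\mathbb{N}=\{1,2,3,\ldots\}$ and $|\cdot|$ denotes diameter. $$F_I=\left\{z\in(0,1)\setminus\mathbb{Q}: z=\cfrac{1}{b_1+\cfrac{1}{b_2+\cdots}},\ b_n\in I\text{ for all }n\in\mathbb{N}\right\}.$$ $\dim_{\mathrm H}$, $\overline{\dim}_{\mathrm B}$, $\dim_{\mathrm B}$ are the Hausdorff, upper box and box dimensions (writing $\dim_{\mathrm B}$ means that the upper and lower box dimensions coincide). For $\theta\in(0,1]$ and non-empty bounded $E\subset\mathbb{R}^d$: $\overline{\dim}_{\theta}E$ is the infimum of $s\ge0$ such that for all $\epsilon>0$ there is $\delta_0\in(0,1]$ such that for all $\delta\in(0,\delta_0)$ there is a cover $\{U_1,U_2,\ldots\}$ of $E$ with $\delta^{1/\theta}\le|U_i|\le\delta$ for all $i$ and $\sum_i|U_i|^s\le\epsilon$; $\underline{\dim}_{\theta}E$ is the infimum of $s\ge0$ such that for all $\epsilon>0$ and $\delta_0\in(0,1]$ there exist $\delta\in(0,\delta_0)$ and a cover $\{U_1,U_2,\ldots\}$ of $E$ with $\delta^{1/\theta}\le|U_i|\le\delta$ for all $i$ and $\sum_i|U_i|^s\le\epsilon$. Set $\overline{\dim}_0=\underline{\dim}_0=\dim_{\mathrm H}$. *)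

(* Defs.v *)
From HB Require Import structures.
From mathcomp Require Import all_boot all_order all_algebra.
From mathcomp Require Import all_classical all_reals all_analysis.
Set Implicit Arguments.
Unset Strict Implicit.
Unset Printing Implicit Defensive.
Import Order.TTheory GRing.Theory Num.Theory.
Import numFieldNormedType.Exports.
Local Open Scope classical_set_scope.
Local Open Scope ring_scope.

Section continued_fractions.
Context {R : realType}.

(* [0; b 0, ..., b n.-1]; entries are indexed from 0. *)
Fixpoint cf_convergent (b : nat -> nat) (n : nat) : R :=
  if n is m.+1 then ((b 0%N)%:R + cf_convergent (fun k => b k.+1) m)^-1 else 0.

Definition cf_set (I : set nat) : set R :=
  [set z | [/\ 0 < z < 1, irrational z &
    exists b : nat -> nat,
      (forall n, I (b n)) /\ cf_convergent b n @[n --> \oo] --> z]].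

End continued_fractions.

(* All dimensions are extended real numbers: infima are taken in \bar R, so no
   junk value arises. A countable family is a sequence U restricted to an index
   set D, which allows finite families without padding them with empty sets. *)
Section dimensions.
Context {R : realType}.
Implicit Types (E : set R) (s delta theta : R).
Local Open Scope ereal_scope.

(* The element 0 makes the diameter of the empty set 0 instead of -oo. *)
Definition diam E : \bar R :=
  ereal_sup (0 |` [set `|x - y|%:E | x in E & y in E]).

Definition covers (D : set nat) (U : nat -> set R) E :=
  E `<=` \bigcup_(i in D) U i.

(* For s = 0 an empty member of the family counts as 0 `^ 0 = 1 rather than 0;
   this does not change the infimum, since such members can be dropped. *)
Definition hausdorff_premeasure s delta E : \bar R :=
  ereal_inf [set x | exists (D : set nat) (U : nat -> set R),
    [/\ covers D U E,
        (forall i, D i -> diam (U i) <= delta%:E) &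
        x = \esum_(i in D) diam (U i) `^ s]].

Definition hausdorff_measure s E : \bar R :=
  ereal_sup [set hausdorff_premeasure s delta E | delta in `]0%R, +oo[].

Definition hausdorff_dim E : \bar R :=
  ereal_inf [set s%:E | s in [set s | (0 <= s)%R /\ hausdorff_measure s E = 0]].

(* The least number of sets of diameter at most delta covering E (+oo if there
   is no finite such cover). *)
Definition covering_number delta E : \bar R :=
  ereal_inf [set n%:R%:E | n in [set n : nat | exists U : nat -> set R,
    covers `I_n U E /\ forall i, (i < n)%N -> diam (U i) <= delta%:E]].

Definition box_ratio E delta : \bar R :=
  lne (covering_number delta E) * ((- ln delta)^-1)%:E.

Definition upper_box_dim E : \bar R := limf_esup (box_ratio E) 0%R^'+.

Definition lower_box_dim E : \bar R := limf_einf (box_ratio E) 0%R^'+.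

Definition has_box_dim E (x : \bar R) :=
  lower_box_dim E = x /\ upper_box_dim E = x.

(* E has a cover whose members have diameter in [delta^(1/theta), delta] and
   whose s-th power sum is at most eps. *)
Definition restricted_cover theta s eps delta E :=
  exists (D : set nat) (U : nat -> set R),
    [/\ covers D U E,
        (forall i, D i -> (delta `^ theta^-1)%:E <= diam (U i) <= delta%:E) &
        \esum_(i in D) diam (U i) `^ s <= eps%:E].

Definition upper_intermediate_dim E theta : \bar R :=
  if theta == 0%R then hausdorff_dim E else
  ereal_inf [set s%:E | s in [set s | (0 <= s)%R /\
    forall eps, (0 < eps)%R -> exists delta0, (0 < delta0 <= 1)%R /\
      forall delta, (0 < delta < delta0)%R ->
        restricted_cover theta s eps delta E]].

Definition lower_intermediate_dim E theta : \bar R :=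
  if theta == 0%R then hausdorff_dim E else
  ereal_inf [set s%:E | s in [set s | (0 <= s)%R /\
    forall eps delta0, (0 < eps)%R -> (0 < delta0 <= 1)%R ->
      exists delta, (0 < delta < delta0)%R /\
        restricted_cover theta s eps delta E]].

(* Intermediate dimensions are functions of theta in [0, 1]. *)
Definition continuous_at0 (f : R -> \bar R) :=
  f theta @[theta --> within [set` `[0%R : R, 1%R]] (nbhs (0%R : R))] --> f 0%R.

End dimensions.

Section fractional_brownian_motion.
Context {d : measure_display} {T : measurableType d} {R : realType}.
Variable P : probability T R.

(* normal_prob m 0 is not the point mass at m, which is the degenerate Gaussian
   law needed here. *)
Definition gaussian_law (m sigma : R) (A : set (measurableTypeR R)) : \bar R :=
  if sigma == 0 then dirac m A else normal_prob m sigma A.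

Definition gaussian_process (B : R -> {RV P >-> R}) :=
  forall (n : nat) (a t : 'I_n -> R), exists m sigma : R,
    forall A : set (measurableTypeR R), measurable A ->
      P [set w | A (\sum_(i < n) a i * B (t i) w)] = gaussian_law m sigma A.

(* The covariance at s = t = 0 vanishes, so B 0 = 0 almost surely. *)
Record fractional_brownian_motion (alpha : R) (B : R -> {RV P >-> R}) : Prop := {
  fbm_gaussian : gaussian_process B;
  fbm_centered : forall t, ('E_P[B t] = 0)%E;
  fbm_covariance : forall s t, covariance P (B s) (B t) =
    ((`|s| `^ (2 * alpha) + `|t| `^ (2 * alpha)
        - `|s - t| `^ (2 * alpha)) / 2)%:E;
  fbm_continuous : {ae P, forall w, continuous (fun t : R => B t w : R)}
}.

End fractional_brownian_motion.

(* Main.v *)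
Require Import Defs.
From HB Require Import structures.
From mathcomp Require Import all_boot all_order all_algebra.
From mathcomp Require Import all_classical all_reals all_analysis.
From mathcomp Require Import measurable_realfun ring lra zify.
Set Implicit Arguments.
Unset Strict Implicit.
Unset Printing Implicit Defensive.
Import Order.TTheory GRing.Theory Num.Theory.
Import numFieldNormedType.Exports.
Local Open Scope classical_set_scope.
Local Open Scope ring_scope.

(** Write [F] for the set of continued fractions with digits in [I] and [h] for
its Hausdorff dimension. A finite digit word [w] determines an interval, its
cylinder, whose length is up to a factor 4 the number [cflen w] = q(w)^-2, q(w)
being the denominator of the corresponding convergent; up to the same factor
these numbers are multiplicative under concatenation. Everything is governed by the
convergence or divergence of the series of [cflen w `^ t] over all words.

If the series converges at [t], stop every expansion at its first cylinder of
length at most [d]. The parents of the stopped cylinders are finitely many, and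
below each parent all digits larger than [1/d] fit into one interval of length
[d]; the remaining stopped cylinders have length at least [d^4]. This gives, for every
exponent [s > t] and every small [d], finite covers of [F] by intervals with
radii between [d^4] and [d] and with small [s]-sum: [F] is tame at [s]
([cf_set_tame]).

If the series diverges at [s], then for each [t < s] some finite family of words
of a common length has a large sum of [cflen w `^ t], and the Bernoulli measure
on its free concatenations lives on a compact subset of [F] and has finite
[r]-energy for every [r < t] ([big_block_family_energy]). Finite energy bounds
the Hausdorff dimension from below, so the two alternatives meet exactly at [h]:
[F] is tame at every exponent above [h] ([cf_set_tame_above_dim]) and carries
finite [r]-energy for every [r] below [h] ([cf_set_energy_below_dim]).

Tameness at [s] bounds the Hausdorff dimension and all intermediate dimensions
for [theta <= 1/5] by [s], forces the upper box dimension below 1 when [s < 1],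
and passes through a map that is Hoelder of every exponent below [alpha], which
turns [s] into any exponent above [s/alpha]. By the Kolmogorov-Chentsov argument
([fbm_locally_holder]) the paths of the process are such maps, so the image is
tame above [h/alpha].

In the other direction, the increment over [[s, t]] is a Gaussian variable with
standard deviation [|s - t|^alpha], whence its moment of order [- u] is at most a
constant times [|s - t|^(- u alpha)] for [u < 1]. A measure of finite
[u alpha]-energy on [F] is therefore sent, almost surely, to a measure of finite
[u]-energy, and the image has dimension at least [min 1 (h/alpha)]
([fbm_image_dimension_ge]). Discrete approximations of the measures keep the
argument free of any joint measurability of the process in time and chance.

If [h < alpha], both bounds give [h/alpha] and tameness at an exponent below 1
gives the box dimension. If [alpha <= h], the lower bound is 1, and the image is
bounded, hence tame at every exponent above 1. In both cases the image is tame
at every exponent above its Hausdorff dimension, so its intermediate dimensions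
do not depend on [theta] in [[0, 1/5]], which is more than continuity at 0. *)

(** * Cylinders of continued fractions *)

Section cylinders.
Context {R : realType}.
Implicit Types (w v : seq nat) (b n : nat) (x y : R).

(** The inverse branch [x |-> [0; b_0, ..., b_(n-1) + x]] of the Gauss map. *)
Fixpoint cfmap w x : R :=
  if w is b :: w' then (b%:R + cfmap w' x)^-1 else x.

(** The chain rule makes [cfden w x ^- 2] the absolute derivative of [cfmap w] at
[x]; the recursion avoids a separate treatment of numerators and denominators. *)
Fixpoint cfden w x : R :=
  if w is b :: w' then (b%:R + cfmap w' x) * cfden w' x else 1.

(** Within a factor 4 of the length [1 / (cfden w 0 * cfden w 1)] of the cylinder of
[w], and easier to multiply. *)
Definition cflen w : R := cfden w 0 ^- 2.

Definition pos_word w := all (leq 1) w.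

Lemma cfmap_cat w v x : cfmap (w ++ v) x = cfmap w (cfmap v x).
Proof. by elim: w => //= b w ->. Qed.

Lemma cfden_cat w v x : cfden (w ++ v) x = cfden w (cfmap v x) * cfden v x.
Proof. by elim: w => /= [|b w ->]; rewrite ?mul1r// cfmap_cat mulrA. Qed.

Lemma cfmap_itv w x : pos_word w -> 0 <= x <= 1 -> 0 <= cfmap w x <= 1.
Proof.
move=> + xI; elim: w => //= b w IH /andP[b1 /IH/andP[w0 w1]].
have : 1 <= b%:R :> R by rewrite ler1n.
move=> hb; rewrite invr_ge0 invf_le1; lra.
Qed.

Lemma cfden_ge1 w x : pos_word w -> 0 <= x <= 1 -> 1 <= cfden w x.
Proof.
move=> + xI; elim: w => //= b w IH /andP[b1 pw].
have /andP[w0 w1] := cfmap_itv pw xI.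
have : 1 <= b%:R :> R by rewrite ler1n.
have := IH pw; nra.
Qed.

Lemma cfden_gt0 w x : pos_word w -> 0 <= x <= 1 -> 0 < cfden w x.
Proof. by move=> pw xI; apply: lt_le_trans (cfden_ge1 pw xI). Qed.

(** A Moebius map of determinant 1 or -1 satisfies this exact mean value identity. *)
Lemma cfmap_sub w x y : pos_word w -> 0 <= x <= 1 -> 0 <= y <= 1 ->
  `|cfmap w x - cfmap w y| = `|x - y| / (cfden w x * cfden w y).
Proof.
move=> + xI yI; elim: w => [|b w IH] /=; first by rewrite mulr1 divr1.
move=> /andP[b1 pw].
have /andP[x0 x1] := cfmap_itv pw xI.
have /andP[y0 y1] := cfmap_itv pw yI.
have hb : 1 <= b%:R :> R by rewrite ler1n.
set u := cfmap w x in IH x0 x1 *; set v := cfmap w y in IH y0 y1 *.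
have Hx : 0 < b%:R + u by lra.
have Hy : 0 < b%:R + v by lra.
have -> : (b%:R + u)^-1 - (b%:R + v)^-1 = (v - u) / ((b%:R + u) * (b%:R + v)).
  by field; rewrite !gt_eqF.
rewrite normrM normfV (gtr0_norm (mulr_gt0 Hx Hy)) distrC IH//.
have Dx := cfden_gt0 pw xI; have Dy := cfden_gt0 pw yI.
by field; rewrite !gt_eqF.
Qed.

(** A Moebius map has an affine denominator; the induction needs the numerator
[cfmap w * cfden w] at the same time. *)
Lemma cfden_affine w x : pos_word w -> 0 <= x <= 1 ->
  cfden w x = cfden w 0 + x * (cfden w 1 - cfden w 0) /\
  cfmap w x * cfden w x = cfmap w 0 * cfden w 0 +
     x * (cfmap w 1 * cfden w 1 - cfmap w 0 * cfden w 0).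
Proof.
move=> + xI; have I0 : 0 <= (0:R) <= 1 by rewrite lexx ler01.
have I1 : 0 <= (1:R) <= 1 by rewrite lexx ler01.
elim: w => [|b w IH] /=; first by move=> _; lra.
move=> /andP[b1 pw]; have [IH1 IH2] := IH pw.
have /andP[x0 x1] := cfmap_itv pw xI.
have /andP[y0 y1] := cfmap_itv pw I0.
have /andP[z0 z1] := cfmap_itv pw I1.
have hb : 1 <= b%:R :> R by rewrite ler1n.
rewrite !mulrA !mulVf ?mul1r ?gt_eqF; try lra.
split=> //; rewrite !mulrDl IH2 IH1; ring.
Qed.

(** Bounded distortion. The bound by 2 alone is not inductive, since the numerator
of the empty word vanishes at 0; the sum of numerator and denominator also has
to be controlled. *)
Lemma cfden1_le w : pos_word w -> cfden w 0 <= cfden w 1 <= 2 * cfden w 0.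
Proof.
have I0 : 0 <= (0:R) <= 1 by rewrite lexx ler01.
have I1 : 0 <= (1:R) <= 1 by rewrite lexx ler01.
move=> pw.
suff : [/\ cfden w 0 <= cfden w 1,
   cfden w 1 <= 2 * cfden w 0,
   cfden w 0 + cfmap w 0 * cfden w 0 <= cfden w 1 + cfmap w 1 * cfden w 1 &
  cfden w 1 + cfmap w 1 * cfden w 1 <= 2 * (cfden w 0 + cfmap w 0 * cfden w 0)].
  by case=> -> ->.
elim: w pw => [|b w IH] /=; first by move=> _; split; lra.
move=> /andP[b1 pw]; have [IH0 IH1 IH2 IH3] := IH pw.
have /andP[y0 y1] := cfmap_itv pw I0.
have /andP[z0 z1] := cfmap_itv pw I1.
have hb : 1 <= b%:R :> R by rewrite ler1n.
rewrite !mulrA !mulVf ?mul1r ?gt_eqF; try lra.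
have H0 : 0 <= (b%:R - 1) * (cfden w 1 - cfden w 0) by apply: mulr_ge0; lra.
have H1 : 0 <= (b%:R - 1) * (2 * cfden w 0 - cfden w 1) by apply: mulr_ge0; lra.
split; lra.
Qed.

Lemma cfden_le w x : pos_word w -> 0 <= x <= 1 ->
  cfden w 0 <= cfden w x <= 2 * cfden w 0.
Proof.
move=> pw xI; have [-> _] := cfden_affine pw xI.
have := cfden1_le pw; nra.
Qed.

(** One digit need not enlarge the denominator (the digit 1), but two digits double
it: [(a + 1/(b+y)) (b+y) >= b + y + 1 >= 2]. *)
Lemma cfden_double (a b : nat) w : pos_word [:: a, b & w] ->
  2 * cfden w 0 <= cfden [:: a, b & w] 0.
Proof.
move=> /= /and3P[a1 b1 pw].
have I0 : 0 <= (0:R) <= 1 by rewrite lexx ler01.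
have := cfden_gt0 pw I0; move: (cfden w 0) => q q0.
have /andP[y0 y1] := cfmap_itv pw I0; move: (cfmap w 0) y0 y1 => y y0 y1.
have ha : 1 <= a%:R :> R by rewrite ler1n.
have hb : 1 <= b%:R :> R by rewrite ler1n.
have -> : (a%:R + (b%:R + y)^-1) * ((b%:R + y) * q) = (a%:R * (b%:R + y) + 1) * q.
  by field; rewrite gt_eqF; lra.
rewrite ler_pM2r//; nra.
Qed.

Lemma cflen_gt0 w : pos_word w -> 0 < cflen w.
Proof.
move=> pw; rewrite /cflen invr_gt0 exprn_gt0// cfden_gt0//.
by rewrite lexx ler01.
Qed.

Lemma cflen_le w : pos_word w -> cflen w <= 2 * (2^-1) ^+ size w.
Proof.
move=> pw; rewrite /cflen exprVn -[2 in X in X / _]invrK -invfM.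
have I0 : 0 <= (0:R) <= 1 by rewrite lexx ler01.
rewrite lef_pV2 ?posrE ?mulr_gt0 ?invr_gt0 ?exprn_gt0 ?cfden_gt0//.
(* Induction on the length by steps of two. *)
suff : forall n w, (size w <= n)%N -> pos_word w -> 2 ^-1 * 2 ^+ size w <= cfden w 0 ^+ 2.
  by apply=> //; exact: (leqnn).
move=> {w pw} n; elim: n => [|n IH] w; first by case: w => //= _ _; lra.
case: w => [|a [|b w]] /=; [by move=> *; lra| |].
- move=> _ /andP[a1 _]; rewrite expr1 mulVf// addr0 mulr1.
  by have : 1 <= a%:R :> R; [rewrite ler1n | nra].
- rewrite !ltnS => sw pw.
  have h2 := cfden_double pw.
  have pw' : pos_word w by move: pw => /= /and3P[].
  have h1 := IH w (ltnW sw) pw'.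
  have h3 := cfden_ge1 pw' I0.
  have h4 : (2 * cfden w 0) ^+ 2 <= cfden [:: a, b & w] 0 ^+ 2.
    by rewrite ler_sqr ?nnegrE//; lra.
  rewrite -[(a%:R + _) * _]/(cfden [:: a, b & w] 0).
  apply: le_trans h4; rewrite 2!exprS; lra.
Qed.

Lemma cflen_cat w v : pos_word w -> pos_word v ->
  cflen w * cflen v / 4 <= cflen (w ++ v) <= cflen w * cflen v.
Proof.
move=> pw pv; rewrite /cflen cfden_cat.
have I0 : 0 <= (0:R) <= 1 by rewrite lexx ler01.
have vI := cfmap_itv pv I0.
have := cfden_le pw vI; have := cfden_ge1 pw vI; have := cfden_ge1 pv I0.
have := cfden_ge1 pw I0.
move: (cfden w _) (cfden w _) (cfden v _) => p q r p1 r1 q1 /andP[pq qp].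
apply/andP; split.
- rewrite -!invfM lef_pV2 ?posrE ?mulr_gt0 ?exprn_gt0//; try lra.
  rewrite [leRHS]mulrAC exprMn ler_pM2r ?exprn_gt0//; nra.
- rewrite -!invfM lef_pV2 ?posrE ?mulr_gt0 ?exprn_gt0//; try lra.
  rewrite exprMn ler_pM2r ?exprn_gt0//; nra.
Qed.

Lemma cfmap_sub_le w x y : pos_word w -> 0 <= x <= 1 -> 0 <= y <= 1 ->
  `|x - y| * cflen w / 4 <= `|cfmap w x - cfmap w y| <= `|x - y| * cflen w.
Proof.
move=> pw xI yI; rewrite cfmap_sub// /cflen.
have I0 : 0 <= (0:R) <= 1 by rewrite lexx ler01.
have := cfden_le pw xI; have := cfden_le pw yI.
have := cfden_ge1 pw xI; have := cfden_ge1 pw yI; have := cfden_ge1 pw I0.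
move: (cfden w 0) (cfden w x) (cfden w y) => p q r p1 r1 q1 /andP[pr rp] /andP[pq qp].
rewrite -mulrA; apply/andP; split; apply: ler_wpM2l => //.
- rewrite -!invfM lef_pV2 ?posrE ?mulr_gt0 ?exprn_gt0//; try lra.
  nra.
- rewrite lef_pV2 ?posrE ?mulr_gt0 ?exprn_gt0//; try lra.
  nra.
Qed.

End cylinders.

(** * Infinite continued fractions *)

Section coding.
Context {R : realType}.
Implicit Types (b : nat -> nat) (n m : nat).

Lemma exp_half_lt (e : R) : 0 < e -> exists N, forall n, (N <= n)%N -> 2 * 2^-1 ^+ n < e.
Proof.
move=> e0.
have : 2 * 2^-1 ^+ n @[n --> \oo] --> (2 * 0 : R).
  by apply: cvgMr; apply: cvg_expr; rewrite ger0_norm ?invr_ge0//; lra.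
rewrite mulr0 => /cvgrPdist_lt /(_ _ e0)[N _ HN]; exists N => n Nn.
by have := HN n Nn; rewrite /= sub0r normrN ger0_norm// mulr_ge0// exprn_ge0// invr_ge0.
Qed.

Definition shiftn n b : nat -> nat := fun k => b (n + k)%N.

Definition pos_digits b := forall n, (0 < b n)%N.

Lemma pos_shiftn n b : pos_digits b -> pos_digits (shiftn n b).
Proof. by move=> hb k; apply: hb. Qed.

Lemma pos_mkseq b n : pos_digits b -> pos_word (mkseq b n).
Proof. by move=> hb; apply/allP => _ /mapP[k _ ->]. Qed.

Lemma mkseqS_shift b n : mkseq b n.+1 = b 0%N :: mkseq (shiftn 1 b) n.
Proof. by rewrite /mkseq /= -[1%N]add1n iotaDl -map_comp. Qed.

Lemma mkseq_add b n m : mkseq b (n + m) = mkseq b n ++ mkseq (shiftn n b) m.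
Proof. by rewrite /mkseq iotaD map_cat add0n -[in iota n m](addn0 n) iotaDl -map_comp. Qed.

Lemma cf_convergentE b n : cf_convergent b n = cfmap (mkseq b n) 0 :> R.
Proof. by elim: n b => // n IH b; rewrite mkseqS_shift /= IH. Qed.

Lemma cf_convergent_cat b n m : cf_convergent b (n + m) =
  cfmap (mkseq b n) (cf_convergent (shiftn n b) m) :> R.
Proof. by rewrite !cf_convergentE mkseq_add cfmap_cat. Qed.

Lemma cf_convergent_itv b n : pos_digits b -> 0 <= (cf_convergent b n : R) <= 1.
Proof.
move=> hb; rewrite cf_convergentE; apply: cfmap_itv; first exact: pos_mkseq.
by rewrite lexx ler01.
Qed.

(** Both convergents lie in the cylinder of the first [n] digits. *)
Lemma cf_convergent_dist b n m : pos_digits b -> (n <= m)%N ->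
  `|(cf_convergent b n : R) - cf_convergent b m| <= 2 * 2^-1 ^+ n.
Proof.
move=> hb nm; rewrite -(subnKC nm) cf_convergent_cat cf_convergentE.
have I0 : 0 <= (0:R) <= 1 by rewrite lexx ler01.
have pw := pos_mkseq n hb.
have /andP[x0 x1] := @cf_convergent_itv (shiftn n b) (m - n) (pos_shiftn n hb).
apply: (le_trans (proj2 (andP (@cfmap_sub_le _ _ _ _ pw I0 _)))); first by rewrite x0 x1.
apply: le_trans (_ : 1 * cflen (mkseq b n) <= _).
  rewrite ler_wpM2r ?(ltW (cflen_gt0 _))//.
  by rewrite sub0r normrN ger0_norm.
by rewrite mul1r (le_trans (cflen_le pw))// size_mkseq.
Qed.

(** For positive digits the limit exists ([cfval_cvg]). *)
Definition cfval b : R := lim (cf_convergent b n @[n --> \oo]).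

Lemma cfval_cvg b : pos_digits b -> cf_convergent b n @[n --> \oo] --> cfval b.
Proof.
move=> hb; suff : cvgn (cf_convergent b : R^nat) by [].
apply/cauchy_cvgP/cauchy_exP => e e0.
have [N HN] := exp_half_lt e0.
exists (cf_convergent b N); exists N => // m /= Nm.
rewrite /ball_ /=; apply: le_lt_trans (HN N (leqnn _)).
exact: cf_convergent_dist.
Qed.

Lemma cfval_itv b : pos_digits b -> 0 <= cfval b <= 1.
Proof.
move=> hb; have hc := cfval_cvg hb; apply/andP; split.
- apply: limr_ge; first by apply: cvgP hc.
  by apply: nearW => n; case/andP: (@cf_convergent_itv b n hb).
- apply: limr_le; first by apply: cvgP hc.
  by apply: nearW => n; case/andP: (@cf_convergent_itv b n hb).
Qed.

Lemma cfval_cons b : pos_digits b -> cfval b = ((b 0%N)%:R + cfval (shiftn 1 b))^-1.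
Proof.
move=> hb; have hc := cfval_cvg hb.
have hs := pos_shiftn 1 hb.
have hc' := cfval_cvg hs.
have /andP[v0 v1] := cfval_itv hs.
have b1 : 1 <= (b 0%N)%:R :> R by rewrite ler1n.
have : cf_convergent b n.+1 @[n --> \oo] --> ((b 0%N)%:R + cfval (shiftn 1 b))^-1.
  apply: cvgV; first by rewrite gt_eqF//; lra.
  by apply: cvgD; [exact: cvg_cst|exact: hc'].
move/(cvg_lim (@norm_hausdorff _ _)) => <-; apply/esym/(cvg_lim (@norm_hausdorff _ _)).
by rewrite -cvg_shiftS in hc; exact: hc.
Qed.

Lemma cfval_shift b n : pos_digits b ->
  cfval b = cfmap (mkseq b n) (cfval (shiftn n b)).
Proof.
elim: n b => [|n IH] b hb; first by congr cfval; apply/funext.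
rewrite mkseqS_shift /= cfval_cons// IH; last exact: pos_shiftn.
by congr (_ + cfmap _ _)^-1; congr cfval; apply/funext => k; rewrite /shiftn add1n addSn.
Qed.

(** The first digit bounds the value below; applied to the tail, it keeps values
away from 1 as well. *)
Lemma cfval_ge b (D : nat) : pos_digits b -> (b 0 <= D)%N ->
  (D.+1%:R)^-1 <= cfval b.
Proof.
move=> hb bD; rewrite cfval_cons//.
have /andP[v0 v1] := cfval_itv (pos_shiftn 1 hb).
have b1 : 1 <= (b 0%N)%:R :> R by rewrite ler1n.
have bD' : (b 0%N)%:R <= D%:R :> R by rewrite ler_nat.
by rewrite lef_pV2 ?posrE; rewrite -?natr1; lra.
Qed.

Lemma cfval_gt0 b : pos_digits b -> 0 < cfval b.
Proof. by move=> hb; apply: lt_le_trans (cfval_ge hb (leqnn _)); rewrite invr_gt0. Qed.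

Lemma cfval_lt1 b : pos_digits b -> cfval b < 1.
Proof.
move=> hb; rewrite cfval_cons//.
have v0 := cfval_gt0 (pos_shiftn 1 hb).
have b1 : 1 <= (b 0%N)%:R :> R by rewrite ler1n.
by rewrite invf_lt1; lra.
Qed.

(** Infinite descent: if the value is p/q with p < q, the tail of the expansion has
the value q/p - b_0, a fraction with the smaller denominator p. *)
Lemma cfval_irrational b : pos_digits b -> irrational (cfval b).
Proof.
move=> hb [r _ rb].
suff H : forall q b p, pos_digits b -> (0 < q)%N -> cfval b * q%:R = p%:~R -> False.
  have : cfval b * `|denq r|%:R = (numq r)%:~R.
    rewrite -rb /ratr.
    have -> : `|denq r|%:R = (denq r)%:~R :> R by rewrite pmulrn gez0_abs ?denq_ge0.
    by rewrite divfK// intr_eq0 denq_eq0.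
  by apply: H => //; rewrite absz_gt0 denq_eq0.
clear r rb hb b; elim/ltn_ind => q IH b p hb q0 e.
have v0 := cfval_gt0 hb; have v1 := cfval_lt1 hb.
have vs0 := cfval_gt0 (pos_shiftn 1 hb).
have q0' : 0 < q%:R :> R by rewrite ltr0n.
have p0 : (0 < p)%R by rewrite -(ltr0z R) -e mulr_gt0.
case: p p0 e => // p p0 e; rewrite -pmulrn in e.
have pq : (p < q)%N by rewrite -(ltr_nat R) -e; nra.
apply: (IH p pq (shiftn 1 b) (q%:Z - (b 0%N)%:Z * p%:Z) (pos_shiftn 1 hb)) => //.
rewrite rmorphB rmorphM /= -!pmulrn -e (cfval_cons hb).
have b1 : 1 <= (b 0%N)%:R :> R by rewrite ler1n.
by field; rewrite gt_eqF//; lra.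
Qed.

Lemma cf_setE (I : set nat) : I `<=` [set n | (0 < n)%N] ->
  cf_set I = cfval @` [set b | forall n, I (b n)] :> set R.
Proof.
move=> Ipos; apply/seteqP; split=> z.
- move=> [_ _ [b [bI bz]]]; exists b => //.
  by apply: cvg_lim bz; exact: norm_hausdorff.
- move=> [b /= bI <-]; have hb : pos_digits b by move=> n; apply: Ipos.
  split; first by rewrite cfval_gt0// cfval_lt1.
    exact: cfval_irrational.
  by exists b; split=> //; exact: cfval_cvg.
Qed.

Lemma cfval_dist b n x : pos_digits b -> 0 <= x <= 1 ->
  `|cfval b - cfmap (mkseq b n) x| <= cflen (mkseq b n).
Proof.
move=> hb xI; rewrite (cfval_shift n hb).
have pw := pos_mkseq n hb.
have vI := cfval_itv (pos_shiftn n hb).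
apply: le_trans (proj2 (andP (cfmap_sub_le pw vI xI))) _.
rewrite ler_piMl ?(ltW (cflen_gt0 _))//.
move: vI xI; rewrite ler_norml; lra.
Qed.

(** For distinct digits [p] and [q], the points [1/(p+v)] and [1/(q+u)] come close only
if [u] or [v] is close to 1, which the hypotheses exclude. *)
Lemma inv_add_separated (E p q u v : R) :
  0 <= u <= 1 - (E + 2)^-1 -> 0 <= v <= 1 - (E + 2)^-1 ->
  1 <= p <= E -> 1 <= q <= E -> 1 <= `|q - p| ->
  (E + 2)^-1 / (E + 2) ^+ 2 <= `|(p + v)^-1 - (q + u)^-1|.
Proof.
move=> uI vI pI qI pq.
have E0 : 0 < (E + 2)^-1 by rewrite invr_gt0; move: pI; clear; lra.
have [u1 v1] : u <= 1 /\ v <= 1.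
  by move: (_^-1) uI vI E0 => y; clear; lra.
have quv : (E + 2)^-1 <= `|(q - p) - (v - u)|.
  have uv : `|v - u| <= 1 - (E + 2)^-1.
    by move: (_^-1) uI vI => y; clear; rewrite ler_norml; lra.
  have := lerB_dist (q - p) (v - u).
  by move: (_^-1) uv pq => y; clear; lra.
have pv : 0 < p + v by move: pI vI; clear; lra.
have qu : 0 < q + u by move: qI uI; clear; lra.
have -> : (p + v)^-1 - (q + u)^-1 = ((q - p) - (v - u)) / ((p + v) * (q + u)).
  by field; rewrite !gt_eqF.
rewrite normrM normfV (gtr0_norm (mulr_gt0 pv qu)).
apply: ler_pM => //; [exact: ltW|by rewrite invr_ge0 sqr_ge0|].
rewrite lef_pV2 ?posrE ?exprn_gt0 ?mulr_gt0//; last by move: pI; clear; lra.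
by rewrite expr2; apply: ler_pM; try exact: ltW; move: pI qI u1 v1; clear; lra.
Qed.

(** Two expansions with bounded digits that split after a common prefix are at a
distance comparable to the cylinder of that prefix. Bounded digits are essential:
they keep the two tails away from the endpoints 0 and 1, where neighbouring
cylinders touch. *)
Lemma cfval_separated (a b : nat -> nat) (D i : nat) :
  pos_digits a -> pos_digits b ->
  (forall k, (a k <= D)%N) -> (forall k, (b k <= D)%N) ->
  mkseq a i = mkseq b i -> a i <> b i ->
  cflen (mkseq a i) <= 4 * D.+2%:R ^+ 3 * `|cfval a - cfval b|.
Proof.
move=> ha hb aD bD ab abi.
have ha' := pos_shiftn i ha; have hb' := pos_shiftn i hb.
rewrite (cfval_shift i ha) (cfval_shift i hb) -ab.
have pw := pos_mkseq i ha.
have /andP[+ _] := cfmap_sub_le pw (cfval_itv ha') (cfval_itv hb').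
set d := `|cfmap _ _ - _|; have l0 := cflen_gt0 pw (R := R); move: (cflen _) l0 => l l0.
rewrite (cfval_cons ha') (cfval_cons hb').
have b0 k : 1 <= (b k)%:R :> R by rewrite ler1n.
have a0 k : 1 <= (a k)%:R :> R by rewrite ler1n.
have aD' k : (a k)%:R <= D%:R :> R by rewrite ler_nat.
have bD' k : (b k)%:R <= D%:R :> R by rewrite ler_nat.
have Hy (c : nat -> nat) : pos_digits c -> (forall k, (c k <= D)%N) ->
   0 <= cfval c <= 1 - (D.+2%:R)^-1.
  move=> hc cD; rewrite cfval_cons//.
  have hv := cfval_ge (pos_shiftn 1 hc) (cD 1%N : shiftn 1 c 0%N <= D)%N.
  have c1 : 1 <= (c 0%N)%:R :> R by rewrite ler1n.
  have D0 : 0 < D.+1%:R^-1 :> R by rewrite invr_gt0.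
  have D1 : 0 < D.+1%:R :> R by [].
  rewrite -(natr1 D.+1); move: (D.+1%:R : R) D1 hv D0 => z D1 hv D0.
  rewrite invr_ge0 addr_ge0 ?(le_trans (ltW D0) hv) ?(le_trans ler01 c1)//=.
  apply: le_trans (_ : (1 + z^-1)^-1 <= _).
    move: (z^-1) hv D0 => y hv D0; by rewrite lef_pV2 ?posrE; lra.
  have -> : (1 + z^-1)^-1 = 1 - (z + 1)^-1 :> R.
    by field; rewrite ?gt_eqF//; lra.
  by [].
have /andP[] := Hy (shiftn 1 (shiftn i a)) (pos_shiftn 1 ha') (fun=> aD _).
have /andP[] := Hy (shiftn 1 (shiftn i b)) (pos_shiftn 1 hb') (fun=> bD _).
move: (cfval _) (cfval _) => v u u0 u1 v0 v1; rewrite /shiftn addn0.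
have := a0 i; have := b0 i; have := aD' i; have := bD' i.
have : 1 <= `|(b i)%:R - (a i)%:R| :> R.
  rewrite ler_normr; have : (b i < a i)%N || (a i < b i)%N by move: abi; lia.
  by case/orP; rewrite -(ler_nat R) -natr1 => h; apply/orP; [right|left]; lra.
have : 0 < D.+2%:R^-1 :> R by rewrite invr_gt0.
have : D%:R + 2 = D.+2%:R :> R by rewrite -natrD addn2.
move: ((a i)%:R : R) ((b i)%:R : R) => p q; move=> E; move: (D.+2%:R) E u1 v1 => z <-{z}.
move: (D%:R) => E u1 v1 E0 pq Hq Hp q1 p1.
move=> Hd.
have H0 : (E + 2)^-1 / (E + 2) ^+ 2 <= `|(p + v)^-1 - (q + u)^-1|.
  by apply: inv_add_separated; rewrite ?u0 ?v0 ?p1 ?q1.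
have H1 : (E + 2)^-1 / (E + 2) ^+ 2 * l / 4 <= d.
  by apply: le_trans Hd; rewrite ler_pM2r// ler_pM2r.
have E2 : 0 < E + 2 by move: p1 Hp; clear; lra.
have -> : l = 4 * (E + 2) ^+ 3 * ((E + 2)^-1 / (E + 2) ^+ 2 * l / 4).
  by field; rewrite gt_eqF.
by rewrite ler_pM2l// mulr_gt0// exprn_gt0.
Qed.

End coding.

(** * Real powers and finite enumeration *)

Section real_powers.
Context {R : realType}.

Lemma powR_le_small (x e : R) : 0 < x -> 0 < e ->
  exists d0, 0 < d0 <= 1 /\ forall d, 0 < d < d0 -> d `^ x <= e.
Proof.
move=> x0 e0; exists (Order.min 1 (e `^ x^-1)); split.
  by rewrite lt_min ltr01 powR_gt0//= ge_min lexx.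
move=> d /andP[d0]; rewrite lt_min => /andP[_ de].
have -> : e = (e `^ x^-1) `^ x by rewrite -powRrM mulVf ?gt_eqF// powRr1// ltW.
by apply: ge0_ler_powR; rewrite ?nnegrE ?powR_ge0// ltW.
Qed.

Lemma powR_le_split (x y s t : R) : 0 < x -> x <= y -> t <= s ->
  x `^ s <= x `^ t * y `^ (s - t).
Proof.
move=> x0 xy ts; rewrite -[in leLHS](subrKC t s) [leLHS]powRD ?(gt_eqF x0) ?implybT//.
rewrite ler_wpM2l ?powR_ge0//.
apply: ge0_ler_powR => //; rewrite ?nnegrE ?subr_ge0 ?(ltW x0)//.
exact: le_trans (ltW x0) xy.
Qed.

Lemma powRN_le (a b r : R) : 0 <= r -> 0 < a -> a <= b -> b `^ (- r) <= a `^ (- r).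
Proof.
move=> r0 a0 ab; have b0 := lt_le_trans a0 ab.
rewrite !powRN lef_pV2 ?posrE ?powR_gt0//.
by apply: ge0_ler_powR; rewrite ?nnegrE ?(ltW a0) ?(ltW b0).
Qed.

Lemma geometric_sum_le (x : R) n : 0 <= x < 1 -> \sum_(i < n) x ^+ i <= (1 - x)^-1.
Proof.
move=> /andP[x0 x1]; have x10 : 0 < 1 - x by rewrite subr_gt0.
rewrite -(ler_pM2l x10) divff ?gt_eqF// -opprB mulNr -subrX1 opprB.
by rewrite lerBlDr lerDl exprn_ge0.
Qed.

Lemma half_powR_itv (a : R) : 0 < a -> 0 <= 2^-1 `^ a < (1 : R).
Proof.
move=> a0; rewrite powR_ge0 /=; have := gt0_ltr_powR a0 (x := 2^-1) (y := 1 : R).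
by rewrite !nnegrE powR1; apply; rewrite ?invr_ge0 ?invf_lt1 ?ltr1n.
Qed.

End real_powers.

(** A predicate whose duplicate-free lists of solutions have bounded length has
finitely many solutions: a list of maximal length contains them all. *)
Lemma bounded_size_enum (T : choiceType) (Q : T -> Prop) (N : nat) :
  (forall L : seq T, uniq L -> (forall x, x \in L -> Q x) -> (size L <= N)%N) ->
  exists2 L : seq T, uniq L & forall x, x \in L <-> Q x.
Proof.
move=> HN.
pose A k := `[< exists L : seq T, [/\ uniq L, forall x, x \in L -> Q x & size L = k] >].
have A0 : exists k, A k by exists 0%N; apply/asboolP; exists [::].
have AN k : A k -> (k <= N)%N by move=> /asboolP[L [uL QL <-]]; exact: HN.
case: (ex_maxnP A0 AN) => k /asboolP[L [uL QL Lk]] kmax.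
exists L => // x; split; first exact: QL.
move=> Qx; apply/negPn/negP => xL.
have : A k.+1.
  apply/asboolP; exists (x :: L); split; rewrite ?Lk//=.
  - by rewrite xL.
  - by move=> y; rewrite inE => /orP[/eqP ->//|]; exact: QL.
  - by rewrite Lk.
by move=> /kmax; rewrite ltnn.
Qed.

(** * Tame covers and the convergent case *)

Section tame_covers.
Context {R : realType}.
Implicit Types (E : set R) (s t : R) (I : set nat).

(** The lower bound [d ^+ 4] on the radii is what distinguishes this from a bound on
Hausdorff measure. Any fixed power would do; 4 is the one that the continued
fractions provide. Only finite families are used, so that sums are plain sums. *)
Definition tame_cover E s := forall eps : R, 0 < eps ->
  exists d0 : R, 0 < d0 <= 1 /\ forall d, 0 < d < d0 ->
  exists L : seq (R * R),
    [/\ forall x, E x -> exists2 u, u \in L & `|x - u.1| <= u.2,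
        forall u, u \in L -> d ^+ 4 <= u.2 <= d &
        \sum_(u <- L) u.2 `^ s <= eps].

Definition word_in I (w : seq nat) := forall b, b \in w -> I b.

(** Finite partial sums stand for the series over the countable set of words. *)
Definition words_summable I t (M : R) := forall L : seq (seq nat),
  uniq L -> (forall w, w \in L -> word_in I w) ->
  \sum_(w <- L) (cflen w : R) `^ t <= M.

Lemma word_in_pos I w : I `<=` [set n | (0 < n)%N] -> word_in I w -> pos_word w.
Proof. by move=> Ipos wI; apply/allP => b /wI /Ipos. Qed.

Lemma word_in_mkseq I (b : nat -> nat) n : (forall k, I (b k)) -> word_in I (mkseq b n).
Proof. by move=> bI c /mapP[k _ ->]. Qed.

Lemma cflen_le1 w : pos_word w -> (cflen w : R) <= 1.
Proof.
move=> pw; rewrite /cflen invf_le1 ?exprn_gt0 ?cfden_gt0 ?lexx ?ler01//.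
by apply: exprn_ege1; rewrite cfden_ge1 ?lexx ?ler01.
Qed.

(** A summable family has finitely many terms above any threshold. *)
Lemma long_cylinders_finite I t M (d : R) : I `<=` [set n | (0 < n)%N] -> 0 <= t ->
  words_summable I t M -> 0 < d ->
  exists2 W : seq (seq nat), uniq W & forall w, w \in W <-> word_in I w /\ d < cflen w.
Proof.
move=> Ipos t0 HM d0.
apply: (@bounded_size_enum _ _ (Num.truncn (M / d `^ t))) => L uL HL.
have dt : 0 < d `^ t by rewrite powR_gt0.
have sL : (size L)%:R * d `^ t <= M.
  apply: le_trans (HM L uL (fun w wL => proj1 (HL w wL))).
  have -> : (size L)%:R * d `^ t = \sum_(w <- L) d `^ t.
    by rewrite big_const_seq count_predT iter_addr_0 mulr_natl.
  rewrite big_seq [leRHS]big_seq.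
  apply: ler_sum => w /HL [wI dw]; apply: ge0_ler_powR => //; rewrite ?nnegrE ?ltW//.
  by rewrite (lt_trans d0).
have M0 : 0 <= M by apply: le_trans sL; rewrite mulr_ge0// ltW.
by rewrite Num.Theory.truncn_ge_nat ?divr_ge0 ?(ltW dt)// ler_pdivlMr.
Qed.

(** An expansion is stopped at its first cylinder of length at most [d]; its parent
is longer than [d] and there are finitely many such parents. If the last digit is
at most [1/d], the stopped cylinder is longer than [d^3/4 >= d^4]. All other
children of a parent lie within [d] of its end point, and one interval of length
[d] covers them. Both families have [s]-sum at most [d^(s-t)] times the sum of the
series at [t]. *)
Lemma cf_set_tame I t s M : I `<=` [set n | (0 < n)%N] -> 0 <= t -> t < s ->
  words_summable I t M -> tame_cover (cf_set I) s.
Proof.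
move=> Ipos t0 ts HM eps eps0.
have M1 : 0 < `|M| + 1 by rewrite ltr_wpDl.
have st0 : 0 < s - t by rewrite subr_gt0.
have e0 : 0 < eps / (2 * (`|M| + 1)) by rewrite divr_gt0// mulr_gt0.
have [d1 [/andP[d10 d11] Hd1]] := powR_le_small st0 e0.
exists (Order.min d1 4^-1); split.
  apply/andP; split; first by rewrite lt_min d10 /= invr_gt0 ltr0n.
  by rewrite ge_min d11.
move=> d /andP[d0]; rewrite lt_min => /andP[dd1 d4].
have dI : 0 < d < d1 by rewrite d0 dd1.
have {Hd1} Hd := Hd1 d dI.
have [W uW HW] := long_cylinders_finite Ipos t0 HM d0.
(* Digits up to [B] get their own cylinder, larger ones are lumped together. *)
pose B := Num.truncn d^-1.
have di0 : 0 < d^-1 by rewrite invr_gt0.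
have /andP[B1 B2] := Num.Theory.truncn_itv (ltW di0).
pose C := [seq rcons w c | w <- W, c <- iota 0 B.+1].
have uC : uniq C.
  apply: allpairs_uniq => //; first exact: iota_uniq.
  by move=> [w c] [w' c'] _ _ /= /rcons_inj[-> ->].
pose V := [seq v <- C | `[< word_in I v /\ d ^+ 4 <= cflen v <= d >] ].
pose L1 := [seq (cfmap v 0 : R, cflen v : R) | v <- V].
pose L2 := [seq (cfmap w 0 : R, d) | w <- W].
have d_4 : d ^+ 4 <= d.
  by rewrite (exprS d 3) ler_piMr ?(ltW d0)// exprn_ile1 ?(ltW d0)//; lra.
exists (L1 ++ L2); split.
- move=> z; rewrite cf_setE// => -[b bI <-{z}].
  have hb : pos_digits b by move=> k; apply: Ipos; apply: bI.
  have ex : exists n, (cflen (mkseq b n) : R) <= d.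
    have [N HN] := exp_half_lt d0; exists N; apply: le_trans (ltW (HN N (leqnn N))).
    by rewrite (le_trans (cflen_le (pos_mkseq N hb)))// size_mkseq.
  (* The empty word has length 1 > d, so at least one digit has been read. *)
  case: (ex_minnP ex) => -[|m].
    by rewrite /= /cflen expr1n invr1 => h; exfalso; lra.
  move=> hm mmin.
  have dm : d < cflen (mkseq b m).
    by rewrite ltNge; apply/negP => /mmin; rewrite ltnn.
  have mW : mkseq b m \in W by apply/HW; split=> //; exact: word_in_mkseq.
  have I0 : 0 <= (0:R) <= 1 by rewrite lexx ler01.
  have pm := pos_mkseq m hb.
  have [bB|Bb] := leqP (b m) B.
  + exists (cfmap (mkseq b m.+1) 0, cflen (mkseq b m.+1)); last first.
      exact: cfval_dist.
    rewrite mem_cat; apply/orP; left; apply/mapP; exists (mkseq b m.+1) => //.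
    rewrite mem_filter; apply/andP; split; last first.
      rewrite mkseqS; apply/allpairsP; exists (mkseq b m, b m); split=> //.
      by rewrite mem_iota add0n ltnS.
    apply/asboolP; split; first exact: word_in_mkseq.
    rewrite hm andbT mkseqS -cats1.
    have pb : pos_word [:: b m] by rewrite /= hb.
    apply: le_trans (proj1 (andP (cflen_cat pm pb))).
    have lb : d ^+ 2 <= cflen [:: b m].
      rewrite /cflen /= addr0 mulr1 -exprVn ler_sqr ?nnegrE ?invr_ge0 ?(ltW d0)//.
      rewrite -[d]invrK lef_pV2 ?posrE ?invr_gt0 ?ltr0n ?hb//.
      by rewrite (le_trans _ B1)// ler_nat.
    apply: le_trans (_ : d * d ^+ 2 / 4 <= _).
      have -> : d ^+ 4 = d * d ^+ 2 * d by rewrite -exprS -exprSr.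
      by rewrite ler_wpM2l ?mulr_ge0 ?sqr_ge0 ?(ltW d0) ?(ltW d4).
    rewrite ler_pM2r ?invr_gt0 ?ltr0n//.
    by apply: ler_pM; rewrite ?sqr_ge0 ?(ltW d0) ?(ltW dm).
  (* The digit exceeds [1/d]: the point is within [1/(b m) <= d] of the end point. *)
  + exists (cfmap (mkseq b m) 0, d) => /=.
      by rewrite mem_cat; apply/orP; right; apply/mapP; exists (mkseq b m).
    have hs := pos_shiftn m hb; have hs' := pos_shiftn 1 hs.
    rewrite (cfval_shift m hb).
    apply: le_trans (proj2 (andP (cfmap_sub_le pm (cfval_itv hs) I0))) _.
    rewrite subr0 (gtr0_norm (cfval_gt0 hs)).
    apply: le_trans (_ : cfval (shiftn m b) * 1 <= _).
      by rewrite ler_wpM2l ?cflen_le1// ltW// cfval_gt0.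
    rewrite mulr1 (cfval_cons hs) /shiftn addn0 -/(shiftn m b) -/(shiftn 1 _).
    rewrite -[leRHS]invrK lef_pV2 ?posrE ?invr_gt0//; last first.
      by rewrite ltr_pwDl ?ltr0n// ltW// cfval_gt0.
    apply: le_trans (ltW B2) _; apply: le_trans (_ : (b m)%:R <= _).
      by rewrite ler_nat.
    by rewrite lerDl ltW// cfval_gt0.
- move=> u; rewrite mem_cat => /orP[] /mapP[v + ->] /=.
    by rewrite mem_filter => /andP[/asboolP[_ ->]].
  by rewrite d_4 lexx.
have Hs (x : seq (seq nat)) : uniq x -> (forall w, w \in x -> word_in I w) ->
    d `^ (s - t) * \sum_(w <- x) (cflen w : R) `^ t <= eps / 2.
  move=> ux xI; have hx := HM x ux xI.
  apply: le_trans (_ : (eps / (2 * (`|M| + 1))) * (`|M| + 1) <= _).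
    apply: ler_pM; rewrite ?powR_ge0//.
      by apply: sumr_ge0 => ? _; exact: powR_ge0.
    by apply: le_trans hx _; have := ler_norm M; lra.
  by rewrite invfM mulrA divfK ?gt_eqF.
rewrite big_cat /= [leRHS](splitr eps); apply: lerD.
- rewrite big_map /=; apply: le_trans (Hs V _ _); last 2 first.
  + by rewrite filter_uniq.
  + by move=> w; rewrite mem_filter => /andP[/asboolP[]].
  rewrite mulr_sumr big_seq [leRHS]big_seq; apply: ler_sum => v.
  rewrite mem_filter => /andP[/asboolP[vI /andP[_ vd]] _].
  rewrite mulrC; apply: powR_le_split => //; last exact: ltW.
  exact: cflen_gt0 (word_in_pos Ipos vI).
- rewrite big_map /=; apply: le_trans (Hs W uW _); last by move=> w /HW[].
  rewrite mulr_sumr big_seq [leRHS]big_seq; apply: ler_sum => w /HW[wI dw].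
  apply: le_trans (powR_le_split d0 (lexx d) (ltW ts)) _.
  rewrite mulrC ler_wpM2l ?powR_ge0//.
  by apply: ge0_ler_powR; rewrite ?nnegrE ?(ltW d0) ?(ltW (lt_trans d0 dw))// ltW.
Qed.

End tame_covers.

(** * Inequalities between the dimensions *)

Section dimension_lemmas.
Context {R : realType}.
Implicit Types (E : set R) (s t : R).
Local Open Scope ereal_scope.

Lemma diam_ge0 E : 0 <= diam E.
Proof. by apply: ereal_sup_ubound; left. Qed.

Lemma diam_ge E x y : E x -> E y -> `|x - y|%:E <= diam E.
Proof. by move=> Ex Ey; apply: ereal_sup_ubound; right; exists x => //; exists y. Qed.

Lemma diam_le E (r : R) : (0 <= r)%R -> (forall x y, E x -> E y -> `|x - y| <= r)%R ->
  diam E <= r%:E.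
Proof.
move=> r0 H; apply: ge_ereal_sup => _ [->|[x Ex [y Ey <-]]]; first by rewrite lee_fin.
by rewrite lee_fin H.
Qed.

Lemma diam_interval (c r : R) : (0 <= r)%R -> diam [set x | `|x - c| <= r]%R = (2 * r)%:E.
Proof.
move=> r0; apply/eqP; rewrite eq_le; apply/andP; split.
  apply: diam_le; first by rewrite mulr_ge0.
  move=> x y /=; rewrite !ler_norml; lra.
have -> : (2 * r = `|(c + r) - (c - r)|)%R.
  by rewrite ger0_norm; lra.
by apply: diam_ge => /=; rewrite ler_norml; lra.
Qed.

Lemma esum_ord n (f : nat -> \bar R) : (forall i, (i < n)%N -> 0 <= f i) ->
  \esum_(i in `I_n) f i = \sum_(i < n) f i.
Proof.
move=> f0; rewrite esum_fset; first by rewrite -fsbig_ord.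
- exact: finite_II.
- by move=> i; rewrite inE; exact: f0.
Qed.

Lemma hausdorff_dim_ge0 E : 0 <= hausdorff_dim E.
Proof. by apply: le_ereal_inf_tmp => _ [s [s0 _] <-]; rewrite lee_fin. Qed.

Lemma hausdorff_measure_eq0 E s :
  (forall d eps : R, (0 < d)%R -> (0 < eps)%R -> exists (D : set nat) (U : nat -> set R),
     [/\ covers D U E, forall i, D i -> diam (U i) <= d%:E &
         \esum_(i in D) diam (U i) `^ s <= eps%:E]) ->
  hausdorff_measure s E = 0.
Proof.
move=> H; apply/eqP; rewrite eq_le; apply/andP; split.
- apply: ge_ereal_sup => _ [d /= + <-]; rewrite in_itv/= andbT => d0.
  apply/lee_addgt0Pr => eps eps0; rewrite add0e.
  have [D [U [cU dU sU]]] := H d eps d0 eps0.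
  by apply: ge_ereal_inf; exists (\esum_(i in D) diam (U i) `^ s) => //; exists D, U.
- apply: le_trans (_ : hausdorff_premeasure s 1 E <= _); last first.
    by apply: ereal_sup_ubound; exists 1%R => //=; rewrite in_itv/= ltr01.
  apply: le_ereal_inf_tmp => _ [D [U [_ _ ->]]].
  by apply: esum_ge0 => i _; exact: poweR_ge0.
Qed.

Lemma hausdorff_dim_le E s : (0 <= s)%R ->
  (forall d eps : R, (0 < d)%R -> (0 < eps)%R -> exists (D : set nat) (U : nat -> set R),
     [/\ covers D U E, forall i, D i -> diam (U i) <= d%:E &
         \esum_(i in D) diam (U i) `^ s <= eps%:E]) ->
  hausdorff_dim E <= s%:E.
Proof.
move=> s0 H; apply: ereal_inf_lbound; exists s => //; split=> //.
exact: hausdorff_measure_eq0.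
Qed.

Lemma hausdorff_dim_mono (K E : set R) : K `<=` E -> hausdorff_dim K <= hausdorff_dim E.
Proof.
move=> KE; apply: le_ereal_inf_tmp => _ [s [s0 Hs] <-]; apply: ereal_inf_lbound.
exists s => //; split=> //; apply/eqP; rewrite eq_le; apply/andP; split.
  rewrite -Hs; apply: ge_ereal_sup => _ [d dI <-].
  apply: (@le_trans _ _ (hausdorff_premeasure s d E)).
    apply: le_ereal_inf_tmp => _ [D [U [cU dU ->]]]; apply: ereal_inf_lbound.
    by exists D, U; split=> //; apply: subset_trans cU.
  by apply: ereal_sup_ubound; exists d.
apply: (@le_trans _ _ (hausdorff_premeasure s 1 K)); last first.
  by apply: ereal_sup_ubound; exists 1%R => //=; rewrite in_itv/= ltr01.
apply: le_ereal_inf_tmp => _ [D [U [_ _ ->]]].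
by apply: esum_ge0 => i _; exact: poweR_ge0.
Qed.

(** Restricted covers are covers, and scales with small sums may be chosen
arbitrarily fine. *)
Lemma hausdorff_le_lower_intermediate E theta :
  hausdorff_dim E <= lower_intermediate_dim E theta.
Proof.
rewrite /lower_intermediate_dim; case: ifPn => // _.
apply: le_ereal_inf_tmp => _ [s [s0 Hs] <-].
apply: hausdorff_dim_le => // d eps d0 eps0.
have [|dl [/andP[dl0 dl1] [D [U [cU dU sU]]]]] := Hs eps (Order.min d 1%R) eps0.
  by rewrite lt_min d0 ltr01 ge_min lexx orbT.
exists D, U; split=> // i Di; case/andP: (dU i Di) => _ h.
by apply: le_trans h _; rewrite lee_fin ltW// (lt_le_trans dl1)// ge_min lexx.
Qed.

Lemma lower_intermediate_le_upper E theta :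
  lower_intermediate_dim E theta <= upper_intermediate_dim E theta.
Proof.
rewrite /lower_intermediate_dim /upper_intermediate_dim; case: ifPn => // _.
apply: le_ereal_inf_tmp => _ [s [s0 Hs] <-].
apply: ereal_inf_lbound; exists s => //; split=> // eps d0 eps0 /andP[d00 d01].
have [d1 [/andP[d10 d11] H]] := Hs eps eps0.
have m0 : (0 < Order.min d0 d1)%R by rewrite lt_min d00.
exists (Order.min d0 d1 / 2)%R; split.
  rewrite divr_gt0//= (@lt_le_trans _ _ (Order.min d0 d1))%R//; last by rewrite ge_min lexx.
  by rewrite ltr_pdivrMr// ltr_pMr// ltr1n.
apply: H; rewrite divr_gt0//= (@lt_le_trans _ _ (Order.min d0 d1))%R//.
  by rewrite ltr_pdivrMr// ltr_pMr// ltr1n.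
by rewrite ge_min lexx orbT.
Qed.

(** An interval of radius [r] in [[(d/2)^4, d/2]] has diameter in
[[d^4/8, d]], and [d^4/8 >= d^5 >= d^(1/theta)] as soon as [d <= 1/8]. *)
Lemma tame_cover_upper_intermediate E s theta : (0 <= s)%R -> (0 < theta <= 5^-1)%R ->
  tame_cover E s -> upper_intermediate_dim E theta <= s%:E.
Proof.
move=> s0 /andP[t0 t5] HE; rewrite /upper_intermediate_dim gt_eqF//.
apply: ereal_inf_lbound; exists s => //; split=> // eps eps0.
have e0 : (0 < eps / 2 `^ s)%R by rewrite divr_gt0// powR_gt0.
have [d1 [/andP[d10 d11] H]] := HE _ e0.
exists (Order.min d1 8^-1)%R; split.
  apply/andP; split; first by rewrite lt_min d10 /= invr_gt0 ltr0n.
  by rewrite ge_min d11.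
move=> d /andP[d0]; rewrite lt_min => /andP[dd1 d8].
have dI : (0 < d / 2 < d1)%R.
  rewrite divr_gt0//= (lt_trans _ dd1)//.
  by rewrite ltr_pdivrMr// ltr_pMr// ltr1n.
have [L [cL rL sL]] := H _ dI.
pose r i := (nth (0, 0) L i)%R.
have rI i : (i < size L)%N -> ((d / 2) ^+ 4 <= (r i).2 <= d / 2)%R.
  by move=> iL; apply: rL; exact: mem_nth.
have r0 i : (i < size L)%N -> (0 <= (r i).2)%R.
  by move=> /rI /andP[+ _]; apply: le_trans; rewrite exprn_ge0// ltW// divr_gt0.
exists `I_(size L), (fun i => [set x | `|x - (r i).1| <= (r i).2]%R); split.
- move=> x /cL[u /(nthP (0, 0)%R)[i iL <-] xu]; exists i => //.
- move=> i iL; rewrite diam_interval ?r0// !lee_fin.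
  have /andP[h1 h2] := rI i iL; apply/andP; split; last by lra.
  apply: le_trans (_ : d ^+ 5 <= _)%R.
    rewrite -powR_mulrn ?(ltW d0)//; apply: ger_powR.
      by rewrite d0 (le_trans (ltW d8))// invf_le1 ?ltr0n// ler1n.
    by rewrite -[leLHS]invrK lef_pV2 ?posrE ?invr_gt0 ?ltr0n.
  apply: le_trans (_ : 2 * (d / 2) ^+ 4 <= _)%R; last by rewrite ler_wpM2l.
  have -> : (2 * (d / 2) ^+ 4 = d ^+ 4 * 8^-1)%R by field.
  by rewrite exprSr ler_wpM2l ?exprn_ge0 ?ltW.
- rewrite esum_ord; last by move=> i _; exact: poweR_ge0.
  apply: le_trans (_ : (2 `^ s * \sum_(u <- L) u.2 `^ s)%:E <= _).
    rewrite (big_nth (0, 0)%R) big_mkord mulr_sumr -sumEFin; apply: lee_sum => i _.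
    by rewrite diam_interval ?r0// poweR_EFin lee_fin powRM ?r0.
  by rewrite lee_fin mulrC -ler_pdivlMr// powR_gt0.
Qed.

Lemma tame_cover_hausdorff_dim (E : set R) (s : R) : (0 <= s)%R -> tame_cover E s ->
  hausdorff_dim E <= s%:E.
Proof.
move=> s0 HE; apply: le_trans (hausdorff_le_lower_intermediate _ 5^-1%R) _.
apply: le_trans (lower_intermediate_le_upper _ _) _.
by apply: tame_cover_upper_intermediate; rewrite ?invr_gt0 ?ltr0n ?lexx.
Qed.

Lemma at_right0_itv (e : R) : (0 < e)%R -> (0%R : R)^'+ [set d | 0 < d < e]%R.
Proof.
by move=> e0; apply: filterS2 (nbhs_right_gt 0%R) (nbhs_right_lt e0) => d /= -> ->.
Qed.

(** The box dimension is defined through covering numbers; an exact power bound on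
the cardinality of some cover suffices, constants being absorbed in the exponent. *)
Lemma upper_box_dim_le E (u d0 : R) : (0 < d0)%R ->
  (forall d, (0 < d < d0)%R -> exists (n : nat) (U : nat -> set R),
     [/\ covers `I_n U E, forall i, (i < n)%N -> (diam (U i) <= d%:E)%E &
        n%:R <= d `^ (- u)]%R) ->
  upper_box_dim E <= u%:E.
Proof.
move=> d00 H; rewrite /upper_box_dim limf_esupE.
apply: ge_ereal_inf; exists (ereal_sup (box_ratio E @` [set d : R | 0 < d < Order.min d0 1]%R)).
  exists [set d : R | 0 < d < Order.min d0 1]%R => //.
  by apply: at_right0_itv; rewrite lt_min d00 ltr01.
apply: ge_ereal_sup => _ [d /= + <-] => /andP[dpos].
rewrite lt_min => /andP[dd0 d1].
have dI : (0 < d < d0)%R by rewrite dpos dd0.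
have [n [U [cU dU nU]]] := H d dI.
have ld : (0 < - ln d)%R by rewrite oppr_gt0 ln_lt0// dpos d1.
rewrite /box_ratio lee_pdivrMr//.
apply: le_trans (_ : lne (d `^ (- u))%:E <= _); last first.
  by rewrite lne_EFin ?powR_gt0// ln_powR -EFinM lee_fin mulNr mulrN.
have N0 : 0 <= covering_number d E.
  by apply: le_ereal_inf_tmp => _ [k _ <-]; rewrite lee_fin.
have Nn : covering_number d E <= (d `^ (- u))%:E.
  apply: ge_ereal_inf; exists n%:R%:E; last by rewrite lee_fin.
  by exists n => //; exists U.
rewrite lee_lne ?Nn// in_itv/=; first by rewrite N0 leey.
by rewrite lee_fin powR_ge0 leey.
Qed.

Lemma lower_box_le_upper E : lower_box_dim E <= upper_box_dim E.
Proof.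
rewrite /lower_box_dim /upper_box_dim limf_einfE limf_esupE.
apply: ge_ereal_sup => _ [V FV <-]; apply: le_ereal_inf_tmp => _ [W FW <-].
have /filter_ex[d [Vd Wd]] : (0%R : R)^'+ (V `&` W) by exact: filterI.
apply: le_trans (_ : box_ratio E d <= _).
  by apply: ereal_inf_lbound; exists d.
by apply: ereal_sup_ubound; exists d.
Qed.

Lemma lee_real_gt (x y : \bar R) : (forall r : R, x < r%:E -> y <= r%:E) -> y <= x.
Proof.
case: x => [x| |] H; last 2 first.
- exact: leey.
- case: y H => [y| |] H //; last by have := H 0%R (ltNyr 0%R).
  by have := H (y - 1)%R (ltNyr (y - 1)%R); rewrite lee_fin leNgt ltrBlDr ltrDl ltr01.
apply/lee_addgt0Pr => e e0; rewrite -EFinD; apply: H.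
by rewrite lte_fin ltrDl.
Qed.

(** At arbitrarily small scales [d] at most [d^-r] sets of diameter [d] suffice, with
[r']-sum at most [d^(r'-r)]. Nonemptiness makes the covering numbers at least 1 and
thus [r] nonnegative; for the empty set the lower box dimension is [-oo]. *)
Lemma hausdorff_le_lower_box E : E !=set0 -> hausdorff_dim E <= lower_box_dim E.
Proof.
move=> [x0 Ex0]; apply: lee_real_gt => r rE; apply: lee_real_gt => r'.
rewrite lte_fin => rr'.
have small (d0 : R) : (0 < d0)%R -> exists d (n : nat) (U : nat -> set R),
    [/\ (0 < d < d0)%R, covers `I_n U E, forall i, (i < n)%N -> (diam (U i) <= d%:E)%E,
       (0 < n)%N & n%:R <= d `^ (- r)]%R.
  move=> d00.
  have V0 : (0%R : R)^'+ [set d : R | 0 < d < Order.min d0 1]%R.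
    by apply: at_right0_itv; rewrite lt_min d00 ltr01.
  have : ereal_inf (box_ratio E @` [set d : R | 0 < d < Order.min d0 1]%R) < r%:E.
    apply: le_lt_trans rE; rewrite /lower_box_dim limf_einfE.
    by apply: ereal_sup_ubound; exists [set d : R | 0 < d < Order.min d0 1]%R.
  move=> /ereal_inf_lt[_ [d /= + <-]] => /andP[dpos].
  rewrite lt_min => /andP[dd0 d1].
  have ld : (0 < - ln d)%R by rewrite oppr_gt0 ln_lt0// dpos d1.
  rewrite /box_ratio lte_pdivrMr// => Hl.
  have N0 : 0 <= covering_number d E.
    by apply: le_ereal_inf_tmp => _ [k _ <-]; rewrite lee_fin.
  have : covering_number d E < (d `^ (- r))%:E.
    rewrite -lte_lne; first by rewrite lne_EFin ?powR_gt0// ln_powR mulNr -mulrN EFinM.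
    + by rewrite in_itv/= N0 leey.
    + by rewrite in_itv/= lee_fin powR_ge0 leey.
  move=> /ereal_inf_lt[_ [n [U [cU dU]] <-]]; rewrite lte_fin => nd.
  exists d, n, U; split=> //; [by rewrite dpos| |exact: ltW].
  by have [i /= iN _] := cU _ Ex0; apply: leq_ltn_trans iN.
(* A negative exponent would force an empty cover. *)
have r0 : (0 <= r)%R.
  have [d [n [U [/andP[d0 d1] cU dU n0 nd]]]] := small 1%R ltr01.
  have n1 : (1 <= n%:R :> R)%R by rewrite ler1n.
  rewrite leNgt; apply/negP => rneg.
  have rn : (0 < - r)%R by rewrite oppr_gt0.
  have := gt0_ltr_powR rn _ _ d1; rewrite !nnegrE (ltW d0) ler01 powR1 => /(_ isT isT).
  by rewrite ltNge (le_trans n1).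
apply: hausdorff_dim_le; first by rewrite (le_trans r0)// ltW.
move=> d eps d0 eps0.
have r'r : (0 < r' - r)%R by rewrite subr_gt0.
have [d1 [/andP[d10 _] Hd1]] := powR_le_small r'r eps0.
have [|e [n [U [/andP[e0 eI] cU eU n0 ne]]]] := small (Order.min d d1).
  by rewrite lt_min d0.
exists `I_n, U; split=> //.
- move=> i iN; apply: le_trans (eU i iN) _; rewrite lee_fin ltW//.
  by rewrite (lt_le_trans eI)// ge_min lexx.
- rewrite esum_ord; last by move=> i _; exact: poweR_ge0.
  apply: le_trans (_ : (\sum_(i < n) (e `^ r')%:E)%E <= _).
    apply: lee_sum => i _; rewrite -poweR_EFin; apply: gt0_ler_poweR.
    + by rewrite (le_trans r0)// ltW.
    + by rewrite in_itv/= diam_ge0 leey.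
    + by rewrite in_itv/= lee_fin (ltW e0) leey.
    + exact: eU.
  rewrite sumEFin lee_fin sumr_const card_ord -mulr_natl.
  apply: le_trans (_ : e `^ (- r) * e `^ r' <= _)%R.
    by rewrite ler_wpM2r ?powR_ge0.
  rewrite -powRD ?(gt_eqF e0) ?implybT// addrC Hd1// e0/=.
  by rewrite (lt_le_trans eI)// ge_min lexx orbT.
Qed.

End dimension_lemmas.

(** * Consequences of tameness *)

Section cover_lemmas.
Context {R : realType}.
Implicit Types (E : set R) (s : R).

(** Centers spaced by [2 d] from the left end of the interval. *)
Lemma interval_subdivision (c rho d : R) : 0 <= rho -> 0 < d ->
  exists C : seq R, (size C)%:R <= rho / d + 1 /\
    forall x, `|x - c| <= rho -> exists2 z, z \in C & `|x - z| <= d.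
Proof.
move=> rho0 d0; have q0 : 0 <= rho / d by rewrite divr_ge0// ltW.
have /andP[n1 n2] := Num.Theory.truncn_itv q0.
set n := Num.truncn _ in n1 n2.
exists [seq c - rho + (2 * k%:R + 1) * d | k <- iota 0 n.+1]; split.
  by rewrite size_map size_iota -natr1 lerD2r.
move=> x xc; pose y := (x - c + rho) / (2 * d).
have y0 : 0 <= y by move: xc; rewrite ler_norml => /andP[h _]; rewrite divr_ge0 ?mulr_ge0 ?(ltW d0)//; lra.
have /andP[k1 k2] := Num.Theory.truncn_itv y0.
set k := Num.truncn _ in k1 k2.
have dd : 0 < 2 * d by rewrite mulr_gt0.
have ey : x - c + rho = y * (2 * d) by rewrite divfK// gt_eqF.
exists (c - rho + (2 * k%:R + 1) * d).
  apply/mapP; exists k => //; rewrite mem_iota add0n /= ltnS -(ler_nat R).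
  apply: le_trans (_ : n%:R <= _) => //; rewrite ler_nat -ltnS -(ltr_nat R).
  apply: le_lt_trans k1 _; apply: le_lt_trans n2.
  rewrite ler_pdivrMr// mulrCA divfK ?gt_eqF//.
  by move: xc; rewrite ler_norml; lra.
have -> : x - (c - rho + (2 * k%:R + 1) * d) = (2 * y - 2 * k%:R - 1) * d.
  by rewrite (_ : x = y * (2 * d) + c - rho); [ring|rewrite -ey; ring].
rewrite normrM (gtr0_norm d0) ler_piMl ?(ltW d0)//.
by move: k1 k2; rewrite -natr1 ler_norml; lra.
Qed.

Lemma list_cover_upper_box E (u d0 : R) : 0 < d0 ->
  (forall d, 0 < d < d0 -> exists C : seq R,
     (forall x, E x -> exists2 z, z \in C & `|x - z| <= d / 2) /\
     (size C)%:R <= d `^ (- u)) ->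
  (upper_box_dim E <= u%:E)%E.
Proof.
move=> d00 H; apply: (upper_box_dim_le d00) => d dI.
have [C [cC sC]] := H d dI; have /andP[dpos _] := dI.
exists (size C), (fun i => [set x | `|x - nth 0 C i| <= d / 2]); split=> //.
- by move=> x /cC[z /(nthP 0)[i iC <-] xz]; exists i.
- move=> i _; rewrite diam_interval; last by rewrite divr_ge0// ltW.
  by rewrite mulrC divfK// lexx.
Qed.

Lemma seq_valued_choice (A : eqType) (B : Type) (L : seq A) (Q : A -> seq B -> Prop) :
  (forall a, a \in L -> exists c, Q a c) ->
  exists f : A -> seq B, forall a, a \in L -> Q a (f a).
Proof.
move=> H.
have H' a : exists c, a \in L -> Q a c.
  by case: (boolP (a \in L)) => [/H[c]|_]; [exists c|exists [::]].
by have [f Hf] := boolp.choice H'; exists f.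
Qed.

(** Subdivide a tame cover at scale [d] into pieces of length [e = d^4]. An interval
of radius [r] needs at most [3 r/e] pieces, and [r <= d^(1-s) r^s] because
[r <= d]; the gain [d^(1-s) = e^((1-s)/4)] is a power of [e]. *)
Lemma tame_cover_upper_box E s : s < 1 -> tame_cover E s ->
  (upper_box_dim E <= (1 - (1 - s) / 4)%:E)%E.
Proof.
move=> s1 HE.
have [d1 [/andP[d10 d11] H]] := HE 5^-1 ltac:(by rewrite invr_gt0 ltr0n).
apply: (@list_cover_upper_box _ _ (d1 ^+ 4)); first by rewrite exprn_gt0.
move=> e /andP[e0 ed].
pose d := e `^ 4^-1; have d0 : 0 < d by rewrite powR_gt0.
have d4 : d ^+ 4 = e.
  by rewrite -powR_mulrn ?powR_ge0// -powRrM mulVf ?powRr1 ?ltW// pnatr_eq0.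
have dd1 : d < d1 by rewrite -(@ltr_pXn2r _ 4) ?nnegrE ?(ltW d0) ?(ltW d10)// d4.
have [L [cL rL sL]] := H d ltac:(by rewrite d0 dd1).
pose Q (u : R * R) (c : seq R) := (size c)%:R <= u.2 / (e / 2) + 1 /\
    forall x, `|x - u.1| <= u.2 -> exists2 z, z \in c & `|x - z| <= e / 2.
have [f Hf] : exists f, forall u, u \in L -> Q u (f u).
  apply: seq_valued_choice => u uL; apply: interval_subdivision; last by rewrite divr_gt0.
  by have /andP[h _] := rL u uL; apply: le_trans h; rewrite exprn_ge0// ltW.
exists (flatten (map f L)); split.
  move=> x /cL[u uL xu]; have [_ /(_ x xu)[z zf xz]] := Hf u uL.
  by exists z => //; apply/flatten_mapP; exists u.
have -> : (size (flatten (map f L)))%:R = \sum_(u <- L) (size (f u))%:R :> R.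
  by rewrite size_flatten /shape -map_comp sumnE big_map natr_sum.
apply: le_trans (_ : \sum_(u <- L) 3 / e * (d `^ (1 - s) * u.2 `^ s) <= _).
  rewrite big_seq [leRHS]big_seq; apply: ler_sum => u uL.
  have [h1 _] := Hf u uL; have /andP[h2 h3] := rL u uL; rewrite d4 in h2.
  have u0 : 0 < u.2 by apply: lt_le_trans h2.
  apply: (le_trans h1).
  apply: le_trans (_ : 3 / e * u.2 <= _).
    have -> : u.2 / (e / 2) + 1 = (2 * u.2 + e) / e by field; rewrite gt_eqF.
    rewrite [leRHS]mulrAC ler_pM2r ?invr_gt0//; lra.
  rewrite ler_wpM2l ?divr_ge0 ?(ltW e0)//.
  have := @powR_le_split R u.2 d 1 s u0 h3 (ltW s1).
  by rewrite powRr1 ?(ltW u0)// mulrC.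
rewrite -!mulr_sumr.
apply: le_trans (_ : 3 / e * (d `^ (1 - s) * 5^-1) <= _).
  by rewrite ler_wpM2l ?divr_ge0 ?(ltW e0)// ler_wpM2l ?powR_ge0.
have -> : e `^ (- (1 - (1 - s) / 4)) = e^-1 * d `^ (1 - s).
  rewrite opprB addrC powRD ?(gt_eqF e0) ?implybT// powR_inv1 ?(ltW e0)//.
  by rewrite /d -powRrM [4^-1 * _]mulrC.
move: (d `^ (1 - s)) (powR_ge0 d (1 - s)) => D D0.
have -> : 3 / e * (D * 5^-1) = (3 / 5) * (e^-1 * D) by ring.
rewrite ler_piMl ?mulr_ge0 ?invr_ge0 ?(ltW e0)//.
by rewrite ler_pdivrMr ?ltr0n// mul1r ler_nat.
Qed.

(** A bounded set needs of order [1/d] intervals of length [d]. *)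
Lemma bounded_tame_cover E s (M : R) : 1 < s -> (forall x, E x -> `|x| <= M) ->
  tame_cover E s.
Proof.
move=> s1 EM eps eps0.
have M1 : 0 < `|M| + 1 by rewrite ltr_wpDl.
have s0 : 0 < s - 1 by rewrite subr_gt0.
have e0 : 0 < eps / (`|M| + 1) by rewrite divr_gt0.
have [d1 [/andP[d10 d11] Hd1]] := powR_le_small s0 e0.
exists d1; split; first by rewrite d10.
move=> d /andP[d0 dd1].
have dlt1 : d <= 1 by rewrite (le_trans (ltW dd1)).
have [C [sC cC]] := @interval_subdivision 0 `|M| d (normr_ge0 _) d0.
exists [seq (z, d) | z <- C]; split.
- move=> x Ex; have [|z zC xz] := cC x; first by rewrite subr0 (le_trans (EM x Ex))// ler_norm.
  by exists (z, d) => //; apply/mapP; exists z.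
- move=> u /mapP[z _ ->] /=; rewrite lexx andbT.
  by rewrite (exprS d 3) ler_piMr ?(ltW d0)// exprn_ile1 ?(ltW d0).
- rewrite big_map /= big_const_seq count_predT iter_addr_0 -mulr_natl.
  apply: le_trans (_ : (`|M| / d + 1) * d `^ s <= _); first by rewrite ler_wpM2r ?powR_ge0.
  have -> : d `^ s = d * d `^ (s - 1).
    by rewrite -[X in X * _]powRr1 ?(ltW d0)// -powRD ?(gt_eqF d0) ?implybT// subrKC.
  rewrite mulrA mulrDl divfK ?gt_eqF// mul1r.
  apply: le_trans (_ : (`|M| + 1) * (eps / (`|M| + 1)) <= _).
    apply: ler_pM; rewrite ?powR_ge0 ?addr_ge0 ?(ltW d0)//; first by rewrite lerD2l.
    by rewrite Hd1// d0.
  by rewrite mulrCA divff ?mulr1// gt_eqF.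
Qed.

Lemma bounded_upper_box E (M : R) : (forall x, E x -> `|x| <= M) ->
  (upper_box_dim E <= 1)%E.
Proof.
move=> EM; apply: lee_real_gt => u; rewrite lte_fin => u1.
have M1 : 0 < 2 * `|M| + 1 by rewrite ltr_wpDl// mulr_ge0.
have s0 : 0 < u - 1 by rewrite subr_gt0.
have e0 : 0 < (2 * `|M| + 1)^-1 by rewrite invr_gt0.
have [d1 [/andP[d10 d11] Hd1]] := powR_le_small s0 e0.
apply: (list_cover_upper_box d10) => d /andP[d0 dd1].
have d20 : 0 < d / 2 by rewrite divr_gt0.
have [C [sC cC]] := @interval_subdivision 0 `|M| (d / 2) (normr_ge0 _) d20.
exists C; split.
  by move=> x Ex; apply: cC; rewrite subr0 (le_trans (EM x Ex))// ler_norm.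
apply: (le_trans sC).
have Hd := Hd1 d ltac:(by rewrite d0 dd1).
have -> : d `^ (- u) = d^-1 * (d `^ (u - 1))^-1.
  by rewrite -powRN opprB -[d^-1]powR_inv1 ?(ltW d0)// -powRD ?(gt_eqF d0) ?implybT// addKr.
apply: le_trans (_ : d^-1 * (2 * `|M| + 1) <= _).
  have -> : `|M| / (d / 2) + 1 = d^-1 * (2 * `|M| + d) by field; rewrite gt_eqF.
  by rewrite ler_wpM2l ?invr_ge0 ?(ltW d0)// lerD2l (le_trans (ltW dd1)).
rewrite ler_wpM2l ?invr_ge0 ?(ltW d0)// -[leLHS]invrK lef_pV2 ?posrE ?powR_gt0//.
Qed.

(** Images of intervals of radius [r] have radius at most a constant times [r^g'],
which is below [r^g] for small [r]; radius exactly [r^g] is used, so that the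
constraint between [d^4] and [d] is preserved literally at the scale [d^g]. *)
Lemma tame_cover_holder E (f : R -> R) (s g g' C h0 : R) :
  0 < g -> g < g' -> 0 < C -> 0 < h0 ->
  (forall x y, E x -> E y -> `|x - y| <= h0 -> `|f x - f y| <= C * `|x - y| `^ g') ->
  tame_cover E s -> tame_cover (f @` E) (s / g).
Proof.
move=> g0 gg' C0 h00 Hf HE eps eps0.
have g'0 : 0 < g' by exact: lt_trans gg'.
have [d1 [/andP[d10 d11] Hd1]] := HE eps eps0.
have gg : 0 < g' - g by rewrite subr_gt0.
have e0 : 0 < (C * 2 `^ g')^-1 by rewrite invr_gt0 mulr_gt0// powR_gt0.
have [d2 [/andP[d20 d21] Hd2]] := powR_le_small gg e0.
pose m := Order.min d1 (Order.min d2 (h0 / 2)).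
have m0 : 0 < m by rewrite !lt_min d10 d20 divr_gt0.
have m1 : m <= 1 by rewrite ge_min d11.
have gV : 0 < g^-1 by rewrite invr_gt0.
exists (m `^ g); split.
  rewrite powR_gt0//=; have := ge0_ler_powR (ltW g0) _ _ m1.
  by rewrite !nnegrE (ltW m0) ler01 powR1; apply.
move=> e /andP[e0' em].
pose d := e `^ g^-1; have d0 : 0 < d by rewrite powR_gt0.
have dg : d `^ g = e by rewrite /d -powRrM mulVf ?gt_eqF// powRr1// ltW.
have dm : d < m.
  rewrite ltNge; apply/negP => /(ge0_ler_powR (ltW g0)).
  by rewrite !nnegrE (ltW d0) (ltW m0) dg => /(_ isT isT); rewrite leNgt em.
have [dd1 dd2 dh] : [/\ d < d1, d < d2 & d < h0 / 2].
  by move: dm; rewrite !lt_min => /andP[-> /andP[-> ->]].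
have [L [cL rL sL]] := Hd1 d ltac:(by rewrite d0 dd1).
(* Recenter each interval at a point of [E], where [f] is controlled. *)
have [c Hc] : exists c : R * R -> R, forall u, forall x, E x -> `|x - u.1| <= u.2 ->
    E (c u) /\ `|c u - u.1| <= u.2.
  suff H u : exists c, forall x, E x -> `|x - u.1| <= u.2 -> E c /\ `|c - u.1| <= u.2.
    by have [c Hc] := boolp.choice H; exists c.
  have [[c [Ec cu]]|nE] := pselect (exists c, E c /\ `|c - u.1| <= u.2); first by exists c.
  by exists 0 => x Ex xu; exfalso; apply: nE; exists x.
exists [seq (f (c u), u.2 `^ g) | u <- L]; split.
- move=> _ [x Ex <-]; have [u uL xu] := cL x Ex; have [Ec cu] := Hc u x Ex xu.
  exists (f (c u), u.2 `^ g); first by apply/mapP; exists u.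
  have /andP[u1 u2] := rL u uL.
  have u0 : 0 < u.2 by apply: lt_le_trans u1; rewrite exprn_gt0.
  have xc : `|x - c u| <= 2 * u.2.
    by move: xu cu; rewrite !ler_norml; lra.
  have xh : `|x - c u| <= h0 by lra.
  apply: le_trans (Hf x (c u) Ex Ec xh) _ => /=.
  apply: le_trans (_ : C * (2 * u.2) `^ g' <= _).
    by rewrite ler_wpM2l ?(ltW C0)//; apply: ge0_ler_powR; rewrite ?nnegrE ?(ltW g'0) ?mulr_ge0 ?(ltW u0).
  rewrite powRM ?(ltW u0)// mulrA -(subrK g g') [u.2 `^ _]powRD ?(gt_eqF u0) ?implybT// mulrA subrK.
  rewrite ler_piMl ?powR_ge0// -ler_pdivlMl ?mulr_gt0 ?powR_gt0// mulr1.
  by apply: Hd2; rewrite u0 (le_lt_trans u2).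
- move=> _ /mapP[u uL ->] /=; have /andP[u1 u2] := rL u uL.
  have d4 : 0 <= d ^+ 4 by rewrite exprn_ge0// ltW.
  have u0 : 0 <= u.2 by apply: le_trans u1.
  have -> : e ^+ 4 = (d ^+ 4) `^ g.
    by rewrite -dg -(powR_mulrn 4 (powR_ge0 d g)) -(powR_mulrn 4 (ltW d0)) powRAC.
  by rewrite -[in X in _ && X]dg; apply/andP; split; apply: ge0_ler_powR; rewrite ?nnegrE ?(ltW g0) ?(ltW d0).
- rewrite big_map /=; apply: le_trans sL; rewrite le_eqVlt; apply/orP; left; apply/eqP.
  by apply: eq_bigr => u _; rewrite -powRrM mulrCA divff ?mulr1// gt_eqF.
Qed.
End cover_lemmas.

(** * Energy and Hausdorff dimension *)

Section energy.
Context {R : realType}.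

Lemma sum_fiber_seq (A : finType) (L : seq nat) (c : A -> nat) (F : A -> nat -> R) :
  uniq L -> (forall a, c a \in L) ->
  \sum_a F a (c a) = \sum_(i <- L) \sum_(a | c a == i) F a i.
Proof.
move=> uL cL; under [RHS]eq_bigr do rewrite big_mkcond.
rewrite exchange_big; apply: eq_bigr => a _ /=.
rewrite (bigD1_seq (c a)) //= eqxx big1 ?addr0// => i ne.
by rewrite eq_sym (negbTE ne).
Qed.

Lemma sum_half_pow_le1 (L : seq nat) : uniq L -> \sum_(i <- L) (2^-1 : R) ^+ i.+1 <= 1.
Proof.
move=> uL; have [N LN] : exists N, forall i, i \in L -> (i < N)%N.
  by exists (\max_(i <- L) i).+1 => i iL; rewrite ltnS; apply: leq_bigmax_seq.
apply: le_trans (_ : \sum_(i <- iota 0 N) 2^-1 ^+ i.+1 <= _).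
  rewrite [leRHS](bigID (mem L)) /= -[X in _ <= X + _]big_filter.
  rewrite [X in _ <= X + _](perm_big L) /=; last first.
    apply: uniq_perm => //; first by rewrite filter_uniq// iota_uniq.
    move=> i; rewrite mem_filter mem_iota /=; case: (boolP (i \in L)) => //= /LN ->//.
  by rewrite lerDl sumr_ge0// => i _; rewrite exprn_ge0// invr_ge0.
have -> : \sum_(i <- iota 0 N) (2^-1 : R) ^+ i.+1 = 1 - 2^-1 ^+ N.
  elim: (N) => [|n IH]; first by rewrite big_nil expr0 subrr.
  rewrite -addn1 iotaD big_cat big_seq1 IH add0n addn1 exprS /=; by field.
by rewrite lerBlDr lerDl exprn_ge0// invr_ge0.
Qed.

Lemma positive_lower_bound (L : seq nat) (f : nat -> R) : (forall i, 0 < f i) ->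
  exists2 r, 0 < r & forall i, i \in L -> r <= f i.
Proof.
move=> f0; elim: L => [|j L [r r0 Hr]]; first by exists 1.
exists (Order.min (f j) r); first by rewrite lt_min f0.
move=> i; rewrite inE => /orP[/eqP ->|/Hr h]; first by rewrite ge_min lexx.
by rewrite ge_min h orbT.
Qed.

(** The energy of a finitely supported measure; truncating the kernel at [rho] makes
the diagonal finite. *)
Definition discrete_energy (A : finType) (p y : A -> R) (s rho : R) :=
  \sum_a \sum_b p a * p b * (Order.max `|y a - y b| rho) `^ (- s).

(** Cauchy-Schwarz: if the pieces have masses [m_i], sizes [r_i] and [a_i = r_i^s],
the energy is at least the sum of [m_i^2/a_i], while
[m_i <= (M/2) a_i + m_i^2/(2 M a_i)]. *)
Lemma energy_cover_bound (A : finType) (p y : A -> R) (s rho M : R)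
    (L : seq nat) (c : A -> nat) (r : nat -> R) :
  (forall a, 0 <= p a) -> \sum_a p a = 1 -> 0 < s -> 0 < rho -> 0 < M ->
  discrete_energy p y s rho <= M ->
  uniq L -> (forall a, c a \in L) -> (forall i, i \in L -> rho <= r i) ->
  (forall a b, c a = c b -> `|y a - y b| <= r (c a)) ->
  1 <= M * \sum_(i <- L) r i `^ s.
Proof.
move=> p0 p1 s0 rho0 M0 HM uL cL Lr cr.
pose m i := \sum_(a | c a == i) p a.
have rpos i : i \in L -> 0 < r i by move=> /Lr; exact: lt_le_trans.
have rs i : i \in L -> 0 < r i `^ s by move=> /rpos; exact: powR_gt0.
have m1 : \sum_(i <- L) m i = 1.
  by rewrite -p1 (sum_fiber_seq (fun a _ => p a) uL cL).
have E : \sum_(i <- L) m i ^+ 2 / r i `^ s <= M.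
  apply: le_trans HM; rewrite /discrete_energy.
  apply: le_trans (_ : \sum_a p a * (m (c a) / r (c a) `^ s) <= _).
    rewrite (sum_fiber_seq (fun a i => p a * (m i / r i `^ s)) uL cL).
    apply: ler_sum => i _; rewrite -mulr_suml -/(m i) mulrA expr2 lexx//.
  apply: ler_sum => a _.
  rewrite mulrA mulr_sumr mulr_suml [leRHS](bigID (fun b => c b == c a)) /=.
  rewrite ler_wpDr ?sumr_ge0// => [b _|]; first by rewrite !mulr_ge0 ?powR_ge0.
  apply: ler_sum => b /eqP cba; rewrite ler_wpM2l ?mulr_ge0// powRN.
  have mx : 0 < Order.max `|y a - y b| rho by rewrite lt_max rho0 orbT.
  rewrite lef_pV2 ?posrE ?powR_gt0 ?rpos//.
  apply: ge0_ler_powR; rewrite ?nnegrE ?(ltW s0) ?(ltW mx) ?(ltW (rpos _ _))//.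
  by rewrite ge_max Lr// cr.
have h i : i \in L -> m i <= M / 2 * r i `^ s + (m i ^+ 2 / r i `^ s) / (2 * M).
  move=> /rs; move: (m i) (_ `^ _) => u v v0.
  have -> : M / 2 * v + (u ^+ 2 / v) / (2 * M) = u + (M * v - u) ^+ 2 / (2 * M * v).
    by field; rewrite ?gt_eqF.
  by rewrite lerDl divr_ge0 ?sqr_ge0// !mulr_ge0// ltW.
have : 1 <= M / 2 * \sum_(i <- L) r i `^ s + M / (2 * M).
  rewrite -[leLHS]m1 [leLHS]big_seq; apply: le_trans (ler_sum _ h) _.
  rewrite -big_seq big_split /= -mulr_sumr lerD2l -mulr_suml.
  by rewrite ler_pM2r ?invr_gt0 ?mulr_gt0.
have -> : M / (2 * M) = 2^-1 by field; rewrite gt_eqF.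
lra.
Qed.

(** A cover with small [t]-sum, [t < s], has small [s]-sum. Compactness reduces it to
finitely many open sets of positive sizes, so that a truncation [rho] below all
these sizes is admissible, and the previous bound fails if the sum is too small. *)
Lemma energy_hausdorff_dim (E : set R) (s M : R) : compact E -> 0 < s ->
  (forall rho : R, 0 < rho -> exists (A : finType) (p y : A -> R),
     [/\ forall a, 0 <= p a, \sum_a p a = 1, forall a, E (y a) &
         discrete_energy p y s rho <= M]) ->
  (s%:E <= hausdorff_dim E)%E.
Proof.
move=> cE s0 HE; apply: le_ereal_inf_tmp => _ [t [t0 Ht] <-]; rewrite lee_fin leNgt.
apply/negP => ts.
have M0 : 0 < `|M| + 1 by rewrite ltr_wpDl.
have c0 : 0 < (`|M| + 1) * 2 `^ s * 4 by rewrite !mulr_gt0 ?powR_gt0.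
pose eta := ((`|M| + 1) * 2 `^ s * 4)^-1; have eta0 : 0 < eta by rewrite invr_gt0.
have : (hausdorff_premeasure t 1 E < eta%:E)%E.
  apply: (@le_lt_trans _ _ 0%E); last by rewrite lte_fin.
  by rewrite -Ht; apply: ereal_sup_ubound; exists 1 => //=; rewrite in_itv/= ltr01.
move=> /ereal_inf_lt[_ [D [U [cU dU ->]]] sU].
pose d i := fine (diam (U i)).
have dE i : D i -> diam (U i) = (d i)%:E.
  move=> Di; rewrite fineK// ge0_fin_numE ?diam_ge0//.
  by apply: le_lt_trans (dU i Di) _; rewrite ltry.
have d0 i : 0 <= d i by rewrite fine_ge0// diam_ge0.
have d1 i : D i -> d i <= 1 by move=> Di; rewrite -lee_fin -dE// dU.
(* Radii exceeding the diameters [d i] strictly, at an extra cost at most [eta]. *)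
pose e i := d i `^ s + eta * 2^-1 ^+ i.+1.
have e0 i : 0 < e i by rewrite ltr_wpDl ?powR_ge0// mulr_gt0// exprn_gt0// invr_gt0.
pose rad i := e i `^ s^-1.
have rad0 i : 0 < rad i by rewrite powR_gt0.
have rads i : rad i `^ s = e i by rewrite -powRrM mulVf ?gt_eqF// powRr1// ltW.
have drad i : d i < rad i.
  rewrite ltNge; apply/negP => /(ge0_ler_powR (ltW s0)).
  rewrite !nnegrE d0 (ltW (rad0 i)) rads => /(_ isT isT).
  by rewrite leNgt ltrDl mulr_gt0// exprn_gt0// invr_gt0.
have [v Hv] : exists v : nat -> R, forall i x, U i x -> U i (v i).
  suff H i : exists v, forall x, U i x -> U i v by have [v Hv] := boolp.choice H; exists v.
  have [[x Ux]|nU] := pselect (U i !=set0); first by exists x.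
  by exists 0 => x Ux; exfalso; apply: nU; exists x.
move: cE; rewrite compact_cover => /(_ nat D (fun i => ball (v i) (rad i))).
case=> [i _|x Ex|D' D'D cD'].
- exact: ball_open.
- have [i Di Ux] := cU x Ex; exists i => //=.
  rewrite /ball /=; apply: le_lt_trans (drad i).
  by rewrite -lee_fin -dE//; apply: diam_ge => //; exact: Hv Ux.
pose L : seq nat := finmap.enum_fset D'; have uL : uniq L by exact: finmap.fset_uniq.
have LD i : i \in L -> D i by move=> iL; have := D'D i iL; rewrite inE.
have r20 i : 0 < 2 * rad i by rewrite mulr_gt0.
have [rho rho0 Hrho] := positive_lower_bound L r20.
have [A [p [y [p0 p1 Ey HM]]]] := HE rho rho0.
have [c Hc] : exists c : A -> nat, forall a, c a \in L /\ `|v (c a) - y a| < rad (c a).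
  suff H a : exists i, i \in L /\ `|v i - y a| < rad i by have [c Hc] := boolp.choice H; exists c.
  by have [i iL yi] := cD' _ (Ey a); exists i; split.
have HM' : discrete_energy p y s rho <= `|M| + 1.
  by apply: le_trans HM _; have := ler_norm M; lra.
have /= := energy_cover_bound p0 p1 s0 rho0 M0 HM' uL (fun a => proj1 (Hc a)) Hrho.
have cr a b : c a = c b -> `|y a - y b| <= 2 * rad (c a).
  move=> cab; have [_] := Hc a; have [_] := Hc b; rewrite -cab !ltr_norml ler_norml; lra.
move=> /(_ cr).
have -> : \sum_(i <- L) (2 * rad i) `^ s = 2 `^ s * \sum_(i <- L) e i.
  rewrite mulr_sumr; apply: eq_bigr => i _; rewrite powRM ?rads//.
  exact: ltW.
have se : \sum_(i <- L) e i <= 2 * eta.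
  rewrite big_split /= (_ : 2 * eta = eta + eta); last by ring.
  apply: lerD; last first.
    by rewrite -mulr_sumr ler_piMr ?(ltW eta0)// sum_half_pow_le1.
  apply: le_trans (_ : \sum_(i <- L) d i `^ t <= _).
    rewrite big_seq [leRHS]big_seq; apply: ler_sum => i iL.
    have := d0 i; rewrite le_eqVlt => /orP[/eqP <-|di0].
      by rewrite powR0 ?gt_eqF// powR_ge0.
    by apply: ger_powR; rewrite ?di0 ?d1 ?(ltW ts)//; exact: LD.
  rewrite -lee_fin; apply: le_trans (ltW sU).
  apply: ereal_sup_ubound; exists [set` L]; first by split; [exact: finite_seq|move=> i /LD].
  rewrite -fsbig_seq// -sumEFin; apply: eq_big_seq => i iL.
  by rewrite dE ?poweR_EFin//; exact: LD.
have := ler_wpM2l (ltW (_ : 0 < (`|M| + 1) * 2 `^ s)) se.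
rewrite mulr_gt0 ?powR_gt0// => /(_ isT) h1.
rewrite mulrA => /le_trans /(_ h1).
have -> : (`|M| + 1) * 2 `^ s * (2 * eta) = 2^-1.
  by rewrite /eta; field; rewrite ?gt_eqF// powR_gt0.
lra.
Qed.

End energy.

(** * Bernoulli measures on concatenated blocks *)

Section bernoulli.
Context {R : realType}.

(** Expresses, through finitely supported measures resolved at scale [e], that [K]
carries a probability measure of finite [r]-energy. The
bound is stated for every kernel [G] dominated by the Riesz kernel, because for a
random image it is the expected kernel that is dominated. *)
Definition carries_energy (K : set R) (r : R) := exists C : R, forall e : R, 0 < e ->
  exists (A : finType) (p x : A -> R),
    [/\ forall a, 0 <= p a, \sum_a p a = 1, forall a, K (x a) &
      forall G : A -> A -> R,
        (forall a b, x a != x b -> G a b <= `|x a - x b| `^ (- r)) ->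
        (forall a b, G a b <= e `^ (- r)) ->
        \sum_a \sum_b p a * p b * G a b <= C].

Section blocks.
Variables (n : nat) (Ws : seq (seq nat)).
Hypothesis n0 : (0 < n)%N.
Hypothesis uWs : uniq Ws.
Hypothesis sizeW : forall w, w \in Ws -> size w = n.
Hypothesis posW : forall w, w \in Ws -> pos_word w.

Definition block (i : nat) : seq nat := nth [::] Ws i.

(** Blocks are addressed by their rank in [Ws]; the default digit 1 keeps every
address sequence meaningful, so that the coding is continuous on the whole of the
product space. *)
Definition digits (b : nat -> nat) (k : nat) : nat := nth 1%N (block (b (k %/ n)%N)) (k %% n)%N.

Lemma block_pos i : pos_word (block i).
Proof.
rewrite /block; have [h|h] := ltnP i (size Ws); first by apply/posW/mem_nth.
by rewrite nth_default.
Qed.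

Lemma digits_pos b : pos_digits (digits b).
Proof.
move=> k; rewrite /digits.
have [h|h] := ltnP (k %% n)%N (size (block (b (k %/ n)%N))); last by rewrite nth_default.
by have /allP := block_pos (b (k %/ n)%N); apply; exact: mem_nth.
Qed.

Lemma digits_agree b b' N : (forall i, (i < N)%N -> b i = b' i) ->
  mkseq (digits b) (n * N) = mkseq (digits b') (n * N).
Proof.
move=> H; apply/eq_in_map => k; rewrite mem_iota add0n /= => kN.
by rewrite /digits H// ltn_divLR// mulnC.
Qed.

Lemma mkseq_digitsS b j : (b j < size Ws)%N ->
  mkseq (digits b) (n * j.+1) = mkseq (digits b) (n * j) ++ block (b j).
Proof.
move=> bj; rewrite mulnS addnC mkseq_add; congr (_ ++ _).
have sb : size (block (b j)) = n by apply/sizeW/mem_nth.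
apply: (@eq_from_nth _ 1%N); first by rewrite size_mkseq.
move=> i; rewrite size_mkseq => iN; rewrite nth_mkseq// /shiftn /digits.
by rewrite mulnC divnMDl// divn_small// addn0 modnMDl modn_small.
Qed.

Lemma size_digits_prefix b j : size (mkseq (digits b) (n * j)) = (n * j)%N.
Proof. by rewrite size_mkseq. Qed.

Lemma cflen_digits_prefix_le b j : (cflen (mkseq (digits b) (n * j)) : R) <= 2 * 2^-1 ^+ j.
Proof.
apply: (le_trans (cflen_le (pos_mkseq _ (digits_pos b)))).
rewrite size_mkseq ler_wpM2l//; apply: ler_wiXn2l.
- by rewrite invr_ge0.
- by rewrite invf_le1 ?ler1n.
- by rewrite leq_pmull.
Qed.

Definition coded_set : set R :=
  [set z | exists2 b : nat -> nat, (forall i, (b i < size Ws)%N) & z = cfval (digits b)].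

(** The continuous image of a product of finite sets. *)
Lemma coded_set_compact : compact coded_set.
Proof.
pose g (b : prod_topology (fun _ : nat => nat)) : R := cfval (digits b).
pose X : set (prod_topology (fun _ : nat => nat)) := [set b | forall i, `I_(size Ws) (b i)].
have -> : coded_set = g @` X.
  by apply/seteqP; split=> z [b h1 h2]; exists b.
apply: (@continuous_compact (prod_topology (fun _ : nat => nat)) R g X); last first.
  apply: (@tychonoff nat (fun _ => nat) (fun _ => `I_(size Ws))) => i.
  by apply: finite_compact; exact: finite_II.
apply: continuous_subspaceT => b.
apply/cvgrPdist_le => e e0.
have e2 : 0 < e / 2 by rewrite divr_gt0.
have [N HN] := exp_half_lt e2.
have agree : nbhs b [set b' : prod_topology (fun _ : nat => nat) | forall i, (i < N)%N -> b i = b' i].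
  elim: (N) => [|m IH]; first by apply: filterS filterT => b' _ i.
  have hm : nbhs b [set b' : prod_topology (fun _ : nat => nat) | b m = b' m].
    have := @proj_continuous nat (fun _ => nat) m b.
    move=> /(_ [set x | b m = x]); apply.
    by rewrite /= nbhs_principalE; apply/principal_filterP.
  apply: filterS2 IH hm => b' h1 h2 i; rewrite ltnS leq_eqVlt => /orP[/eqP ->//|]; exact: h1.
apply: filterS agree => b' /= hb'.
have I0 : 0 <= (0:R) <= 1 by rewrite lexx ler01.
have h1 := cfval_dist (n * N) (digits_pos b) I0.
have h2 := cfval_dist (n * N) (digits_pos b') I0.
rewrite -(digits_agree hb') distrC in h2.
have h3 := cflen_digits_prefix_le b N; have h4 := HN N (leqnn N).
apply: le_trans (ler_distD (cfmap (mkseq (digits b) (n * N)) 0 : R) _ _) _.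
by rewrite [e]splitr; apply: lerD; [apply: le_trans h1 _|apply: le_trans h2 _];
  exact: le_trans h3 (ltW h4).
Qed.

Lemma coded_set_sub (I : set nat) : I `<=` [set m | (0 < m)%N] ->
  (forall w, w \in Ws -> word_in I w) -> coded_set `<=` cf_set I.
Proof.
move=> Ipos IW z [b hb ->]; rewrite cf_setE//; exists (digits b) => // k /=.
have bW : block (b (k %/ n)%N) \in Ws by apply: mem_nth.
by apply: (IW _ bW); apply: mem_nth; rewrite (sizeW bW) ltn_mod.
Qed.

(** The digits split somewhere inside block [j], and the cylinder of the common
prefix is not much shorter than that of the first [j] blocks, since the blocks form
a finite family. *)
Lemma coded_separation : (0 < size Ws)%N -> exists2 C : R, 0 < C &
  forall (b b' : nat -> nat) j,
    (forall i, (b i < size Ws)%N) -> (forall i, (b' i < size Ws)%N) ->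
    (forall i, (i < j)%N -> b i = b' i) -> b j <> b' j ->
    cflen (mkseq (digits b) (n * j)) <= C * `|cfval (digits b) - cfval (digits b')|.
Proof.
move=> W0; pose D := (\max_(i < size Ws) \max_(k < n) nth 1%N (block i) k).
have DD b k : (forall i, (b i < size Ws)%N) -> (digits b k <= D)%N.
  move=> hb; rewrite /digits.
  pose i0 := Ordinal (hb (k %/ n)%N); have hk : (k %% n < n)%N by rewrite ltn_mod.
  pose k0 := Ordinal hk.
  apply: leq_trans (_ : \max_(k < n) nth 1%N (block i0) k <= _)%N.
    exact: (@leq_bigmax _ (fun k : 'I_n => nth 1%N (block i0) k) k0).
  exact: (@leq_bigmax _ (fun i : 'I_(size Ws) => \max_(k < n) nth 1%N (block i) k)%N i0).
have [c c0 Hc] := positive_lower_bound (iota 0 (size Ws)) (fun i => cflen_gt0 (R := R) (block_pos i)).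
have D0 : 0 < D.+2%:R ^+ 3 :> R by rewrite exprn_gt0.
exists (4 / c * (4 * D.+2%:R ^+ 3)); first by rewrite !mulr_gt0// invr_gt0.
move=> b b' j hb hb' bb' bj.
have [i [ij1 ij2 di dd]] : exists i, [/\ (n * j <= i)%N, (i < n * j.+1)%N,
    mkseq (digits b) i = mkseq (digits b') i & digits b i <> digits b' i].
  have ne : mkseq (digits b) (n * j.+1) != mkseq (digits b') (n * j.+1).
    rewrite !mkseq_digitsS// (digits_agree bb'); apply/eqP => /(congr1 (drop (n * j))).
    rewrite !drop_cat !size_digits_prefix ltnn subnn !drop0 => /eqP.
    by rewrite nth_uniq// => /eqP.
  have ex : exists i, digits b i != digits b' i.
    apply: contrapT => nex; move/eqP: ne; apply; apply: eq_mkseq => k.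
    by apply: contrapT => h; apply: nex; exists k; apply/eqP.
  case: (ex_minnP ex) => i di mi; exists i; split.
  - rewrite leqNgt; apply/negP => ij; move/eqP: di; apply.
    have := digits_agree bb' => /(congr1 (fun s => nth 0%N s i)).
    by rewrite !nth_mkseq.
  - rewrite ltnNge; apply/negP => ij; move/eqP: ne; apply.
    apply/eq_in_map => k; rewrite mem_iota add0n /= => kj.
    apply: contrapT => /eqP /mi; rewrite leqNgt => /negP; apply.
    exact: leq_trans ij.
  - apply/eq_in_map => k; rewrite mem_iota add0n /= => kj.
    by apply: contrapT => /eqP /mi; rewrite leqNgt kj.
  - by apply/eqP.
have h := cfval_separated (R := R) (digits_pos b) (digits_pos b') (fun k => DD b k hb) (fun k => DD b' k hb') di dd.
have pw := pos_mkseq (n * j) (digits_pos b).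
have h1 : cflen (mkseq (digits b) (n * j)) * c / 4 <= cflen (mkseq (digits b) i).
  apply: le_trans (_ : cflen (mkseq (digits b) (n * j.+1)) <= _).
    rewrite mkseq_digitsS//; apply: le_trans (proj1 (andP (cflen_cat pw (block_pos _)))).
    rewrite ler_pM2r ?invr_gt0// ler_wpM2l ?(ltW (cflen_gt0 pw))//.
    by apply: Hc; rewrite mem_iota add0n leq0n /=.
  rewrite -(subnKC (ltnW ij2)) mkseq_add.
  have p1 := pos_mkseq i (digits_pos b).
  have p2 := pos_mkseq (n * j.+1 - i) (pos_shiftn i (digits_pos b)).
  apply: le_trans (proj2 (andP (cflen_cat p1 p2))) _.
  by rewrite ler_piMr ?cflen_le1// ltW// cflen_gt0.
have -> : cflen (mkseq (digits b) (n * j)) = 4 / c * (cflen (mkseq (digits b) (n * j)) * c / 4).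
  by field; rewrite gt_eqF.
rewrite -[leRHS]mulrA ler_wpM2l ?divr_ge0 ?(ltW c0)//; exact: le_trans h.
Qed.


Variable t : R.
Hypothesis t0 : 0 < t.
Let Z : R := \sum_(w <- Ws) cflen w `^ t.
Hypothesis Z4 : 4 `^ t <= Z.

Let Z0 : 0 < Z.
Proof. by apply: lt_le_trans Z4; rewrite powR_gt0. Qed.

Let W0 : (0 < size Ws)%N.
Proof. by move: Z0; rewrite /Z; case: (Ws) => //; rewrite big_nil ltxx. Qed.

Definition block_mass (i : nat) : R := cflen (block i) `^ t / \sum_(w <- Ws) cflen w `^ t.

Lemma block_mass_ge0 i : 0 <= block_mass i.
Proof. by rewrite divr_ge0 ?powR_ge0// -/Z ltW. Qed.

Lemma block_mass_sum : \sum_(a < size Ws) block_mass a = 1.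
Proof.
rewrite -mulr_suml -/Z.
have -> : \sum_(a < size Ws) cflen (block a) `^ t = Z.
  by rewrite /Z (big_nth [::]) big_mkord.
by rewrite divff ?gt_eqF.
Qed.

(** Each concatenation loses a factor at most 4 in the lengths, that is [4^t] in the
masses, which the normalisation by the total [>= 4^t] makes up for. *)
Lemma prefix_mass_le (b : nat -> nat) j : (forall i, (b i < size Ws)%N) ->
  \prod_(i < j) block_mass (b i) <= cflen (mkseq (digits b) (n * j)) `^ t.
Proof.
move=> hb; elim: j => [|j IH].
  by rewrite big_ord0 muln0 /= /cflen /= expr1n invr1 powR1.
rewrite big_ord_recr /= mkseq_digitsS// [X in _ * X]/block_mass -/Z.
set l := cflen _ in IH; have pl := pos_mkseq (n * j) (digits_pos b).
have l0 : 0 < l by exact: cflen_gt0.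
set m := cflen (block _).
have m0 : 0 < m by apply/cflen_gt0/block_pos.
apply: le_trans (_ : l `^ t * (m `^ t / Z) <= _).
  apply: ler_pM => //; first by apply: prodr_ge0 => i _; exact: block_mass_ge0.
  by rewrite divr_ge0 ?powR_ge0 ?(ltW Z0).
apply: le_trans (_ : (l * m / 4) `^ t <= _).
  rewrite powRM ?powRM ?mulr_ge0 ?(ltW l0) ?(ltW m0)// ?invr_ge0// mulrA.
  rewrite ler_wpM2l ?mulr_ge0 ?powR_ge0//.
  have -> : 4^-1 `^ t = (4 `^ t)^-1 :> R.
    by rewrite -powR_inv1// -powRrM mulN1r powRN.
  by rewrite lef_pV2 ?posrE ?powR_gt0.
apply: ge0_ler_powR; rewrite ?nnegrE ?(ltW t0)//.
- by rewrite divr_ge0 ?mulr_ge0 ?(ltW l0) ?(ltW m0).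
- by apply/ltW/cflen_gt0; rewrite /pos_word all_cat; apply/andP; split; [exact: pl|exact: block_pos].
- by case/andP: (cflen_cat (R := R) pl (block_pos (b j))).
Qed.

(** Give the addresses of length [k] their product mass, and bound the kernel at a pair
by the sum of [l^-r] over the cylinder lengths [l] of the common prefixes. The
addresses that share a prefix with a given one have mass at most [l^t], and the
powers [l^(t-r)] decay geometrically. *)
Lemma coded_set_carries_energy (r : R) : 0 < r -> r < t -> carries_energy coded_set r.
Proof.
move=> r0 rt; have [Cs Cs0 Hsep] := coded_separation W0.
have tr : 0 < t - r by rewrite subr_gt0.
pose x : R := 2^-1 `^ (t - r).
have x1 : 0 <= x < 1 by exact: half_powR_itv tr.
pose K0 := (1 + Cs) `^ r.
have K01 : 1 <= K0.
  have := ge0_ler_powR (ltW r0) (x := 1 : R) (y := 1 + Cs).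
  by rewrite powR1; apply; rewrite ?nnegrE; lra.
exists (K0 * (2 `^ (t - r) * (1 - x)^-1)) => e e0.
have [k Hk] := exp_half_lt e0.
pose m := size Ws.
pose ext (f : {ffun 'I_k -> 'I_m}) (i : nat) : nat := if insub i is Some j then val (f j) else 0%N.
have extV f i : (ext f i < size Ws)%N by rewrite /ext; case: insubP => // j _ _; exact: ltn_ord.
have extE f (i : 'I_k) : ext f i = f i by rewrite /ext valK.
pose l f j : R := cflen (mkseq (digits (ext f)) (n * j)).
have l0 f j : 0 < l f j by exact/cflen_gt0/pos_mkseq/digits_pos.
pose mu (f : {ffun 'I_k -> 'I_m}) : R := \prod_i block_mass (f i).
pose pt (f : {ffun 'I_k -> 'I_m}) : R := cfval (digits (ext f)).
have mu0 f : 0 <= mu f by apply: prodr_ge0 => i _; exact: block_mass_ge0.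
have mu1 : \sum_f mu f = 1.
  rewrite -(bigA_distr_bigA (fun _ (a : 'I_m) => block_mass a)) /=.
  by rewrite big1// => i _; exact: block_mass_sum.
exists {ffun 'I_k -> 'I_m}, mu, pt; split=> //.
  by move=> f; exists (ext f).
move=> G G1 G2.
pose ind j (f g : {ffun 'I_k -> 'I_m}) : R := [forall i : 'I_k, (i < j)%N ==> (f i == g i)]%:R.
(* The mass of a cylinder of addresses. *)
have cyl j f : (j <= k)%N -> \sum_g mu g * ind j f g <= l f j `^ t.
  move=> jk; apply: le_trans (prefix_mass_le j (extV f)).
  pose F (i : 'I_k) (a : 'I_m) : R := block_mass a * ((i < j)%N ==> (f i == a))%:R.
  have -> : \sum_g mu g * ind j f g = \sum_(g : {ffun 'I_k -> 'I_m}) \prod_i F i (g i).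
    apply: eq_bigr => g _; rewrite big_split /=; congr (_ * _); rewrite /ind.
    case: forallP => [H|H]; first by rewrite big1// => i _; rewrite (H i).
    have [i Hi] : exists i : 'I_k, ~~ ((i < j)%N ==> (f i == g i)).
      by apply: contrapT => nH; apply: H => i; apply: contrapT => /negP h; apply: nH; exists i.
    by rewrite (bigD1 i) //= (negbTE Hi) mul0r.
  rewrite -(bigA_distr_bigA F) (big_ord_widen k (fun i => block_mass (ext f i)) jk).
  rewrite [leRHS]big_mkcond /= le_eqVlt; apply/orP; left; apply/eqP; apply: eq_bigr => i _.
  rewrite /F; case: ifP => ij /=.
    rewrite (bigD1 (f i)) //= eqxx mulr1 big1 ?addr0 ?extE// => a af.
    by rewrite eq_sym (negbTE af) mulr0.
  by under eq_bigr do rewrite mulr1; exact: block_mass_sum.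
(* Distinct addresses are handled at the place [j] where they split, equal ones at [k]. *)
have Gle f g : G f g <= K0 * \sum_(j < k.+1) ind j f g * l f j `^ (- r).
  have term (j : 'I_k.+1) : ind j f g = 1 -> K0 * l f j `^ (- r) <=
      K0 * \sum_(j < k.+1) ind j f g * l f j `^ (- r).
    move=> ij; rewrite ler_wpM2l ?powR_ge0// (bigD1 j) //= ij mul1r lerDl.
    by apply: sumr_ge0 => i _; rewrite mulr_ge0 ?powR_ge0 ?ler0n.
  have [E|fg] := eqVneq f g; first subst g.
    have ik : ind (@ord_max k) f f = 1.
      by rewrite /ind; case: forallP => // H; exfalso; apply: H => i; rewrite eqxx implybT.
    apply: le_trans (term ord_max ik); apply: (le_trans (G2 f f)).
    apply: le_trans (_ : l f k `^ (- r) <= _); last by rewrite ler_peMl ?powR_ge0.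
    apply: powRN_le => //; first exact: ltW.
    apply: le_trans (ltW (Hk k (leqnn k))); exact: cflen_digits_prefix_le.
  have ex : exists i, ext f i != ext g i.
    apply: contrapT => nex; move/eqP: fg; apply; apply/ffunP => i; apply/val_inj => /=.
    by rewrite -!extE; apply: contrapT => h; apply: nex; exists (val i); apply/eqP.
  case: (ex_minnP ex) => j /eqP jfg jmin.
  have jk : (j < k)%N.
    by rewrite ltnNge; apply/negP => kj; apply: jfg; rewrite /ext insubN// -leqNgt.
  have jk1 : (j < k.+1)%N by rewrite ltnS ltnW.
  have agree i : (i < j)%N -> ext f i = ext g i.
    by move=> ij; apply: contrapT => /eqP /jmin; rewrite leqNgt ij.
  have ij : ind (Ordinal jk1) f g = 1.
    rewrite /ind; case: forallP => // H; exfalso; apply: H => i; apply/implyP => /= ij.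
    by rewrite -val_eqE /= -!extE agree.
  apply: le_trans (term (Ordinal jk1) ij) => /=.
  have hs := Hsep _ _ j (extV f) (extV g) agree jfg.
  rewrite -/(pt f) -/(pt g) -/(l f j) in hs.
  have ptn : 0 < `|pt f - pt g|.
    by rewrite -(pmulr_rgt0 _ Cs0); apply: lt_le_trans hs.
  have ne : pt f != pt g by rewrite -subr_eq0 -normr_gt0.
  apply: (le_trans (G1 f g ne)).
  apply: le_trans (_ : (l f j / (1 + Cs)) `^ (- r) <= _).
    apply: powRN_le; [exact: ltW|by rewrite divr_gt0//; lra|].
    rewrite ler_pdivrMr; last lra.
    by apply: (le_trans hs); rewrite mulrC ler_wpM2l//; lra.
  have C1 : 0 <= 1 + Cs by lra.
  have C2 : 0 <= (1 + Cs)^-1 by rewrite invr_ge0.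
  rewrite (powRM _ (ltW (l0 f j)) C2) [leLHS]mulrC.
  by rewrite -[(1 + Cs)^-1]powR_inv1// -powRrM mulN1r opprK.
apply: le_trans (_ : \sum_f \sum_g mu f * mu g * (K0 * \sum_(j < k.+1) ind j f g * l f j `^ (- r)) <= _).
  by apply: ler_sum => f _; apply: ler_sum => g _; rewrite ler_wpM2l ?mulr_ge0.
have -> : \sum_f \sum_g mu f * mu g * (K0 * \sum_(j < k.+1) ind j f g * l f j `^ (- r)) =
   K0 * \sum_(j < k.+1) \sum_f mu f * (l f j `^ (- r) * \sum_g mu g * ind j f g).
  transitivity (\sum_f \sum_g \sum_(j < k.+1)
      K0 * (mu f * (l f j `^ (- r) * (mu g * ind j f g)))).
    apply: eq_bigr => f _; apply: eq_bigr => g _.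
    by rewrite !mulr_sumr; apply: eq_bigr => j _; ring.
  rewrite mulr_sumr [RHS](eq_bigr (fun j : 'I_k.+1 => \sum_f \sum_g
      K0 * (mu f * (l f j `^ (- r) * (mu g * ind j f g))))); last first.
    move=> j _; rewrite mulr_sumr; apply: eq_bigr => f _.
    by rewrite !mulr_sumr.
  by rewrite [RHS]exchange_big; apply: eq_bigr => f _; rewrite exchange_big.
rewrite ler_wpM2l ?powR_ge0//.
apply: le_trans (_ : \sum_(j < k.+1) 2 `^ (t - r) * x ^+ j <= _); last first.
  by rewrite -mulr_sumr ler_wpM2l ?powR_ge0// geometric_sum_le.
apply: ler_sum => j _; rewrite -[leRHS]mul1r -[X in _ <= X * _]mu1 mulr_suml; apply: ler_sum => f _.
rewrite ler_wpM2l//; apply: le_trans (_ : l f j `^ (- r) * l f j `^ t <= _).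
  by rewrite ler_wpM2l ?powR_ge0// cyl// -ltnS.
rewrite -powRD ?(gt_eqF (l0 f j)) ?implybT// addrC.
apply: le_trans (_ : (2 * 2^-1 ^+ j) `^ (t - r) <= _).
  apply: ge0_ler_powR; rewrite ?nnegrE ?(ltW tr) ?(ltW (l0 _ _))//; last exact: cflen_digits_prefix_le.
have i2 : 0 <= 2^-1 :> R by rewrite invr_ge0.
rewrite (powRM _ (ler0n _ 2) (exprn_ge0 j i2)) /x -(powR_mulrn j i2).
by rewrite -(powR_mulrn j (powR_ge0 _ _)) powRAC.
Qed.

End blocks.
End bernoulli.

(** * The critical exponent is the Hausdorff dimension *)

Section dichotomy.
Context {R : realType}.

(** The constant [4 `^ t] compensates the distortion in [prefix_mass_le]. *)
Definition has_big_block_family (I : set nat) (t : R) := exists (n : nat) (Ws : seq (seq nat)),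
  [/\ (0 < n)%N, uniq Ws, forall w, w \in Ws -> size w = n,
      forall w, w \in Ws -> word_in I w & 4 `^ t <= \sum_(w <- Ws) cflen w `^ t].

Lemma big_block_family_energy (I : set nat) (t : R) : I `<=` [set m | (0 < m)%N] ->
  0 < t -> has_big_block_family I t ->
  exists K : set R, [/\ compact K, K `<=` cf_set I &
    forall r, 0 < r < t -> carries_energy K r].
Proof.
move=> Ipos t0 [n [Ws [n0 uW sW IW W4]]].
have pW w : w \in Ws -> pos_word w by move=> /IW /(word_in_pos Ipos).
exists (coded_set n Ws); split.
- exact: coded_set_compact.
- exact: coded_set_sub.
- move=> r /andP[r0 rt]; exact: (@coded_set_carries_energy R n Ws n0 uW sW pW t).
Qed.

(** If the words of each length have [t]-sum at most [4^t], their [s]-sum gains the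
factor [(2 * 2^-n)^(s-t)], and the sum over all lengths [n] converges. *)
Lemma no_big_block_family_summable (I : set nat) (t s : R) : I `<=` [set m | (0 < m)%N] ->
  0 < t -> t < s -> ~ has_big_block_family I t -> exists M : R, words_summable I s M.
Proof.
move=> Ipos t0 ts nbig; have st : 0 < s - t by rewrite subr_gt0.
have s0 : 0 < s by exact: lt_trans ts.
pose x : R := 2^-1 `^ (s - t).
have i2 : 0 <= 2^-1 :> R by rewrite invr_ge0.
have x1 : 0 <= x < 1 by exact: half_powR_itv st.
pose c : R := 4 `^ t * 2 `^ (s - t).
exists (1 + c * (1 - x)^-1) => L uL LI.
have c0 : 0 <= c by rewrite mulr_ge0 ?powR_ge0.
pose N := (\max_(w <- L) size w)%N.
have LN w : w \in L -> (size w <= N)%N by move=> wL; apply: leq_bigmax_seq.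
have inN w : w \in L -> (inord (size w) : 'I_N.+1) = size w :> nat.
  by move=> wL; rewrite inordK// ltnS LN.
rewrite (partition_big (fun w => inord (size w) : 'I_N.+1) xpredT)//= big_ord_recl /=.
have pL w : w \in L -> pos_word w by move=> wL; apply: (word_in_pos Ipos); exact: LI.
(* The words of length 0: there is only one. *)
apply: lerD.
  rewrite -big_filter; set L0 := seq.filter _ _.
  have L01 : (size L0 <= 1)%N.
    apply: (@uniq_leq_size _ L0 [:: [::]]); first exact: filter_uniq.
    move=> w; rewrite mem_filter => /andP[/eqP h wL]; rewrite inE -size_eq0.
    by rewrite -(inN w wL) h.
  apply: le_trans (_ : \sum_(w <- L0) 1 <= _).
    rewrite big_seq [leRHS]big_seq; apply: ler_sum => w; rewrite mem_filter => /andP[_ wL].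
    have := ge0_ler_powR (ltW s0) (x := cflen w) (y := 1 : R).
    rewrite powR1 !nnegrE; apply; rewrite ?cflen_le1 ?pL//.
    by apply/ltW/cflen_gt0/pL.
  by rewrite big_const_seq count_predT iter_addr_0 (ler_nat R _ 1).
apply: le_trans (_ : \sum_(i < N) c * x ^+ i <= _); last first.
  by rewrite -mulr_sumr ler_wpM2l// geometric_sum_le.
apply: ler_sum => j _; rewrite -big_filter; set Lj := seq.filter _ _.
have Ljs w : w \in Lj -> w \in L /\ size w = j.+1.
  rewrite mem_filter => /andP[/eqP h wL]; split=> //.
  by rewrite -(inN w wL) h.
have small : \sum_(w <- Lj) cflen w `^ t <= 4 `^ t :> R.
  rewrite leNgt; apply/negP => /ltW h; apply: nbig; exists j.+1, Lj; split=> //.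
  - exact: filter_uniq.
  - by move=> w /Ljs[].
  - by move=> w /Ljs[/LI].
apply: le_trans (_ : \sum_(w <- Lj) cflen w `^ t * (2 * 2^-1 ^+ j.+1) `^ (s - t) <= _).
  rewrite big_seq [leRHS]big_seq; apply: ler_sum => w /Ljs[wL sw].
  apply: powR_le_split; [exact/cflen_gt0/pL| |exact: ltW].
  by rewrite -sw; exact/cflen_le/pL.
rewrite -mulr_suml; apply: le_trans (_ : 4 `^ t * (2 * 2^-1 ^+ j.+1) `^ (s - t) <= _).
  by rewrite ler_wpM2r ?powR_ge0.
rewrite /c -mulrA ler_wpM2l ?powR_ge0//.
apply: le_trans (_ : (2 * 2^-1 ^+ j) `^ (s - t) <= _).
  apply: ge0_ler_powR; rewrite ?nnegrE ?mulr_ge0 ?exprn_ge0 ?(ltW st)// ler_wpM2l//.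
  by rewrite exprS ler_piMl ?exprn_ge0// invf_le1 ?ler1n.
rewrite (powRM _ (ler0n _ 2) (exprn_ge0 j i2)) /x -(powR_mulrn j i2).
by rewrite -(powR_mulrn j (powR_ge0 _ _)) powRAC.
Qed.

Lemma carries_energy_hausdorff (K : set R) (r : R) : compact K -> 0 < r ->
  carries_energy K r -> (r%:E <= hausdorff_dim K)%E.
Proof.
move=> cK r0 [C HC]; apply: (energy_hausdorff_dim (M := C)) => // rho rho0.
have [A [p [x [p0 p1 xK HG]]]] := HC rho rho0.
exists A, p, x; split=> //; rewrite /discrete_energy; apply: HG => a b.
  rewrite -subr_eq0 -normr_gt0 => ab; apply: powRN_le => //; first exact: ltW.
  by rewrite le_max lexx.
by apply: powRN_le; [exact: ltW| |rewrite le_max lexx orbT].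
Qed.

(** A big family of blocks at an exponent above the dimension would carry energy at
exponents above the dimension, which is impossible; so the series converges. *)
Lemma cf_set_tame_above_dim (I : set nat) (s : R) : I `<=` [set m | (0 < m)%N] ->
  (hausdorff_dim (cf_set I : set R) < s%:E)%E -> tame_cover (cf_set I) s.
Proof.
move=> Ipos; have := hausdorff_dim_ge0 (cf_set I : set R).
have Hbig t : 0 < t -> has_big_block_family I t ->
    (t%:E <= hausdorff_dim (cf_set I : set R))%E.
  move=> t0 /(big_block_family_energy Ipos t0)[K [cK KF HK]].
  apply: le_trans (hausdorff_dim_mono KF).
  apply/lee_subgt0Pr => e e0; rewrite -EFinB.
  have [et|te] := ltP e t; last first.
    apply: le_trans (hausdorff_dim_ge0 K); rewrite lee_fin; lra.
  apply: carries_energy_hausdorff => //; first by rewrite subr_gt0.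
  by apply: HK; rewrite subr_gt0 et/= ltrBlDr ltrDl.
case: (hausdorff_dim _) Hbig => [h| |] Hbig //; rewrite lee_fin lte_fin => h0 hs.
pose t1 := h + (s - h) / 3; pose t2 := h + (s - h) / 3 * 2.
have ht1 : h < t1 by rewrite /t1; lra.
have t12 : t1 < t2 by rewrite /t1 /t2; lra.
have t2s : t2 < s by rewrite /t2; lra.
have t10 : 0 < t1 by exact: le_lt_trans ht1.
have nb : ~ has_big_block_family I t1.
  by move=> /(Hbig _ t10); rewrite lee_fin leNgt ht1.
have [M HM] := no_big_block_family_summable Ipos t10 t12 nb.
apply: cf_set_tame HM => //; exact: ltW (lt_trans t10 t12).
Qed.

(** Without big families just above [r] the series would converge there, and the
dimension would be at most [r]. *)
Lemma cf_set_energy_below_dim (I : set nat) (r : R) : I `<=` [set m | (0 < m)%N] ->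
  0 < r -> (r%:E < hausdorff_dim (cf_set I : set R))%E ->
  exists K : set R, [/\ compact K, K `<=` cf_set I & carries_energy K r].
Proof.
move=> Ipos r0 rh; apply: contrapT => nK.
have : (hausdorff_dim (cf_set I : set R) <= r%:E)%E; last by rewrite leNgt rh.
apply: lee_real_gt => s; rewrite lte_fin => rs.
pose t1 := r + (s - r) / 3; pose t2 := r + (s - r) / 3 * 2.
have ht1 : r < t1 by rewrite /t1; lra.
have t12 : t1 < t2 by rewrite /t1 /t2; lra.
have t2s : t2 < s by rewrite /t2; lra.
have t10 : 0 < t1 by exact: lt_trans ht1.
have nb : ~ has_big_block_family I t1.
  move=> /(big_block_family_energy Ipos t10)[K [cK KF HK]]; apply: nK.
  by exists K; split=> //; apply: HK; rewrite r0.
have [M HM] := no_big_block_family_summable Ipos t10 t12 nb.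
have t20 : 0 <= t2 by exact: ltW (lt_trans t10 t12).
have tame := cf_set_tame Ipos t20 t2s HM.
by apply: tame_cover_hausdorff_dim => //; rewrite (le_trans t20)// ltW.
Qed.

End dichotomy.

(** * Gaussian variables *)

Section normal_bounds.
Context {R : realType}.
Local Notation mu := (@lebesgue_measure R).

Lemma measurable_abs_gt (m a : R) : measurable ([set y | a < `|y - m|] : set R).
Proof.
have -> : [set y | a < `|y - m|] = ~` `[m - a, m + a]%classic :> set R.
  apply/seteqP; split=> y /=; rewrite in_itv/= => h.
    by move=> h2; move: h; rewrite ltNge ler_norml => /negP; apply; lra.
  by rewrite ltNge; apply/negP; rewrite ler_norml => h2; apply: h; lra.
by apply: measurableC; exact: measurable_itv.
Qed.

Lemma measurable_abs_le (a : R) : measurable ([set y | `|y| <= a] : set R).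
Proof.
have -> : [set y | `|y| <= a] = `[- a, a]%classic :> set R.
  by apply/seteqP; split=> y /=; rewrite in_itv/= ler_norml.
exact: measurable_itv.
Qed.

Lemma measurable_abs_ge (a : R) : measurable ([set y | a <= `|y|] : set R).
Proof.
have -> : [set y | a <= `|y|] = ~` `]- a, a[%classic :> set R.
  apply/seteqP; split=> y /=; rewrite in_itv/= => h.
    by move=> h2; move: h; rewrite leNgt ltr_norml h2.
  by rewrite leNgt; apply/negP; rewrite ltr_norml.
by apply: measurableC; exact: measurable_itv.
Qed.

Lemma normal_small_ball (m s x : R) : s != 0 -> 0 < x ->
  (normal_prob m s [set y | `|y| <= x]%R <= (x / `|s|)%:E)%E.
Proof.
move=> s0 x0; rewrite /normal_prob.
have -> : [set y | `|y| <= x] = `[- x, x]%classic :> set R.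
  by apply/seteqP; split=> y /=; rewrite in_itv/= ler_norml.
set A := (X in (\int[_]_(_ in X) _)%E).
have mA : measurable A by exact: measurable_itv.
apply: (@le_trans _ _ (\int[mu]_(y in A) cst (normal_peak s)%:E y)%E).
  apply: ge0_le_integral => //=.
  - by move=> y _; rewrite lee_fin normal_pdf_ge0.
  - by apply/measurable_EFinP/measurable_funTS; exact: measurable_normal_pdf.
  - by move=> y _; rewrite lee_fin normal_pdf_ub.
have xx : (- x < x) by lra.
rewrite integral_cst//= lebesgue_measure_itv /= lte_fin xx -EFinB -EFinM lee_fin.
rewrite /normal_peak opprK.
have sp : 0 < `|s| by rewrite normr_gt0.
have hs : 2 * `|s| <= Num.sqrt (s ^+ 2 * pi *+ 2).
  have -> : 2 * `|s| = Num.sqrt ((2 * s) ^+ 2) by rewrite sqrtr_sqr normrM ger0_norm.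
  apply: ler_wsqrtr; rewrite exprMn -mulr_natr.
  have : 0 <= s ^+ 2 by exact: sqr_ge0.
  have := pi_ge2 R; move: pi => p; nra.
have sq0 : 0 < Num.sqrt (s ^+ 2 * pi *+ 2) by apply: lt_le_trans hs; rewrite mulr_gt0.
rewrite [leLHS]mulrC ler_pdivrMr// mulrAC ler_pdivlMr//.
apply: le_trans (_ : x * (2 * `|s|) <= _); first by lra.
by rewrite ler_pM2l.
Qed.

(** The density with standard deviation [s] is at most [sqrt 2 * exp (- a^2/(4 s^2))]
times the density with standard deviation [sqrt 2 * s] outside the interval of
radius [a], and the latter has total mass 1. *)
Lemma normal_tail (m s a : R) : s != 0 -> 0 <= a ->
  (normal_prob m s [set y | a < `|y - m|]%R <= (2 * expR (- (a ^+ 2 / (4 * s ^+ 2))))%:E)%E.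
Proof.
move=> s0 a0; rewrite /normal_prob.
pose s' := Num.sqrt 2 * s.
have sq2 : Num.sqrt 2 != 0 :> R by rewrite gt_eqF ?sqrtr_gt0.
have s'0 : s' != 0 by rewrite mulf_neq0.
have s'2 : s' ^+ 2 = 2 * s ^+ 2 by rewrite exprMn sqr_sqrtr.
have sg : 0 < s ^+ 2 by rewrite exprn_even_gt0.
set c := 2 * _; have c0 : 0 <= c by rewrite mulr_ge0 ?expR_ge0.
set A := [set y | _].
have mA : measurable A by exact: measurable_abs_gt.
have mpdf (u : R) (B : set R) : measurable_fun B (fun y => (normal_pdf m u y)%:E).
  by apply/measurable_EFinP/measurable_funTS; exact: measurable_normal_pdf.
apply: (@le_trans _ _ (\int[mu]_(y in A) (c%:E * (normal_pdf m s' y)%:E))%E).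
  apply: ge0_le_integral => //=.
  - by move=> y _; rewrite lee_fin normal_pdf_ge0.
  - exact: mpdf.
  - by apply: measurable_funeM; exact: mpdf.
  - move=> y; rewrite /A /= => ya; rewrite -EFinM lee_fin.
    rewrite !normal_pdfE// /normal_peak /normal_fun s'2.
    have ay : a ^+ 2 <= (y - m) ^+ 2.
      by rewrite -(real_normK (num_real (y - m))) ler_sqr ?nnegrE// ltW.
    have -> : Num.sqrt (2 * s ^+ 2 * pi *+ 2) = Num.sqrt 2 * Num.sqrt (s ^+ 2 * pi *+ 2).
      by rewrite -sqrtrM//; congr Num.sqrt; ring.
    set p := Num.sqrt (_ *+ 2).
    have p0 : 0 < p by rewrite sqrtr_gt0 pmulrn_lgt0// mulr_gt0// pi_gt0.
    have sq20 : 0 < Num.sqrt 2 :> R by rewrite sqrtr_gt0.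
    have -> : expR (- (y - m) ^+ 2 / (s ^+ 2 *+ 2)) =
       expR (- ((y - m) ^+ 2 / (4 * s ^+ 2))) * expR (- (y - m) ^+ 2 / (2 * s ^+ 2 *+ 2)).
      by rewrite -expRD; congr expR; field.
    set E2 := expR (_ / (2 * _ *+ 2)).
    have -> : c * ((Num.sqrt 2 * p)^-1 * E2) =
        p^-1 * ((2 * expR (- (a ^+ 2 / (4 * s ^+ 2))) / Num.sqrt 2) * E2).
      by rewrite /c; field; rewrite !gt_eqF.
    rewrite ler_wpM2l ?invr_ge0 ?(ltW p0)// ler_wpM2r ?expR_ge0//.
    apply: le_trans (_ : expR (- (a ^+ 2 / (4 * s ^+ 2))) <= _).
      by rewrite ler_expR lerN2 ler_pM2r// invr_gt0 mulr_gt0.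
    rewrite [leRHS]mulrAC ler_peMl ?expR_ge0// ler_pdivlMr// mul1r.
    rewrite -(ler_sqr (ltW sq20)) ?nnegrE// sqr_sqrtr//; lra.
rewrite ge0_integralZl//=; [|exact: mpdf|by move=> y _; rewrite lee_fin normal_pdf_ge0].
rewrite -[leRHS]mule1; apply: lee_wpmul2l; first by rewrite lee_fin.
rewrite -(integral_normal_pdf m s'); apply: ge0_subset_integral => //; first exact: mpdf.
by move=> y _; rewrite lee_fin normal_pdf_ge0.
Qed.

End normal_bounds.

Section gaussian_variable.
Context {d : measure_display} {T : measurableType d} {R : realType}.
Variable P : probability T R.

Lemma RV_measurable (X : {RV P >-> R}) (A : set R) : measurable A ->
  measurable [set w | A (X w)].
Proof. by move=> mA; have := measurable_funPTI X mA. Qed.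

Lemma gaussian_tail_centered (X : {RV P >-> R}) (m s a : R) : 0 <= a ->
  (forall A : set (measurableTypeR R), measurable A ->
     P [set w | A (X w)] = gaussian_law m s A) ->
  (P [set w | (a < `|X w - m|)%R] <= (2 * expR (- (a ^+ 2 / (4 * s ^+ 2))))%:E)%E.
Proof.
move=> a0 law; have := law [set y | a < `|y - m|] (measurable_abs_gt m a).
rewrite /= => ->; rewrite /gaussian_law; case: eqVneq => [s0|s0].
  rewrite /dirac indicE memNset ?lee_fin ?mulr_ge0 ?expR_ge0//= subrr normr0.
  by apply/negP; rewrite -leNgt.
exact: normal_tail.
Qed.

(** The tail formula for expectations turns the Gaussian tail into the integral of an
exponential density of rate [1/(4 s^2)]; no exact moment is computed. *)
Lemma gaussian_second_moment (X : {RV P >-> R}) (m s : R) :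
  (forall A : set (measurableTypeR R), measurable A ->
     P [set w | A (X w)] = gaussian_law m s A) ->
  ('E_P[(fun w => (X w - m) ^+ 2)%R] <= (8 * s ^+ 2)%:E)%E.
Proof.
move=> law.
pose Y : {RV P >-> R} := ((X - cst m) ^+ 2)%R.
have YE w : Y w = (X w - m) ^+ 2 by [].
have -> : ('E_P[(fun w => (X w - m) ^+ 2)%R] = 'E_P[Y])%E by [].
rewrite ge0_expectation_ccdf; last first.
  by move=> w; rewrite YE sqr_ge0.
have ccdfE (r : R) : 0 <= r -> ccdf Y r = P [set w | Num.sqrt r < `|X w - m|].
  move=> r0; rewrite /ccdf /distribution /pushforward; congr (P _).
  apply/seteqP; split=> w H.
    have h : r < (X w - m) ^+ 2 by move: H; rewrite /preimage/= in_itv/= andbT.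
    by rewrite /= -sqrtr_sqr ltr_sqrt// (le_lt_trans r0).
  have h : r < (X w - m) ^+ 2.
    by rewrite -(sqr_sqrtr r0) -(real_normK (num_real (X w - m))) ltr_sqr ?nnegrE ?sqrtr_ge0.
  by rewrite /preimage/= in_itv/= andbT.
have [s0|s0] := eqVneq s 0.
  rewrite integral0_eq; first by rewrite lee_fin mulr_ge0// sqr_ge0.
  move=> r /=; rewrite in_itv/= andbT => r0.
  rewrite ccdfE//; have := law [set y | Num.sqrt r < `|y - m|] (measurable_abs_gt m _).
  rewrite /= => ->; rewrite /gaussian_law s0 eqxx /dirac indicE memNset//= subrr normr0.
  by apply/negP; rewrite -leNgt sqrtr_ge0.
have sg : 0 < s ^+ 2 by rewrite exprn_even_gt0.
pose la : R := (4 * s ^+ 2)^-1.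
have la0 : 0 < la by rewrite invr_gt0 mulr_gt0.
have mexp : measurable_fun [set: R] (fun r => (exponential_pdf la r)%:E).
  by apply/measurable_EFinP; exact: measurable_exponential_pdf.
have e0 r : (0 <= (exponential_pdf la r)%:E)%E.
  by rewrite lee_fin exponential_pdf_ge0// ltW.
have k0 : (0 <= (8 * s ^+ 2)%:E)%E by rewrite lee_fin mulr_ge0// ltW.
have mI : measurable (`[0, +oo[%classic : set R) by exact: measurable_itv.
apply: (@le_trans _ _ (\int[lebesgue_measure]_(r in `[0%R, +oo[) ((8 * s ^+ 2)%:E * (exponential_pdf la r)%:E))%E).
  apply: ge0_le_integral => //=.
  - apply: measurable_funTS; exact: ccdf_measurable.
  - by apply: measurable_funeM; exact: measurable_funTS.
  - move=> r; rewrite in_itv/= andbT => r0; rewrite ccdfE// exponential_pdfE// -EFinM.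
    apply: le_trans (gaussian_tail_centered (sqrtr_ge0 r) law) _.
    rewrite lee_fin sqr_sqrtr// [leRHS]mulrA.
    have -> : 8 * s ^+ 2 * la = 2 by rewrite /la; field.
    by rewrite /la mulNr [_^-1 * r]mulrC.
rewrite ge0_integralZl//=; [|exact: measurable_funTS].
rewrite -[leRHS]mule1; apply: lee_wpmul2l => //.
rewrite -(integral_exponential_pdf la0); apply: ge0_subset_integral => //.
Qed.

Definition small_ball_at (X : T -> R) (v : R) := forall x : R, 0 < x ->
  (P [set w | (`|X w| <= x)%R] <= (3 * x / Num.sqrt v)%:E)%E.

Definition tail_at (X : T -> R) (v : R) := forall a : R, 0 <= a ->
  (P [set w | (a < `|X w|)%R] <= (expR 2 * expR (- (a ^+ 2 / (128 * v))))%:E)%E.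

(** The law is known to be Gaussian, but its parameters [m], [s] are not; they have to be
compared with the mean 0 and the variance [v]. The second moment about [m] gives
[v + m^2 <= 8 s^2], and the small-ball bound against Chebyshev's inequality gives
[s^2 <= 8 v]. These inequalities also exclude [s = 0]. *)
Lemma gaussian_bounds (X : {RV P >-> R}) (m s v : R) : 0 < v ->
  (forall A : set (measurableTypeR R), measurable A ->
     P [set w | A (X w)] = gaussian_law m s A) ->
  (X : T -> R) \in Lfun P 2%:E -> ('E_P[X] = 0)%E -> ('V_P[X] = v%:E)%E ->
  small_ball_at X v /\ tail_at X v.
Proof.
move=> v0 law X2 EX VX.
have m2 := gaussian_second_moment law.
have Pfin : P setT \is a fin_num := fin_num_measure P _ measurableT.
have X1 : (X : T -> R) \in Lfun P 1 by exact: (Lfun_subset12 Pfin X2).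
have c2 : (cst m : T -> R) \in Lfun P 2%:E by exact: Lfun_cst.
have c1 : (cst m : T -> R) \in Lfun P 1 by exact: Lfun_cst.
have h : v + m ^+ 2 <= 8 * s ^+ 2.
  rewrite -lee_fin; apply: le_trans m2.
  have XB : (X \- cst m)%R \in Lfun P 2%:E by rewrite rpredB ?lee1n.
  have VE := varianceE XB.
  rewrite varianceB_cst_r// VX expectationB// EX expectation_cst in VE.
  have -> : ('E_P[(fun w => (X w - m) ^+ 2)%R] = 'E_P[((X \- cst m) ^+ 2)%R])%E by [].
  move: VE; case: ('E_P[_ ^+ 2])%E => [e| |] //=.
  rewrite -EFinD => -[->]; rewrite lee_fin le_eqVlt; apply/orP; left; apply/eqP; ring.
have s0 : s != 0.
  by apply/negP => /eqP s0; move: h; rewrite s0 expr0n mulr0 leNgt ltr_pwDl ?sqr_ge0.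
have sp : 0 < `|s| by rewrite normr_gt0.
have sg : 0 < s ^+ 2 by rewrite exprn_even_gt0.
have lawn A : measurable A -> P [set w | A (X w)] = normal_prob m s A.
  by move=> mA; rewrite law// /gaussian_law (negbTE s0).
have sb (x : R) : 0 < x -> (P [set w | (`|X w| <= x)%R] <= (x / `|s|)%:E)%E.
  move=> x0; have := lawn _ (measurable_abs_le x); rewrite /= => ->.
  exact: normal_small_ball.
(* The ball of radius [|s|/2] has probability at most 1/2, so its complement has at least
   1/2, while Chebyshev bounds the latter by [4 v/s^2]. *)
have hs : s ^+ 2 <= 8 * v.
  have e0 : 0 < `|s| / 2 by rewrite divr_gt0.
  have := @chebyshev _ _ _ P X (`|s| / 2) e0; rewrite EX VX /= -EFinM => ch.
  have mB := RV_measurable X (measurable_abs_le (`|s| / 2)).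
  have mC := RV_measurable X (measurable_abs_ge (`|s| / 2)).
  have H1 := sb _ e0.
  have H2 : (P [set w | (`|s| / 2 <= `|X w|)%R] <= ((`|s| / 2) ^- 2 * v)%:E)%E.
    apply: le_trans ch; apply: le_measure; rewrite ?inE//; last by move=> w /=; rewrite subr0.
    suff -> : [set w | `|s| / 2 <= `|X w - 0|] = [set w | `|s| / 2 <= `|X w|] by [].
    by apply/seteqP; split=> w /=; rewrite subr0.
  have H3 : (1 <= P [set w | (`|X w| <= `|s| / 2)%R] + P [set w | (`|s| / 2 <= `|X w|)%R])%E.
    rewrite -(probability_setT P); apply: le_trans (measureU2 _ mB mC).
    apply: le_measure; rewrite ?inE//; first exact: measurableU.
    by move=> w _ /=; case: (leP `|X w| (`|s| / 2)) => [?|/ltW ?]; [left|right].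
  have := le_trans H3 (leeD H1 H2); rewrite -EFinD lee_fin.
  have -> : `|s| / 2 / `|s| = 2^-1 by field; rewrite gt_eqF.
  have -> : (`|s| / 2) ^- 2 * v = 4 * v / s ^+ 2.
    by rewrite exprMn (real_normK (num_real s)); field.
  move=> H4; have : 2^-1 <= 4 * v / s ^+ 2 by lra.
  by rewrite ler_pdivlMr//; lra.
split.
- move=> x x0; apply: le_trans (sb x x0) _; rewrite lee_fin [3 * x]mulrC -mulrA ler_wpM2l ?(ltW x0)//.
  have vq : 0 < Num.sqrt v by rewrite sqrtr_gt0.
  rewrite ler_pdivlMr// ler_pdivrMl// mulrC.
  rewrite -ler_sqr ?nnegrE ?mulr_ge0 ?(ltW sp)// ?(ltW vq)// sqr_sqrtr ?(ltW v0)//.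
  rewrite exprMn (real_normK (num_real s)); have := sqr_ge0 m; lra.
- move=> a a0; have e2 : 3 <= expR 2 :> R by have := expR_ge1Dx (2 : R); lra.
  have mA := RV_measurable X (measurable_abs_gt 0 a).
  have mA' : measurable [set w | a < `|X w|].
    suff <- : [set w | a < `|X w - 0|] = [set w | a < `|X w|] by [].
    by apply/seteqP; split=> w /=; rewrite subr0.
  (* For [a < 2 |m|] the bound is at least 1, as [a^2 <= 256 v]. *)
  have [am|am] := leP (2 * `|m|) a.
    have a2 : 0 <= a / 2 by rewrite divr_ge0.
    apply: (@le_trans _ _ (P [set w | a / 2 < `|X w - m|]%R)).
      apply: le_measure; rewrite ?inE//.
        exact: RV_measurable (measurable_abs_gt m (a / 2)).
      move=> w /= h1; have := lerB_dist (X w) m; lra.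
    apply: le_trans (gaussian_tail_centered a2 law) _; rewrite lee_fin.
    apply: ler_pM; rewrite ?expR_ge0//; first by lra.
    have s4 : 0 < 4 * s ^+ 2 by lra.
    have v128 : 0 < 128 * v by lra.
    rewrite ler_expR lerN2 ler_pdivrMr// mulrAC ler_pdivlMr//.
    have a20 := sqr_ge0 a; rewrite exprMn; nra.
  apply: le_trans (probability_le1 P mA') _.
  rewrite lee_fin -expRD -[leLHS]expR0 ler_expR subr_ge0 ler_pdivrMr; last lra.
  have : a ^+ 2 <= (2 * `|m|) ^+ 2 by rewrite ler_sqr ?nnegrE ?mulr_ge0// ltW.
  rewrite exprMn (real_normK (num_real m)); lra.
Qed.

End gaussian_variable.

(** * Increments of fractional Brownian motion *)

Section fbm_increments.
Context {d : measure_display} {T : measurableType d} {R : realType}.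
Variable P : probability T R.

(** A finite value of the covariance of [X] with itself encodes square integrability. *)
Lemma centered_finite_variance_Lfun2 (X : {RV P >-> R}) (v : R) :
  ('E_P[X] = 0)%E -> covariance P X X = v%:E -> (X : T -> R) \in Lfun P 2%:E.
Proof.
move=> EX; rewrite unlock EX /= => h.
rewrite inE; apply/andP; split; rewrite inE /=; first exact: measurable_funPT.
rewrite /finite_norm; apply: (@lty_poweRy _ _ 2); first by rewrite pnatr_eq0.
rewrite powR_Lnorm ?pnatr_eq0//.
move: h; rewrite unlock /= => h.
have -> : (\int[P]_x ((`|X x| `^ 2)%:E) = v%:E)%E; last exact: ltry.
rewrite -h; apply: eq_integral => w _ /=; congr EFin.
rewrite (_ : ((X \- cst 0) * (X \- cst 0)) w = (X w - 0) * (X w - 0))//.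
by rewrite subr0 -expr2 powR_mulrn// real_normK ?num_real.
Qed.

Variables (alpha : R) (B : R -> {RV P >-> R}).
Hypothesis alpha0 : 0 < alpha.
Hypothesis hB : fractional_brownian_motion alpha B.

(** The covariance formula gives the increment the variance [|s-t|^(2 alpha)]. *)
Lemma fbm_increment (s t : R) : s != t ->
  small_ball_at P (fun w => B s w - B t w) (`|s - t| `^ (2 * alpha)) /\
  tail_at P (fun w => B s w - B t w) (`|s - t| `^ (2 * alpha)).
Proof.
move=> st; have v0 : 0 < `|s - t| `^ (2 * alpha) by rewrite powR_gt0// normr_gt0 subr_eq0.
have [hG hE hC _] := hB.
have L2 u : (B u : T -> R) \in Lfun P 2%:E by apply: centered_finite_variance_Lfun2 (hE u) (hC u u).
have Pfin : P setT \is a fin_num := fin_num_measure P _ measurableT.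
have L1 u : (B u : T -> R) \in Lfun P 1 by exact: (Lfun_subset12 Pfin (L2 u)).
pose a (i : 'I_2) : R := if i == 0 :> nat then 1 else -1.
pose u (i : 'I_2) : R := if i == 0 :> nat then s else t.
have [m [sigma law]] := hG 2%N a u.
pose X : {RV P >-> R} := (B s - B t)%R.
apply: (@gaussian_bounds _ _ _ P X m sigma) => //.
- move=> A mA; rewrite -law//; congr (P _); apply/seteqP; split=> w /=;
    by rewrite big_ord_recl big_ord1 /a /u /= mul1r mulN1r.
- suff : (B s \- B t)%R \in Lfun P 2%:E by [].
  by rewrite rpredB ?lee1n.
- have -> : ('E_P[X] = 'E_P[(B s \- B t)%R])%E by [].
  by rewrite expectationB// !hE sube0.
- have -> : ('V_P[X] = 'V_P[(B s \- B t)%R])%E by [].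
  rewrite varianceB// /variance !hC -!EFinM -!EFinD; congr EFin.
  by rewrite !subrr normr0 powR0 ?gt_eqF ?mulr_gt0//; field.
Qed.

End fbm_increments.

(** * Dyadic chaining *)

Section chaining.
Context {R : realType}.
Implicit Types (f : R -> R) (x y g : R).

Let h n : R := 2^-1 ^+ n.

Let h0 n : 0 < h n. Proof. by rewrite exprn_gt0// invr_gt0. Qed.

Definition dyadic_index n x : nat := Num.truncn (x * 2 ^+ n).
Definition dyadic_floor n x : R := (dyadic_index n x)%:R * 2^-1 ^+ n.

Lemma half_expK n : (2^-1 : R) ^+ n * 2 ^+ n = 1.
Proof. by rewrite -exprMn mulVf// expr1n. Qed.

Lemma dyadic_index_itv n x : 0 <= x ->
  (dyadic_index n x)%:R <= x * 2 ^+ n < (dyadic_index n x).+1%:R.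
Proof. by move=> x0; apply: Num.Theory.truncn_itv; rewrite mulr_ge0// exprn_ge0. Qed.

Lemma dyadic_index_lt n x : 0 <= x < 1 -> (dyadic_index n x < 2 ^ n)%N.
Proof.
move=> /andP[x0 x1]; have /andP[h1 _] := dyadic_index_itv n x0.
rewrite -(ltr_nat R); apply: (le_lt_trans h1).
by rewrite natrX -[ltRHS]mul1r ltr_pM2r// exprn_gt0.
Qed.

Lemma dyadic_indexS n x : 0 <= x ->
  dyadic_index n.+1 x = (dyadic_index n x).*2 \/ dyadic_index n.+1 x = (dyadic_index n x).*2.+1.
Proof.
move=> x0; have /andP[a1 a2] := dyadic_index_itv n x0.
have /andP[b1 b2] := dyadic_index_itv n.+1 x0.
move: (dyadic_index n x) (dyadic_index n.+1 x) a1 a2 b1 b2 => k l a1 a2 b1 b2.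
have e : x * 2 ^+ n.+1 = 2 * (x * 2 ^+ n) by rewrite exprS; ring.
rewrite e in b1 b2.
have l1 : (l < k.*2.+2)%N.
  by rewrite -(ltr_nat R); move: a2 b1; rewrite -!natr1 -muln2 natrM; lra.
have l2 : (k.*2 < l.+1)%N.
  by rewrite -(ltr_nat R); move: a1 b2; rewrite -!natr1 -muln2 natrM; lra.
lia.
Qed.

Lemma dyadic_floor_dist n x : 0 <= x -> `|x - dyadic_floor n x| <= 2^-1 ^+ n.
Proof.
move=> x0; have /andP[a1 a2] := dyadic_index_itv n x0.
have -> : x - dyadic_floor n x = (x * 2 ^+ n - (dyadic_index n x)%:R) * 2^-1 ^+ n.
  by rewrite mulrBl -mulrA [2 ^+ n * _]mulrC half_expK mulr1.
rewrite normrM (gtr0_norm (h0 n)) ler_piMl ?(ltW (h0 n))//.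
by rewrite ler_norml; move: a1 a2; rewrite -natr1; lra.
Qed.

Definition dyadic_regular f g N := forall n i, (N <= n)%N -> (i < 2 ^ n)%N ->
  `|f (i.+1%:R * 2^-1 ^+ n) - f (i%:R * 2^-1 ^+ n)| <= (2^-1 ^+ n) `^ g.

Definition locally_holder f g := exists C h0 : R, [/\ 0 < C, 0 < h0 &
  forall x y, 0 <= x < 1 -> 0 <= y < 1 -> `|x - y| <= h0 ->
    `|f x - f y| <= C * `|x - y| `^ g].

(** Each point is the limit of its dyadic approximations, whose consecutive steps are
dyadic increments; summing the geometric series bounds the oscillation at level [n]
by a constant times [2^(-n g)]. Two points at distance at most [2^-n] have equal or
neighbouring approximations at level [n]. *)
Lemma dyadic_chaining f g N : continuous f -> 0 < g -> dyadic_regular f g N ->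
  locally_holder f g.
Proof.
move=> cf g0 Hf.
pose rho : R := 2^-1 `^ g.
have rho0 : 0 < rho by rewrite powR_gt0// invr_gt0.
have /andP[_ rho1] : 0 <= rho < 1 by exact: half_powR_itv g0.
have i2 : 0 <= 2^-1 :> R by rewrite invr_ge0.
have hg n : h n `^ g = rho ^+ n.
  by rewrite /h /rho -(powR_mulrn n i2) -(powR_mulrn n (powR_ge0 _ _)) powRAC.
have step n x : 0 <= x < 1 -> (N <= n.+1)%N ->
    `|f (dyadic_floor n.+1 x) - f (dyadic_floor n x)| <= rho ^+ n.+1.
  move=> xI Nn; have /andP[x0 _] := xI.
  have e : dyadic_floor n x = (dyadic_index n x).*2%:R * 2^-1 ^+ n.+1.
    by rewrite /dyadic_floor -muln2 natrM exprS; field.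
  have lt := dyadic_index_lt n.+1 xI.
  rewrite e /dyadic_floor; have [->|E] := dyadic_indexS n x0.
    by rewrite subrr normr0 exprn_ge0// ltW.
  rewrite E -hg; apply: Hf => //.
  by rewrite E in lt; exact: ltnW.
pose c := (1 - rho)^-1; have c0 : 0 < c by rewrite invr_gt0 subr_gt0.
have chain n m x : 0 <= x < 1 -> (N <= n)%N ->
    `|f (dyadic_floor (n + m) x) - f (dyadic_floor n x)| <= rho ^+ n * \sum_(i < m) rho ^+ i.+1.
  move=> xI Nn; elim: m => [|m IH].
    by rewrite addn0 subrr normr0 big_ord0 mulr0.
  apply: le_trans (ler_distD (f (dyadic_floor (n + m) x)) _ _) _.
  rewrite big_ord_recr /= mulrDr addrC; apply: lerD => //.
  by rewrite addnS -exprD addnS; apply: step => //; rewrite ltnW// ltnS (leq_trans Nn)// leq_addr.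
have tail n x : 0 <= x < 1 -> (N <= n)%N -> `|f x - f (dyadic_floor n x)| <= c * rho ^+ n.
  move=> xI Nn; have /andP[x0 _] := xI.
  have cv : f (dyadic_floor (n + m) x) @[m --> \oo] --> f x.
    apply: continuous_cvg; first exact: cf.
    apply/cvgrPdist_le => e e0; have [M HM] := exp_half_lt e0.
    exists M => // m /= Mm; apply: (le_trans (dyadic_floor_dist _ x0)).
    have h1 := HM (n + m)%N (leq_trans Mm (leq_addl _ _)).
    apply: le_trans (ltW h1); rewrite ler_peMl ?ler1n// ?(ltW (h0 _))//.
  have cv2 : `|f (dyadic_floor (n + m) x) - f (dyadic_floor n x)| @[m --> \oo] --> `|f x - f (dyadic_floor n x)|.
    by apply: cvg_norm; apply: cvgB => //; exact: cvg_cst.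
  rewrite -(cvg_lim (@norm_hausdorff _ _) cv2).
  apply: limr_le; first by apply: cvgP cv2.
  apply: nearW => m; apply: (le_trans (chain n m x xI Nn)).
  rewrite mulrC ler_wpM2r ?exprn_ge0 ?(ltW rho0)//.
  apply: le_trans (_ : \sum_(i < m) rho ^+ i <= _).
    by apply: ler_sum => i _; rewrite exprS ler_piMl ?exprn_ge0 ?ltW.
  by apply: geometric_sum_le; rewrite rho1 ltW.
have same n x y : 0 <= x < 1 -> 0 <= y < 1 -> (N <= n)%N -> x <= y -> y - x <= h n ->
    `|f (dyadic_floor n y) - f (dyadic_floor n x)| <= rho ^+ n.
  move=> xI yI Nn xy yx; have /andP[x0 _] := xI; have /andP[y0 _] := yI.
  have /andP[a1 a2] := dyadic_index_itv n x0; have /andP[b1 b2] := dyadic_index_itv n y0.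
  have lt := dyadic_index_lt n yI.
  rewrite /dyadic_floor.
  have n2 : 0 < 2 ^+ n :> R by rewrite exprn_gt0.
  have yx' : y * 2 ^+ n - x * 2 ^+ n <= 1.
    by rewrite -mulrBl -[leRHS](half_expK n) ler_pM2r.
  have xy' : x * 2 ^+ n <= y * 2 ^+ n by rewrite ler_pM2r.
  move: (dyadic_index n x) (dyadic_index n y) a1 a2 b1 b2 lt => k l a1 a2 b1 b2 lt.
  have k1 : (k < l.+1)%N by rewrite -(ltr_nat R); lra.
  have k2 : (l < k.+2)%N.
    by rewrite -(ltr_nat R) -(natr1 k.+1); lra.
  have [kl|kl] : l = k \/ l = k.+1 by clear -k1 k2; lia.
    by rewrite kl subrr normr0 exprn_ge0// ltW.
  by rewrite kl -hg; apply: Hf => //; rewrite kl in lt; exact: ltnW.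
pose K := 1 + 2 * c.
have K0 : 0 < K by rewrite /K; lra.
exists (K / rho), (h N); split; [by rewrite divr_gt0|exact: h0|].
have main x y : 0 <= x < 1 -> 0 <= y < 1 -> x <= y -> y - x <= h N ->
    `|f x - f y| <= K / rho * (y - x) `^ g.
  move=> xI yI; rewrite le_eqVlt => /orP[/eqP->|xy] hN.
    by rewrite !subrr normr0 mulr_ge0 ?powR_ge0// divr_ge0 ?ltW.
  have yx0 : 0 < y - x by rewrite subr_gt0.
  have ex : exists m, h m < y - x.
    have [M HM] := exp_half_lt yx0; exists M; apply: le_lt_trans (HM M (leqnn M)).
    by rewrite ler_peMl ?ler1n// ltW// h0.
  case: (ex_minnP ex) => m hm mmin.
  have Nm : (N < m)%N.
    rewrite ltnNge; apply/negP => mN; move: hm; rewrite ltNge => /negP; apply.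
    by apply: (le_trans hN); apply: ler_wiXn2l => //; rewrite invf_le1 ?ler1n.
  case: m hm mmin Nm => // n hn nmin; rewrite ltnS => Nn.
  have yxn : y - x <= h n by rewrite leNgt; apply/negP => /nmin; rewrite ltnn.
  apply: le_trans (_ : K * rho ^+ n <= _).
    apply: le_trans (ler_distD (f (dyadic_floor n x)) _ _) _.
    have t1 := tail n x xI Nn; have t2 := tail n y yI Nn.
    have t3 := same n x y xI yI Nn (ltW xy) yxn.
    have := ler_distD (f (dyadic_floor n y)) (f (dyadic_floor n x)) (f y).
    rewrite [`|f (dyadic_floor n y) - f y|]distrC [`|f (dyadic_floor n x) - f (dyadic_floor n y)|]distrC.
    by rewrite /K; move: (rho ^+ n) t1 t2 t3 => r; lra.
  rewrite -mulrA ler_wpM2l ?(ltW K0)// ler_pdivlMl// -exprS -hg.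
  by apply: ge0_ler_powR; rewrite ?nnegrE ?(ltW g0) ?(ltW (h0 _)) ?(ltW yx0) ?(ltW hn).
move=> x y xI yI; have [xy|/ltW yx] := leP x y.
  by rewrite [`|x - y|]distrC ger0_norm ?subr_ge0//; exact: main.
by rewrite [`|f x - f y|]distrC ger0_norm ?subr_ge0//; exact: main.
Qed.

End chaining.

(** * Almost sure Hoelder continuity *)

Section kolmogorov.
Context {d : measure_display} {T : measurableType d} {R : realType}.
Variable P : probability T R.

(** From [exp z = (exp (z/k))^k >= (z/k)^k]. *)
Lemma expRN_le_pow (z : R) (k : nat) : 0 < z -> (0 < k)%N ->
  expR (- z) <= (k%:R / z) ^+ k.
Proof.
move=> z0 k0; have kp : 0 < k%:R :> R by rewrite ltr0n.
rewrite expRN -[(_ / z)]invrK invf_div exprVn lef_pV2 ?posrE ?expR_gt0 ?exprn_gt0 ?divr_gt0//.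
have -> : expR z = expR (z / k%:R) ^+ k.
  by rewrite -expRM_natl mulrCA divff ?mulr1// gt_eqF.
apply: lerXn2r; rewrite ?nnegrE ?expR_ge0 ?divr_ge0 ?(ltW z0)//.
by apply: le_trans (expR_ge1Dx _); rewrite lerDr.
Qed.

Lemma borel_cantelli_ae (F : nat -> set T) (C : R) : (forall n, measurable (F n)) ->
  (forall n, P (F n) <= (C * 2^-1 ^+ n)%:E)%E ->
  {ae P, forall w, exists N, forall n, (N <= n)%N -> ~ F n w}.
Proof.
move=> mF HF; exists (lim_sup_set F); split.
- by apply: bigcap_measurable => // n _; apply: bigcup_measurable.
- apply: lim_sup_set_cvg0 => //.
  apply: (@le_lt_trans _ _ (`|C| * 2)%:E); last exact: ltry.
  apply: lime_le; first by apply: is_cvg_nneseries => n _ _; exact: measure_ge0.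
  apply: nearW => n; rewrite big_mkord.
  apply: (@le_trans _ _ (\sum_(i < n) (`|C| * 2^-1 ^+ i)%:E)%E).
    apply: lee_sum => i _; apply: (le_trans (HF i)); rewrite lee_fin.
    by rewrite ler_wpM2r ?exprn_ge0 ?invr_ge0// ler_norm.
  rewrite sumEFin lee_fin -mulr_sumr ler_wpM2l//.
  apply: le_trans (@geometric_sum_le R 2^-1 n _) _.
    by rewrite invr_ge0 invf_lt1 ?ltr1n//= ler0n.
  by have -> : (1 - 2^-1)^-1 = 2 :> R; [field|].
- move=> w /= h n _; apply: contrapT => h2; apply: h; exists n => m nm Fm.
  by apply: h2; exists m.
Qed.

Variables (alpha : R) (B : R -> {RV P >-> R}).
Hypothesis alpha0 : 0 < alpha.
Hypothesis hB : fractional_brownian_motion alpha B.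

(** The probability that one of the [2^n] increments at level [n] exceeds [2^(-n g)] is
at most [2^n] times a Gaussian tail at [2^(n (alpha - g))] standard deviations, which
is smaller than any power of [2^-n]. *)
Lemma fbm_dyadic_regular (g : R) : 0 < g -> g < alpha ->
  {ae P, forall w, exists N, dyadic_regular (fun t => B t w) g N}.
Proof.
move=> g0 ga.
have ag : 0 < alpha - g by rewrite subr_gt0.
pose h n : R := 2^-1 ^+ n.
have h0 n : 0 < h n by rewrite exprn_gt0// invr_gt0.
have h1 n : h n <= 1 by rewrite exprn_ile1 ?invr_ge0// invf_le1 ?ler1n.
(* The degree of the power that beats the number of increments. *)
pose k := (Num.truncn (alpha - g)^-1).+1.
have kag : 1 <= k%:R * (alpha - g).
  have i0 : 0 <= (alpha - g)^-1 by rewrite invr_ge0 ltW.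
  have /andP[_ /ltW] := Num.Theory.truncn_itv i0.
  by rewrite -/k -ler_pdivrMr// div1r.
pose G n i := [set w | h n `^ g < `|B (i.+1%:R * h n) w - B (i%:R * h n) w|].
have mG n i : measurable (G n i).
  have := RV_measurable (B (i.+1%:R * h n) - B (i%:R * h n) : {RV P >-> R})%R (measurable_abs_gt 0 (h n `^ g)).
  congr measurable; apply/seteqP; split=> w /=; by rewrite subr0.
pose C : R := expR 2 * (128 * k%:R) ^+ k.
have PG n i : (P (G n i) <= (C * h n ^+ 2)%:E)%E.
  have ne : i.+1%:R * h n != i%:R * h n.
    by rewrite -subr_eq0 -mulrBl -natr1 addrAC subrr add0r mul1r gt_eqF.
  have [_ ta] := fbm_increment alpha0 hB ne.
  apply: le_trans (ta (h n `^ g) (powR_ge0 _ _)) _; rewrite lee_fin /C -mulrA.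
  rewrite ler_wpM2l ?expR_ge0//.
  have -> : `|i.+1%:R * h n - i%:R * h n| = h n.
    by rewrite -mulrBl -natr1 addrAC subrr add0r mul1r gtr0_norm.
  set z := _ / _.
  have zE : z = (128 * h n `^ (2 * (alpha - g)))^-1.
    rewrite /z -powR_mulrn ?powR_ge0// -powRrM !invfM mulrCA; congr (_ * _).
    rewrite -!powRN -powRD ?(gt_eqF (h0 n)) ?implybT//; congr (_ `^ _); ring.
  have z0 : 0 < z by rewrite zE invr_gt0 mulr_gt0// powR_gt0.
  apply: le_trans (expRN_le_pow z0 (ltn0Sn _ : 0 < k)%N) _.
  rewrite zE invrK mulrA exprMn [k%:R * _]mulrC ler_wpM2l ?exprn_ge0 ?mulr_ge0//.
  rewrite -!powR_mulrn ?powR_ge0 ?(ltW (h0 n))// -powRrM.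
  apply: ger_powR; first by rewrite h0 h1.
  rewrite mulrAC -mulrA; lra.
pose F n := \big[setU/set0]_(i < 2 ^ n) G n i.
have mF n : measurable (F n) by apply: bigsetU_measurable.
have PF n : (P (F n) <= (C * 2^-1 ^+ n)%:E)%E.
  apply: (@le_trans _ _ (\sum_(i < 2 ^ n) P (G n i))%E).
    by apply: (@content_subadditive _ _ _ P) => // m _; exact: mG.
  apply: (@le_trans _ _ (\sum_(i < 2 ^ n) (C * h n ^+ 2)%:E)%E); first exact: lee_sum.
  rewrite sumEFin lee_fin sumr_const card_ord -[leLHS]mulr_natr natrX -mulrA.
  by rewrite expr2 -[h n * h n * _]mulrA half_expK mulr1.
apply: filterS (borel_cantelli_ae mF PF) => w [N HN]; exists N => n i Nn iN.
rewrite leNgt; apply/negP => H; apply: (HN n Nn).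
by rewrite /F -bigcup_mkord; exists i.
Qed.

(** Countably many exponents increasing to [alpha] suffice. *)
Lemma fbm_locally_holder : {ae P, forall w, forall g : R, 0 < g -> g < alpha ->
  locally_holder (fun t => B t w) g}.
Proof.
pose gs (n : nat) : R := alpha * (1 - (n.+2%:R)^-1).
have gsI n : 0 < gs n < alpha.
  have n1 : (n.+2%:R)^-1 < 1 :> R by rewrite invf_lt1 ?ltr1n.
  have n0 : 0 < (n.+2%:R)^-1 :> R by rewrite invr_gt0.
  by rewrite mulr_gt0 ?subr_gt0//= gtr_pMr// ltrBlDr ltrDl.
have H1 : {ae P, forall w, forall n, exists N, dyadic_regular (fun t => B t w) (gs n) N}.
  by apply: ae_foralln => n; have /andP[a b] := gsI n; exact: fbm_dyadic_regular.
have [_ _ _ H2] := hB.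
apply: filterS2 H1 H2 => w Hd Hc g g0 ga.
have [n gn] : exists n, g <= gs n.
  have c0 : 0 < 1 - g / alpha by rewrite subr_gt0 ltr_pdivrMr ?mul1r.
  have i0 : 0 <= (1 - g / alpha)^-1 by rewrite invr_ge0 ltW.
  have /andP[_ h] := Num.Theory.truncn_itv i0.
  exists (Num.truncn (1 - g / alpha)^-1); rewrite /gs -ler_pdivrMl// mulrC.
  rewrite lerBrDr -lerBrDl -[leRHS]invrK lef_pV2 ?posrE ?invr_gt0//.
  by apply: ltW; apply: lt_trans h _; rewrite ltr_nat.
have /andP[gs0 _] := gsI n.
have [N HN] := Hd n.
have [C [e [C0 e0 HC]]] := dyadic_chaining Hc gs0 HN.
exists C, (Order.min e 1); split=> //; first by rewrite lt_min e0 ltr01.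
move=> x y xI yI; rewrite le_min => /andP[xe x1]; apply: le_trans (HC x y xI yI xe) _.
rewrite ler_wpM2l ?(ltW C0)//; have := normr_ge0 (x - y).
rewrite le_eqVlt => /orP[/eqP <-|p]; first by rewrite !powR0 ?gt_eqF.
by apply: ger_powR; rewrite ?p.
Qed.

End kolmogorov.

(** * Negative moments *)

Section negative_moment.
Context {d : measure_display} {T : measurableType d} {R : realType}.
Variable P : probability T R.

(** Dyadic decomposition of [y] below [sigma]; the truncation [rho] makes it finite. *)
Lemma dyadic_layer_bound (s sigma rho y : R) (N : nat) : 0 <= s -> 0 < sigma -> 0 < rho ->
  0 <= y -> 2^-1 ^+ N * sigma <= rho ->
  (Order.max y rho) `^ (- s) <= sigma `^ (- s) +
    \sum_(j < N) (2^-1 ^+ j.+1 * sigma) `^ (- s) * (y <= 2^-1 ^+ j * sigma)%R%:R.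
Proof.
move=> s0 sg0 rho0 y0 HN; set m := Order.max y rho.
have m0 : 0 < m by rewrite lt_max rho0 orbT.
have sum0 : 0 <= \sum_(j < N) (2^-1 ^+ j.+1 * sigma) `^ (- s) * (y <= 2^-1 ^+ j * sigma)%R%:R.
  by apply: sumr_ge0 => j _; rewrite mulr_ge0 ?powR_ge0.
have [sm|ms] := leP sigma m.
  by rewrite ler_wpDr//; apply: powRN_le.
have ex : exists j, 2^-1 ^+ j * sigma <= m.
  by exists N; apply: (le_trans HN); rewrite le_max lexx orbT.
case: (ex_minnP ex) => -[|j] hj jmin.
  by move: hj; rewrite expr0 mul1r leNgt ms.
have jN : (j < N)%N by apply: jmin; apply: (le_trans HN); rewrite le_max lexx orbT.
have mj : m < 2^-1 ^+ j * sigma by rewrite ltNge; apply/negP => /jmin; rewrite ltnn.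
have yj : y <= 2^-1 ^+ j * sigma.
  by apply: le_trans (ltW mj); rewrite le_max lexx.
apply: le_trans (_ : (2^-1 ^+ j.+1 * sigma) `^ (- s) <= _).
  by apply: powRN_le => //; rewrite mulr_gt0// exprn_gt0// invr_gt0.
apply: ler_wpDl; first exact: powR_ge0.
rewrite (bigD1 (Ordinal jN)) //= yj mulr1 lerDl.
by apply: sumr_ge0 => i _; rewrite mulr_ge0 ?powR_ge0.
Qed.

Lemma integral_linear_combination (A : finType) (c : A -> R) (f : A -> T -> R) :
  (forall a, 0 <= c a) -> (forall a w, 0 <= f a w) ->
  (forall a, measurable_fun [set: T] (f a)) ->
  (\int[P]_w (\sum_a c a * f a w)%:E = \sum_a (c a)%:E * \int[P]_w (f a w)%:E)%E.
Proof.
move=> c0 f0 mf.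
have mcf a : measurable_fun [set: T] (fun w => (c a)%:E * (f a w)%:E)%E.
  by apply: measurable_funeM; exact/measurable_EFinP.
transitivity (\int[P]_w (\sum_a (c a)%:E * (f a w)%:E))%E.
  by apply: eq_integral => w _; rewrite -sumEFin.
rewrite ge0_integral_sum//; last by move=> a w _; rewrite -EFinM lee_fin mulr_ge0.
apply: eq_bigr => a _; rewrite ge0_integralZl//.
- exact/measurable_EFinP.
- by move=> w _; rewrite lee_fin.
- by rewrite lee_fin.
Qed.

(** On the layer of size [2^-j sqrt v] the power is a multiple of [2^(j s) v^(-s/2)], with
probability at most [3 * 2^-j], and [s < 1] makes the sum converge. *)
Lemma small_ball_negative_moment (s : R) : 0 < s < 1 -> exists C : R, 1 <= C /\
  forall (X : {RV P >-> R}) (v rho : R), 0 < v -> 0 < rho -> small_ball_at P X v ->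
  (\int[P]_w ((Order.max `|X w| rho) `^ (- s))%:E <= (C * Num.sqrt v `^ (- s))%:E)%E.
Proof.
move=> /andP[s0 s1]; pose x : R := 2^-1 `^ (1 - s).
have s10 : 0 < 1 - s by rewrite subr_gt0.
have i2 : 0 < 2^-1 :> R by rewrite invr_gt0.
have x1 : 0 <= x < 1 by exact: half_powR_itv s10.
have x10 : 0 < (1 - x)^-1 by rewrite invr_gt0 subr_gt0; case/andP: x1.
pose C := 1 + 3 * (2 `^ s * (1 - x)^-1).
exists C; split; first by rewrite lerDl !mulr_ge0 ?powR_ge0// ltW.
move=> X v rho v0 rho0 sb.
pose sigma := Num.sqrt v; have sg0 : 0 < sigma by rewrite sqrtr_gt0.
have rs0 : 0 < rho / sigma by rewrite divr_gt0.
have [N HN] := exp_half_lt rs0.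
have {}HN : 2^-1 ^+ N * sigma <= rho.
  rewrite -ler_pdivlMr//; apply: le_trans (ltW (HN N (leqnn N))).
  by rewrite ler_peMl ?ler1n// exprn_ge0// ltW.
(* Layer 0 is the whole space, layer [j+1] the ball of radius [2^-j sigma]. *)
pose c (i : nat) : R := (2^-1 ^+ i * sigma) `^ (- s).
pose A (i : nat) : set T := if i is j.+1 then [set w | `|X w| <= 2^-1 ^+ j * sigma] else setT.
have mA i : measurable (A i).
  by case: i => [|j] //=; exact: RV_measurable (measurable_abs_le _).
have mX : measurable_fun [set: T] X by exact: measurable_funPT.
apply: (@le_trans _ _ (\int[P]_w (\sum_(i < N.+1) c i * \1_(A i) w)%:E)%E).
  apply: ge0_le_integral => //=.
  - by move=> w _; rewrite lee_fin powR_ge0.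
  - apply/measurable_EFinP; apply: (measurableT_comp (measurable_powR _)).
    by apply: measurable_maxr => //; exact: measurableT_comp.
  - apply/measurable_EFinP; apply: measurable_sum => o.
    by apply: measurable_funM => //; exact: measurable_indic.
  - move=> w _; rewrite lee_fin.
    apply: le_trans (dyadic_layer_bound (ltW s0) sg0 rho0 (normr_ge0 (X w)) HN) _.
    rewrite big_ord_recl /= indicT /c expr0 !mul1r mulr1 lerD2l; apply: ler_sum => j _.
    rewrite indicE /=; case: (leP `|X w| (2^-1 ^+ j * sigma)) => h.
      by rewrite mem_set.
    by rewrite mulr0 mulr_ge0 ?powR_ge0.
rewrite (@integral_linear_combination _ (fun i : 'I_N.+1 => c i) (fun i => \1_(A i))); last 3 first.
- by move=> i; exact: powR_ge0.
- by move=> i w; rewrite indicE ler0n.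
- by move=> i; exact: measurable_indic.
apply: (@le_trans _ _ (\sum_(i < N.+1) (sigma `^ (- s) *
    (if nat_of_ord i is j.+1 then 3 * (2 `^ s * x ^+ j) else 1))%:E)%E).
  apply: lee_sum => i _; rewrite integral_indic// setIT.
  case: i => -[|j] /= _; first by rewrite probability_setT mule1 /c expr0 mul1r mulr1.
  have j0 : 0 < 2^-1 ^+ j :> R by rewrite exprn_gt0.
  have := sb (2^-1 ^+ j * sigma) (mulr_gt0 j0 sg0); rewrite -/sigma => hj.
  apply: (@le_trans _ _ (((2^-1 ^+ j.+1 * sigma) `^ (- s))%:E * (3 * (2^-1 ^+ j * sigma) / sigma)%:E)%E).
    by apply: lee_wpmul2l => //; rewrite lee_fin powR_ge0.
  rewrite -EFinM lee_fin le_eqVlt; apply/orP; left; apply/eqP.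
  rewrite powRM ?exprn_ge0 ?(ltW i2) ?(ltW sg0)//.
  have <- : (2^-1 ^+ j.+1) `^ (- s) * 2^-1 ^+ j = 2 `^ s * x ^+ j :> R.
    rewrite exprS powRM ?exprn_ge0 ?(ltW i2)//.
    have -> : 2^-1 `^ (- s) = 2 `^ s :> R.
      by rewrite -[2^-1]powR_inv1// -powRrM mulN1r opprK.
    rewrite -mulrA; congr (_ * _).
    rewrite /x -(powR_mulrn j (powR_ge0 _ _)) powRAC (powR_mulrn j (ltW i2)).
    by rewrite addrC powRD ?(gt_eqF j0) ?implybT// powRr1// ltW.
  by field; rewrite gt_eqF.
rewrite sumEFin lee_fin -mulr_sumr mulrC ler_wpM2r ?powR_ge0//.
rewrite big_ord_recl /= lerD2l -mulr_sumr ler_wpM2l// -mulr_sumr ler_wpM2l ?powR_ge0//.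
exact: geometric_sum_le.
Qed.

End negative_moment.

(** * The dimension of the image from below *)

Section image_energy.
Context {d : measure_display} {T : measurableType d} {R : realType}.
Variable P : probability T R.

(** Fatou's lemma: the lower limit has finite integral, so it is finite almost surely. *)
Lemma fatou_bounded_infinitely_often (X : nat -> T -> R) (M : R) :
  (forall k, measurable_fun [set: T] (X k)) -> (forall k w, 0 <= X k w) ->
  (forall k, (\int[P]_w (X k w)%:E <= M%:E)%E) ->
  {ae P, forall w, exists C, forall n, exists2 k, (n <= k)%N & X k w <= C}.
Proof.
move=> mX X0 HM.
pose f k w := (X k w)%:E.
have mf k : measurable_fun [set: T] (f k) by exact/measurable_EFinP.
have f0 k w : setT w -> (0 <= f k w)%E by move=> _; rewrite lee_fin.
have Lle (u : nat -> \bar R) (c : \bar R) : (forall k, u k <= c)%E -> (limn_einf u <= c)%E.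
  move=> uc; rewrite -[limn_einf u]/(limf_einf u \oo) limf_einfE.
  apply: ge_ereal_sup => _ [V FV <-]; have [n Vn] := filter_ex FV.
  by apply: le_trans (uc n); apply: ereal_inf_lbound; exists n.
have F := fatou P measurableT mf f0.
have L0 w : (0 <= limn_einf (f ^~ w))%E.
  rewrite -[limn_einf _]/(limf_einf (f ^~ w) \oo) limf_einfE.
  apply: le_ereal_sup_tmp; exists (ereal_inf ((f ^~ w) @` setT)); first by exists setT => //; exact: filterT.
  by apply: le_ereal_inf_tmp => _ [k _ <-]; exact: f0.
have mL : measurable_fun [set: T] (fun w => limn_einf (f ^~ w)).
  have mfN k : measurable_fun [set: T] (fun w => - f k w)%E by exact: measurableT_comp.
  exact: measurableT_comp (measurable_fun_limn_esup mfN).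
have iL : P.-integrable [set: T] (fun w => limn_einf (f ^~ w)).
  apply/integrableP; split=> //.
  under eq_integral do rewrite gee0_abs//.
  by apply: le_lt_trans F _; apply: le_lt_trans (Lle _ M%:E HM) _; rewrite ltry.
apply: filterS (integrable_ae measurableT iL) => w /(_ I) fw.
exists (fine (limn_einf (f ^~ w)) + 1) => n.
have : (ereal_inf ((f ^~ w) @` [set k | (n <= k)%N]) < (fine (limn_einf (f ^~ w)) + 1)%:E)%E.
  apply: (@le_lt_trans _ _ (limn_einf (f ^~ w))).
    rewrite -[limn_einf _]/(limf_einf (f ^~ w) \oo) limf_einfE.
    by apply: ereal_sup_ubound; exists [set k | (n <= k)%N] => //; exists n.
  by rewrite EFinD fineK// lteDl// lte_fin.
by move=> /ereal_inf_lt[_ [k /= nk <-]]; rewrite lte_fin => /ltW h; exists k.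
Qed.

Variables (alpha : R) (B : R -> {RV P >-> R}).
Hypothesis alpha0 : 0 < alpha.
Hypothesis hB : fractional_brownian_motion alpha B.

(** The expected kernel of the image is dominated by the Riesz kernel of exponent
[s * alpha], so the discrete energies of the images have bounded expectations and,
almost surely, stay bounded along a random subsequence, which is all that the
energy criterion needs. The truncation [e^alpha] corresponds to the scale [e]. *)
Lemma fbm_image_dimension (K : set R) (s : R) : compact K -> 0 < s < 1 ->
  carries_energy K (s * alpha) ->
  {ae P, forall w, (s%:E <= hausdorff_dim ((fun t => B t w : R) @` K))%E}.
Proof.
move=> cK /[dup] sI /andP[s0 s1] [C HC].
have [Cs [Cs1 HCs]] := small_ball_negative_moment P sI.
have Cs0 : 0 < Cs by exact: lt_le_trans Cs1.
pose e k : R := 2^-1 ^+ k.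
have e0 k : 0 < e k by rewrite exprn_gt0// invr_gt0.
have rho0 k : 0 < e k `^ alpha by exact: powR_gt0.
pose Fam := {A : finType & ((A -> R) * (A -> R))%type}.
have [S HS] : exists S : nat -> Fam, forall k, let p := (projT2 (S k)).1 in let x := (projT2 (S k)).2 in
    [/\ forall a, 0 <= p a, \sum_a p a = 1, forall a, K (x a) &
      forall G : projT1 (S k) -> projT1 (S k) -> R,
        (forall a b, x a != x b -> G a b <= `|x a - x b| `^ (- (s * alpha))) ->
        (forall a b, G a b <= e k `^ (- (s * alpha))) ->
        \sum_a \sum_b p a * p b * G a b <= C].
  suff H k : exists S : Fam, let p := (projT2 S).1 in let x := (projT2 S).2 in
    [/\ forall a, 0 <= p a, \sum_a p a = 1, forall a, K (x a) &
      forall G : projT1 S -> projT1 S -> R,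
        (forall a b, x a != x b -> G a b <= `|x a - x b| `^ (- (s * alpha))) ->
        (forall a b, G a b <= e k `^ (- (s * alpha))) ->
        \sum_a \sum_b p a * p b * G a b <= C] by have [S HS] := boolp.choice H; exists S.
  by have [A [p [x H]]] := HC (e k) (e0 k); exists (existT _ A (p, x)).
pose Ak k := projT1 (S k); pose p k : Ak k -> R := (projT2 (S k)).1.
pose x k : Ak k -> R := (projT2 (S k)).2.
pose ker k (a b : Ak k) (w : T) := (Order.max `|B (x k a) w - B (x k b) w| (e k `^ alpha)) `^ (- s).
have mker k a b : measurable_fun [set: T] (ker k a b).
  apply: (measurableT_comp (measurable_powR _)); apply: measurable_maxr => //.
  apply: measurableT_comp => //; apply: measurable_funB; exact: measurable_funPT.
have ker0 k a b w : 0 <= ker k a b w by exact: powR_ge0.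
pose X k w := discrete_energy (p k) (fun a => B (x k a) w) s (e k `^ alpha).
have XE k w : X k w = \sum_(ab : Ak k * Ak k) (p k ab.1 * p k ab.2) * ker k ab.1 ab.2 w.
  by rewrite /X /discrete_energy pair_bigA.
have rhoE k : (e k `^ alpha) `^ (- s) = e k `^ (- (s * alpha)).
  by rewrite -powRrM; congr (_ `^ _); ring.
have ker_ub k a b : (\int[P]_w (ker k a b w)%:E <= (e k `^ (- (s * alpha)))%:E)%E.
  apply: (@le_trans _ _ (\int[P]_w (cst (e k `^ (- (s * alpha)))%:E w))%E).
    apply: ge0_le_integral => //=.
    - by move=> w _; rewrite lee_fin.
    - exact/measurable_EFinP.
    - move=> w _; rewrite lee_fin -rhoE; apply: powRN_le; rewrite ?(ltW s0)//.
      by rewrite le_max lexx orbT.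
  by rewrite integral_cst//= probability_setT mule1.
have ker_fin k a b : (\int[P]_w (ker k a b w)%:E)%E \is a fin_num.
  rewrite ge0_fin_numE; first by apply: le_lt_trans (ker_ub k a b) _; rewrite ltry.
  by apply: integral_ge0 => w _; rewrite lee_fin.
have XM k : (\int[P]_w (X k w)%:E <= (Cs * C)%:E)%E.
  have [p0 p1 xK HG] := HS k.
  under eq_integral do rewrite XE.
  rewrite (@integral_linear_combination _ _ _ P _ (fun ab : Ak k * Ak k => p k ab.1 * p k ab.2)
     (fun ab w => ker k ab.1 ab.2 w)) //; last by move=> ab; exact: mulr_ge0 (p0 _) (p0 _).
  (* The expected kernel, normalised by the constant of the moment bound. *)
  pose G (a b : Ak k) := Cs^-1 * fine (\int[P]_w (ker k a b w)%:E)%E.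
  have := HG G _ _.
  have -> : (\sum_ab (p k ab.1 * p k ab.2)%:E * \int[P]_w (ker k ab.1 ab.2 w)%:E)%E =
    (Cs * \sum_a \sum_b p k a * p k b * G a b)%:E.
    rewrite (pair_bigA _ (fun a b => p k a * p k b * G a b)) /= mulr_sumr -sumEFin.
    apply: eq_bigr => ab _; rewrite -(fineK (ker_fin k ab.1 ab.2)) -EFinM; congr EFin.
    by rewrite /G; field; rewrite gt_eqF.
  move=> h; rewrite lee_fin ler_pM2l//; apply: h => a b.
  - move=> ab; rewrite /G mulrC ler_pdivrMr//.
    have [sb _] := fbm_increment alpha0 hB ab.
    have v0 : 0 < `|x k a - x k b| `^ (2 * alpha) by rewrite powR_gt0// normr_gt0 subr_eq0.
    have := HCs (B (x k a) - B (x k b))%R _ (e k `^ alpha) v0 (rho0 k) sb.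
    rewrite -[X in (X <= _)%E](fineK (ker_fin k a b)) lee_fin => /le_trans; apply.
    rewrite mulrC ler_wpM2r ?(ltW Cs0)// -powR12_sqrt ?powR_ge0// -!powRrM.
    rewrite le_eqVlt; apply/orP; left; apply/eqP; congr (_ `^ _).
    by field.
  - rewrite /G -lee_fin EFinM fineK//.
    apply: le_trans (ker_ub k a b).
    rewrite -[leRHS]mul1e; apply: lee_wpmul2r; first by apply: integral_ge0 => w _; rewrite lee_fin.
    by rewrite lee_fin invf_le1.
have mXk k : measurable_fun [set: T] (X k).
  rewrite (_ : X k = fun w => \sum_(ab : Ak k * Ak k) (p k ab.1 * p k ab.2) * ker k ab.1 ab.2 w); last exact/funext.
  apply: measurable_sum => ab; apply: measurable_funM => //; exact: mker.
have X0 k w : 0 <= X k w.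
  have [p0 _ _ _] := HS k.
  by rewrite XE; apply: sumr_ge0 => ab _; apply: mulr_ge0 => //; exact: mulr_ge0 (p0 _) (p0 _).
have [_ _ _ hc] := hB.
apply: filterS2 hc (fatou_bounded_infinitely_often mXk X0 XM) => w cw [M HM].
have cBK : compact ((fun t => B t w : R) @` K).
  by apply: continuous_compact => //; apply: continuous_subspaceT.
apply: (energy_hausdorff_dim (M := M)) => // rho rho0'.
have [d0 [/andP[d00 _] Hd0]] := powR_le_small alpha0 rho0'.
have [N HN] := exp_half_lt d00.
have [k Nk XkM] := HM N.
have [p0 p1 xK _] := HS k.
exists (Ak k), (p k), (fun a => B (x k a) w); split=> //.
  by move=> a; exists (x k a) => //; exact: xK.
apply: le_trans XkM; apply: ler_sum => a _; apply: ler_sum => b _.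
apply: ler_wpM2l; [exact: mulr_ge0 (p0 _) (p0 _)|apply: powRN_le; first exact: ltW].
  by rewrite lt_max rho0 orbT.
rewrite ge_max !le_max lexx /=; apply/orP; right; apply: Hd0.
rewrite e0 /=; apply: le_lt_trans (HN k Nk).
by rewrite ler_peMl ?ler1n// ltW// e0.
Qed.

End image_energy.

(** * The dimensions of the image *)

Section assembly.
Context {R : realType}.

Lemma continuous_at0_locally_constant (f : R -> \bar R) :
  (forall theta : R, 0 < theta <= 5^-1 -> f theta = f 0) -> continuous_at0 f.
Proof.
move=> H; apply: cvg_near_cst; rewrite near_withinE.
have h5 : 0 < 5^-1 :> R by rewrite invr_gt0.
apply: filterS (nbhsx_ballx (0 : R) _ h5) => t; rewrite /ball/= sub0r normrN => t5.
rewrite in_itv/= => /andP[]; rewrite le_eqVlt => /orP[/eqP <- //|t0] _.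
by apply: H; rewrite t0/= (le_trans (ler_norm t))// ltW.
Qed.

Lemma continuous_image_bounded (f : R -> R) (E : set R) : continuous f ->
  (forall x, E x -> 0 < x < 1) -> exists M, forall y, (f @` E) y -> `|y| <= M.
Proof.
move=> cf E01.
have : compact (f @` `[0, 1]%classic).
  by apply: continuous_compact; [exact: continuous_subspaceT|exact: segment_compact].
move=> /compact_bounded[M [_ HM]]; exists (M + 1) => _ [x Ex <-].
apply: (HM (M + 1)); first by rewrite ltrDl.
by exists x => //=; rewrite in_itv/=; have := E01 x Ex; lra.
Qed.

Lemma cf_set01 (I : set nat) (x : R) : cf_set I x -> 0 < x < 1.
Proof. by case. Qed.

Lemma cf_set_nonempty (I : set nat) : I `<=` [set n | (0 < n)%N] -> I !=set0 ->
  (cf_set I : set R) !=set0.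
Proof.
move=> Ipos [n In]; rewrite cf_setE//; exists (cfval (fun=> n)).
by exists (fun=> n).
Qed.

(** Tameness at [s * g] becomes tameness at [s] for any Hoelder exponent [g < a] with
[s * g] still above the dimension. *)
Lemma image_tame_cover (I : set nat) (f : R -> R) (a s : R) : I `<=` [set n | (0 < n)%N] ->
  0 < a -> (forall g, 0 < g -> g < a -> locally_holder f g) ->
  (hausdorff_dim (cf_set I : set R) < (s * a)%:E)%E -> tame_cover (f @` cf_set I) s.
Proof.
move=> Ipos a0 Hf; have := hausdorff_dim_ge0 (cf_set I : set R).
case E : (hausdorff_dim _) => [h| |] //; rewrite lee_fin lte_fin => h0 hs.
have s0 : 0 < s by rewrite -(pmulr_lgt0 _ a0); apply: le_lt_trans hs.
have ha : h / s < a by rewrite ltr_pdivrMr// mulrC.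
have hs0 : 0 <= h / s by rewrite divr_ge0// ltW.
pose g := (h / s + a) / 2; pose g' := (g + a) / 2.
have g0 : 0 < g by rewrite /g; lra.
have gg' : g < g' by rewrite /g' /g; lra.
have g'a : g' < a by rewrite /g' /g; lra.
have hg : h / s < g by rewrite /g; lra.
have [C [e [C0 e0 HC]]] := Hf g' (lt_trans g0 gg') g'a.
have -> : s = s * g / g by rewrite mulfK// gt_eqF.
apply: (tame_cover_holder (g' := g') (C := C) (h0 := e)) => //.
  move=> x y /cf_set01 x01 /cf_set01 y01; apply: HC; lra.
by apply: cf_set_tame_above_dim => //; rewrite E lte_fin mulrC -ltr_pdivrMr.
Qed.

(** Tameness above the Hausdorff dimension collapses the inequalities between the
Hausdorff, lower and upper intermediate dimensions for [theta <= 1/5]. *)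
Lemma intermediate_dims_continuous (E : set R) :
  (forall s : R, (hausdorff_dim E < s%:E)%E -> tame_cover E s) ->
  continuous_at0 (upper_intermediate_dim E) /\ continuous_at0 (lower_intermediate_dim E).
Proof.
move=> HE.
have up (theta : R) : 0 < theta <= 5^-1 -> (upper_intermediate_dim E theta <= hausdorff_dim E)%E.
  move=> tI; apply: lee_real_gt => s sE.
  have s0 : 0 <= s.
    by rewrite -lee_fin; apply: le_trans (ltW sE); exact: hausdorff_dim_ge0.
  by apply: tame_cover_upper_intermediate => //; exact: HE.
have lo (theta : R) := hausdorff_le_lower_intermediate E theta.
have lu (theta : R) := lower_intermediate_le_upper E theta.
split; apply: continuous_at0_locally_constant => theta tI.
- rewrite [RHS]/upper_intermediate_dim eqxx; apply/eqP; rewrite eq_le up//=.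
  exact: le_trans (lo theta) (lu theta).
- rewrite [RHS]/lower_intermediate_dim eqxx; apply/eqP; rewrite eq_le lo andbT.
  exact: le_trans (lu theta) (up theta tI).
Qed.

(** Exponents slightly below [s] satisfy the strict inequalities needed for the energy
argument; countably many of them determine the bound. *)
Lemma fbm_image_dimension_ge (d : measure_display) (T : measurableType d)
    (P : probability T R) (alpha : R) (B : R -> {RV P >-> R}) (I : set nat) (s : R) :
  0 < alpha -> fractional_brownian_motion alpha B -> I `<=` [set n | (0 < n)%N] ->
  0 < s <= 1 -> ((s * alpha)%:E <= hausdorff_dim (cf_set I : set R))%E ->
  {ae P, forall w, (s%:E <= hausdorff_dim ((fun t => B t w : R) @` cf_set I))%E}.
Proof.
move=> a0 hB Ipos /andP[s0 s1] sh.
pose r (n : nat) : R := s - s * (n.+2%:R)^-1.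
have rI n : 0 < r n < s.
  have n1 : (n.+2%:R)^-1 < 1 :> R by rewrite invf_lt1 ?ltr1n.
  have n0 : 0 < (n.+2%:R)^-1 :> R by rewrite invr_gt0.
  by rewrite /r subr_gt0 gtr_pMr// n1 /= ltrBlDr ltrDl mulr_gt0.
have H : {ae P, forall w, forall n,
    ((r n)%:E <= hausdorff_dim ((fun t => B t w : R) @` cf_set I))%E}.
  apply: ae_foralln => n; have /andP[r0 rs] := rI n.
  have ra0 : 0 < r n * alpha by exact: mulr_gt0.
  have rh : ((r n * alpha)%:E < hausdorff_dim (cf_set I : set R))%E.
    by apply: lt_le_trans sh; rewrite lte_fin ltr_pM2r.
  have [K [cK KF HK]] := cf_set_energy_below_dim Ipos ra0 rh.
  have r1 : 0 < r n < 1 by rewrite r0 (lt_le_trans rs).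
  apply: filterS (fbm_image_dimension a0 hB cK r1 HK) => w Hw.
  by apply: le_trans Hw _; apply: hausdorff_dim_mono; exact: image_subset.
apply: filterS H => w Hw; apply/lee_subgt0Pr => e e0; rewrite -EFinB.
have se : 0 <= s / e by rewrite divr_ge0 ?ltW.
have /andP[_ hn] := Num.Theory.truncn_itv se.
apply: le_trans (Hw (Num.truncn (s / e))); rewrite lee_fin /r lerD2l lerN2.
rewrite ler_pdivrMr// mulrC -ler_pdivrMr//.
by apply: ltW (lt_trans hn _); rewrite ltr_nat.
Qed.

End assembly.

Theorem corollary4p6 (R : realType) (d : measure_display) (T : measurableType d)
    (P : probability T R) (alpha : R) (halpha : 0 < alpha < 1)
    (B : R -> {RV P >-> R}) (hB : fractional_brownian_motion alpha B)
    (I : set nat) (hI0 : I !=set0) (hI : I `<` [set n | (0 < n)%N]) :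
  let F : set R := cf_set I in
  let h : \bar R := hausdorff_dim F in
  let BF (w : T) : set R := (fun t : R => B t w : R) @` F in
  [/\ {ae P, forall w, continuous_at0 (upper_intermediate_dim (BF w)) /\
                       continuous_at0 (lower_intermediate_dim (BF w))},
      (h < alpha%:E)%E ->
        {ae P, forall w, [/\ (h * alpha^-1%:E = hausdorff_dim (BF w))%E,
                            (hausdorff_dim (BF w) <= upper_box_dim (BF w))%E &
                            (upper_box_dim (BF w) < 1)%E]} &
      (alpha%:E <= h)%E ->
        {ae P, forall w, hausdorff_dim (BF w) = 1%E /\
                         has_box_dim (BF w) 1%E}].
Proof.
move=> F h BF; have /andP[a0 a1] := halpha.
have Ipos : I `<=` [set n | (0 < n)%N] by exact: properW.
have [x0 Fx0] := cf_set_nonempty (R := R) Ipos hI0.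
have BF0 w : BF w !=set0 by exists (B x0 w); exists x0.
have [_ _ _ hc] := hB.
(* For [h < alpha], tameness and energy meet at [h/alpha]. *)
have small : (h < alpha%:E)%E -> {ae P, forall w, (h * alpha^-1%:E = hausdorff_dim (BF w))%E /\
     forall s : R, (hausdorff_dim (BF w) < s%:E)%E -> tame_cover (BF w) s}.
  move=> ha.
  have lower : {ae P, forall w, (h * alpha^-1%:E <= hausdorff_dim (BF w))%E}.
    have := hausdorff_dim_ge0 F; rewrite -/h le_eqVlt => /orP[/eqP <-|hpos].
      by apply: aeW => w; rewrite mul0e hausdorff_dim_ge0.
    have hE : h = (fine h)%:E by rewrite fineK// ge0_fin_numE ?(ltW hpos)// (lt_trans ha)// ltry.
    move: hpos (ha); rewrite hE !lte_fin => h00 h0a; rewrite -EFinM.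
    apply: (fbm_image_dimension_ge a0 hB Ipos); last by rewrite divfK ?gt_eqF// -hE.
    by rewrite divr_gt0//= ler_pdivrMr// mul1r ltW.
  apply: filterS2 lower (fbm_locally_holder a0 hB) => w lw holw.
  have tame s : (h * alpha^-1%:E < s%:E)%E -> tame_cover (BF w) s.
    move=> hs; apply: (image_tame_cover Ipos a0 holw).
    by rewrite EFinM -lte_pdivrMr.
  have eqdim : (h * alpha^-1%:E = hausdorff_dim (BF w))%E.
    apply/eqP; rewrite eq_le lw /=; apply: lee_real_gt => s hs.
    apply: tame_cover_hausdorff_dim; last exact: tame.
    rewrite -lee_fin; apply: le_trans (ltW hs).
    by rewrite mule_ge0 ?hausdorff_dim_ge0// lee_fin invr_ge0 ltW.
  by split=> // s; rewrite -eqdim; exact: tame.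
(* For [alpha <= h], the image has full dimension and is tame because it is bounded. *)
have large : (alpha%:E <= h)%E -> {ae P, forall w, hausdorff_dim (BF w) = 1%E /\
     has_box_dim (BF w) 1%E /\
     forall s : R, (hausdorff_dim (BF w) < s%:E)%E -> tame_cover (BF w) s}.
  move=> ah.
  have lower : {ae P, forall w, (1%:E <= hausdorff_dim (BF w))%E}.
    by apply: fbm_image_dimension_ge a0 hB Ipos _ _; rewrite ?ltr01 ?lexx ?mul1r.
  apply: filterS2 lower hc => w lw cw.
  have [M HM] := continuous_image_bounded cw (@cf_set01 R I).
  have ub := bounded_upper_box HM.
  have hl := hausdorff_le_lower_box (BF0 w).
  have lu := lower_box_le_upper (BF w).
  have e1 : hausdorff_dim (BF w) = 1%E.
    by apply/eqP; rewrite eq_le lw andbT (le_trans hl)// (le_trans lu).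
  split=> //; split.
    split; apply/eqP; rewrite eq_le.
      by rewrite (le_trans lu ub) (le_trans lw hl).
    by rewrite ub (le_trans lw (le_trans hl lu)).
  by move=> s; rewrite e1 lte_fin => s1; exact: bounded_tame_cover s1 HM.
split.
- have [ha|ha] := ltP h alpha%:E.
    by apply: filterS (small ha) => w [_ H]; exact: intermediate_dims_continuous.
  by apply: filterS (large ha) => w [_ [_ H]]; exact: intermediate_dims_continuous.
- move=> ha; apply: filterS (small ha) => w [e1 tame]; split=> //.
    exact: le_trans (hausdorff_le_lower_box (BF0 w)) (lower_box_le_upper (BF w)).
  have lt1 : (hausdorff_dim (BF w) < 1)%E by rewrite -e1 lte_pdivrMr// mul1e.
  have := hausdorff_dim_ge0 (BF w).
  case: (hausdorff_dim (BF w)) tame lt1 => [b| |] // tame; rewrite lte_fin lee_fin => b1 b0.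
  (* Any exponent strictly between the dimension and 1. *)
  have b2 : (b < (b + 1) / 2)%R by lra.
  have b3 : ((b + 1) / 2 < 1)%R by lra.
  apply: le_lt_trans (tame_cover_upper_box b3 (tame _ _)) _; first by rewrite lte_fin.
  by rewrite lte_fin; lra.
- by move=> ha; apply: filterS (large ha) => w [e1 [e2 _]].
Qed.
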